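(* Let $n\in\mathbb{N}$, $\mu_1,\mu_2>0$, $p\in[0,1]$, $\omega\in[0,1]$, and let the clients' service times be i.i.d. copies of a hyperexponential random variable $B$ that is with probability $p$ exponentially distributed with mean $1/\mu_1$ and with probability $1-p$ exponentially distributed with mean $1/\mu_2$. Let $C_i(k,u)$, $\bar f^\circ_{k,u}(t)$, $\bar h^\circ_{k,u}$, $p_{k\ell,uv}(t)$, $P^\downarrow_{k,u}(t)$, $P^\uparrow_{k,u}(t)$ be as defined in the context. Then the $C_i(k,u)$ are determined recursively by: for $i = 1,\ldots,n-1$, $k = 1,\ldots,i$, and $u\geqslant 0$, $$C_i(k,u) = \inf_{t\geqslant 0} \Bigg(\omega \,\bar f^\circ_{k,u}(t) + (1-\omega) \,\bar h^\circ_{k,u} +\sum_{\ell=2}^{k} \int_{(0,t)} p_{k\ell,uv}(t) \,C_{i+1}(\ell,v) \,\mathrm{d}v+P^\downarrow_{k,u}(t)\, C_{i+1}(1,0) + P^\uparrow_{k,u}(t) \,C_{i+1}(k+1, u+t)\Bigg),$$ whereas, for $k=1,\ldots,n$ and $u\geqslant 0$, $$C_n(k,u) = (1-\omega) \,\bar h^\circ_{k,u}.$$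
   Context: Model. Clients $1,\ldots,n$ arrive punctually, in this order, at a single server that serves them in order of arrival without idling when clients are present. Service times are i.i.d. copies of $B$. Immediately after the arrival of client $i<n$, the time $t\geqslant 0$ until the arrival of client $i+1$ is chosen as a (Borel measurable) function of $i$, the number $k$ of clients then in the system (including the one just arrived and the one in service), and the elapsed service time $u$ of the client in service. In state $(k,u)$ the service time of the client in service is distributed as $B$ conditioned on $B>u$, independent of all other service times. A policy is a collection of such decision functions $\tau_j(\cdot,\cdot)\geqslant 0$, $j=1,\ldots,n-1$. Cost. $C_i(k,u)$ is the infimum over policies of the expected cost associated with the arrival of client $i$ onwards, given that immediately after this arrival there are $k$ clients in the system and the client in service has elapsed service time $u$. The cost is $\omega$ times the total time the server is idle between the arrival of client $i$ and the arrival of client $n$, plus $(1-\omega)\sum_{j=i}^n W_j$, where $W_j$ is the waiting time of client $j$ (from arrival to start of service). Notation. $\mathrm{E}(m,\lambda)$ denotes an Erlang random variable with shape $m$ and rate $\lambda$ (equal to $0$ if $m=0$), and $\mathrm{Bin}(m,q)$ a binomial random variable; Erlang variables appearing in the same expression are independent. Let $$\mathbb{P}(B>t)=p e^{-\mu_1 t}+(1-p)e^{-\mu_2 t},\quad \gamma_1(t)=\frac{p e^{-\mu_1 t}}{\mathbb{P}(B>t)},\quad \gamma_2(t)=\frac{(1-p) e^{-\mu_2 t}}{\mathbb{P}(B>t)}.$$ Idle time: let $\sigma_t[m,k]=\int_0^t\mathbb{P}(\mathrm{E}(m,\mu_1)+\mathrm{E}(k,\mu_2)\leqslant s)\,\mathrm{d}s$,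 $$\bar f_{k1}(t)=\sum_{m=0}^{k-1}\mathbb{P}(\mathrm{Bin}(k-1,p)=m)\,\sigma_t[m+1,k-1-m],\qquad \bar f_{k2}(t)=\sum_{m=0}^{k-1}\mathbb{P}(\mathrm{Bin}(k-1,p)=m)\,\sigma_t[m,k-m],$$ and $\bar f^\circ_{k,u}(t)=\gamma_1(u)\bar f_{k1}(t)+\gamma_2(u)\bar f_{k2}(t)$. Waiting time: with $\frac1\mu=\frac{p}{\mu_1}+\frac{1-p}{\mu_2}$, $\bar h_{1z}=0$ and $\bar h_{kz}=\frac{1}{\mu_z}+\frac{k-2}{\mu}$ for $k\geqslant 2$, $z=1,2$; $\bar h^\circ_{k,u}=\gamma_1(u)\bar h_{k1}+\gamma_2(u)\bar h_{k2}$. Transitions: $P^\uparrow_{k,u}(t)=\mathbb{P}(B>u+t)/\mathbb{P}(B>u)$, and $$P^\downarrow_{k,u}(t)=\sum_{m=0}^{k-1}\mathbb{P}(\mathrm{Bin}(k-1,p)=m)\Big(\gamma_1(u)\mathbb{P}(\mathrm{E}(m+1,\mu_1)+\mathrm{E}(k-1-m,\mu_2)\leqslant t)+\gamma_2(u)\mathbb{P}(\mathrm{E}(m,\mu_1)+\mathrm{E}(k-m,\mu_2)\leqslant t)\Big).$$ For $j=1,2$ let $$\chi_{vt,j}[a,b]=\mathbb{P}\big(t-v\leqslant \mathrm{E}(a,\mu_1)+\mathrm{E}(b,\mu_2)\leqslant t,\ \mathrm{E}(a,\mu_1)+\mathrm{E}(b,\mu_2)+\mathrm{E}(1,\mu_j)>t\big).$$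 For $\ell=2,\ldots,k$ and $0<v<t$, $$q_{k\ell,1,v}(t)=\sum_{m=0}^{k-\ell}\mathbb{P}(\mathrm{Bin}(k-\ell,p)=m)\big(p\,\chi_{vt,1}[m+1,k-\ell-m]+(1-p)\chi_{vt,2}[m+1,k-\ell-m]\big),$$ $$q_{k\ell,2,v}(t)=\sum_{m=0}^{k-\ell}\mathbb{P}(\mathrm{Bin}(k-\ell,p)=m)\big(p\,\chi_{vt,1}[m,k-\ell-m+1]+(1-p)\chi_{vt,2}[m,k-\ell-m+1]\big),$$ and $p_{k\ell,uv}(t)=\gamma_1(u)\frac{\partial}{\partial v}q_{k\ell,1,v}(t)+\gamma_2(u)\frac{\partial}{\partial v}q_{k\ell,2,v}(t)$. *)

(* Defs.v *)
From HB Require Import structures.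
From mathcomp Require Import all_boot all_order all_algebra.
From mathcomp Require Import all_classical all_reals all_analysis.

Set Implicit Arguments.
Unset Strict Implicit.
Unset Printing Implicit Defensive.

Import Order.TTheory GRing.Theory Num.Theory.
Import numFieldNormedType.Exports.

Local Open Scope classical_set_scope.
Local Open Scope ring_scope.

Section Model.
Context {R : realType}.

Definition hyperexp_prob (p mu1 mu2 : R) (A : set R) : \bar R :=
  (p%:E * exponential_prob mu1 A + (1 - p)%:E * exponential_prob mu2 A)%E.

Definition mutually_independent d (Omega : measurableType d)
    (P : probability Omega R) (I : pred nat) (X : nat -> {RV P >-> R}) : Prop :=
  forall (J : seq nat) (A : nat -> set R),
    uniq J -> {subset J <= I} -> (forall j, measurable (A j)) ->
    P (\big[setI/setT]_(j <- J) (X j @^-1` A j)) =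
    (\prod_(j <- J) P (X j @^-1` A j))%E.

(* [tau j k u] is the time between the arrivals of clients [j] and [j.+1] when,
   just after the arrival of client [j], there are [k] clients in the system and
   the client in service has elapsed service time [u].  Asking for measurability
   and nonnegativity at all arguments loses nothing: a decision function given
   for [1 <= j < n], [1 <= k <= j] and [0 <= u] can be extended by 0. *)
Definition policy (tau : nat -> nat -> R -> R) : Prop :=
  forall j k, measurable_fun [set: R] (tau j k) /\ forall u, 0 <= tau j k u.

(* Sample paths.  [s c] is the service time of client [c].  In state [(k, u)]
   just after the arrival of client [j], the clients present are
   [(j - k).+1, ..., j], and [(j - k).+1] is the one in service. *)

(* Time from the arrival of client [j] until the [m]-th departure after it,
   for [1 <= m <= k]. *)
Definition departure (s : nat -> R) (j k : nat) (u : R) (m : nat) : R :=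
  \sum_((j - k).+1 <= c < (j - k).+1 + m) s c - u.

(* Waiting time of client [j]: zero if the client finds the system empty, and
   otherwise the time until the client just ahead departs. *)
Definition waiting (s : nat -> R) (j : nat) (x : nat * R) : R :=
  if x.1 == 1%N then 0 else departure s j x.1 x.2 x.1.-1.

(* Idle time between the arrival of client [j] and that of client [j.+1], if
   the latter arrives [t] time units after the former. *)
Definition idle (s : nat -> R) (j : nat) (x : nat * R) (t : R) : R :=
  Num.max 0 (t - departure s j x.1 x.2 x.1).

Definition nb_departures (s : nat -> R) (j : nat) (x : nat * R) (t : R) : nat :=
  count (fun m => departure s j x.1 x.2 m <= t) (iota 1 x.1).

Definition next_state (s : nat -> R) (j : nat) (x : nat * R) (t : R) : nat * R :=
  let: (k, u) := x in
  let d := nb_departures s j x t in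
  if d == 0%N then (k.+1, u + t)
  else if (d < k)%N then ((k - d).+1, t - departure s j k u d)
  else (1%N, 0).

(* State just after the arrival of client [i + r], starting from state [x] just
   after the arrival of client [i]. *)
Fixpoint state (tau : nat -> nat -> R -> R) (s : nat -> R) (i : nat)
    (x : nat * R) (r : nat) : nat * R :=
  if r is r'.+1 then
    let y := state tau s i x r' in
    next_state s (i + r') y (tau (i + r')%N y.1 y.2)
  else x.

Definition path_cost (omega : R) (n : nat) (tau : nat -> nat -> R -> R)
    (i k : nat) (u : R) (s : nat -> R) : R :=
  let y j := state tau s i (k, u) (j - i) in
  omega * \sum_(i <= j < n) idle s j (y j) (tau j (y j).1 (y j).2) +
  (1 - omega) * \sum_(i <= j < n.+1) waiting s j (y j).

(* Given state [(k, u)] just after the arrival of client [i], the service times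
   have their original joint law conditioned on the service time of client
   [(i - k).+1], the one in service, being larger than [u]. *)
Definition expected_cost d (Omega : measurableType d) (P : probability Omega R)
    (S : nat -> {RV P >-> R}) (omega : R) (n : nat) (tau : nat -> nat -> R -> R)
    (i k : nat) (u : R) : \bar R :=
  let survives := [set x | u < S (i - k).+1 x] in
  ((fine (P survives))^-1%:E *
   \int[P]_(x in survives) (path_cost omega n tau i k u (S ^~ x))%:E)%E.

(* Extended-real valued, since a policy may have infinite expected cost. *)
Definition optimal_cost d (Omega : measurableType d) (P : probability Omega R)
    (S : nat -> {RV P >-> R}) (omega : R) (n i k : nat) (u : R) : \bar R :=
  ereal_inf [set expected_cost S omega n tau i k u | tau in policy].

End Model.

Section Quantities.
Context {R : realType}.
Variables (p mu1 mu2 : R).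
Local Notation leb := (@lebesgue_measure R).

(* Law of a sum of [m] independent exponentials with rate [lambda]. *)
Fixpoint erlang_prob (m : nat) (lambda : R) : set R -> \bar R :=
  if m is m'.+1 then
    pushforward (erlang_prob m' lambda \x exponential_prob lambda)%E
      (fun z : R * R => z.1 + z.2)
  else \d_(0 : R).

Definition erlang_sum_cdf (a b : nat) (t : R) : R :=
  fine ((erlang_prob a mu1 \x erlang_prob b mu2)%E
          [set z : R * R | z.1 + z.2 <= t]).

Definition survival (t : R) : R :=
  p * expR (- mu1 * t) + (1 - p) * expR (- mu2 * t).
Definition gamma1 (t : R) : R := p * expR (- mu1 * t) / survival t.
Definition gamma2 (t : R) : R := (1 - p) * expR (- mu2 * t) / survival t.

Definition sigma (m k : nat) (t : R) : R :=
  \int[leb]_(s in `[0, t]) erlang_sum_cdf m k s.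

Definition fbar1 (k : nat) (t : R) : R :=
  \sum_(0 <= m < k) binomial_pmf k.-1 p m * sigma m.+1 (k.-1 - m) t.
Definition fbar2 (k : nat) (t : R) : R :=
  \sum_(0 <= m < k) binomial_pmf k.-1 p m * sigma m (k - m) t.
Definition fbar (k : nat) (u t : R) : R :=
  gamma1 u * fbar1 k t + gamma2 u * fbar2 k t.

Definition mean_service : R := p / mu1 + (1 - p) / mu2.
Definition hbarz (k : nat) (muz : R) : R :=
  if (2 <= k)%N then muz^-1 + (k - 2)%:R * mean_service else 0.
Definition hbar (k : nat) (u : R) : R :=
  gamma1 u * hbarz k mu1 + gamma2 u * hbarz k mu2.

Definition P_up (u t : R) : R := survival (u + t) / survival u.

Definition P_down (k : nat) (u t : R) : R :=
  \sum_(0 <= m < k) binomial_pmf k.-1 p m *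
    (gamma1 u * erlang_sum_cdf m.+1 (k.-1 - m) t +
     gamma2 u * erlang_sum_cdf m (k - m) t).

Definition chi (muj : R) (a b : nat) (v t : R) : R :=
  fine ((erlang_prob a mu1 \x erlang_prob b mu2 \x erlang_prob 1 muj)%E
    [set z : R * R * R |
      t - v <= z.1.1 + z.1.2 <= t /\ t < z.1.1 + z.1.2 + z.2]).

Definition q1 (k l : nat) (v t : R) : R :=
  \sum_(0 <= m < (k - l).+1) binomial_pmf (k - l) p m *
    (p * chi mu1 m.+1 (k - l - m) v t + (1 - p) * chi mu2 m.+1 (k - l - m) v t).
Definition q2 (k l : nat) (v t : R) : R :=
  \sum_(0 <= m < (k - l).+1) binomial_pmf (k - l) p m *
    (p * chi mu1 m (k - l - m).+1 v t + (1 - p) * chi mu2 m (k - l - m).+1 v t).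

Definition p_trans (k l : nat) (u v t : R) : R :=
  gamma1 u * (fun v' => q1 k l v' t)^`()%classic v +
  gamma2 u * (fun v' => q2 k l v' t)^`()%classic v.

End Quantities.

(* Main.v *)
(** Conditioning on the survival of the client in service is undone by
    multiplying the cost by [P(B > u)].  The [total_cost] so obtained, of a
    fixed policy, satisfies the one-step equation
    [total_cost i k u = onestep (total_cost i.+1) k u (tau i k u)]: the states that client [i.+1]
    can meet split according to the number of departures, the [m]-th departure
    occurs after a time that is, with weights [p exp(-mu1 u)] and
    [(1 - p) exp(-mu2 u)], a binomial mixture of sums of Erlang variables, and
    it is independent of the later services.

    In the value iteration [value] that replaces the policy by an infimum over
    [t], every iterate is nonincreasing in [u], because the weights are; hence it
    is measurable and no continuity argument is needed.  For the same reason, and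
    because sums of Erlang variables have bounded densities, [onestep] grows at
    most linearly to the right of every [t].  So an infimum over [t >= 0] is one
    over rational [t], and choosing the first rational that is good enough gives
    measurable policies whose cost is arbitrarily close to the iterate.  The error
    made in one step is taken proportional to [P(B > u)], which [transition]
    preserves. *)
Require Import Defs.
From HB Require Import structures.
From mathcomp Require Import all_boot all_order all_algebra.
From mathcomp Require Import all_classical all_reals all_analysis.
From mathcomp Require Import measurable_realfun.
From mathcomp Require Import zify ring lra.

Set Implicit Arguments.
Unset Strict Implicit.
Unset Printing Implicit Defensive.
Import Order.TTheory GRing.Theory Num.Theory.
Import numFieldNormedType.Exports.
Local Open Scope classical_set_scope.
Local Open Scope ring_scope.

(** * Sums of exponential variables *)

(** The form of [p_trans] explains the normalization. The derivative of [chi] in [v] is [exp(-l v)]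
    times the density of an Erlang sum at [t - v], and averaging the two rates with weights [p] and
    [1 - p] turns the exponentials into [survival v]. This factor cancels the division by
    [survival v] that leads from a weighted value back to a conditional cost, so the integral terms
    of the statement are mixtures of laws of Erlang sums. The densities must be continuous at
    positive arguments for the derivative, and bounded for the growth estimate. That estimate is
    one-sided because, as a function of [t], the term [W k.+1 (u + t)] is only known to be
    nonincreasing: a near-optimal [t] is replaced by a rational slightly above it, never below. The
    cost after a transition depends on the departure time as well, through the later decisions.
    Independence is therefore needed for functionals of both the departure time and the later
    services, not just for products; this is why it is phrased with sigma-algebras generated by
    blocks of services. *)

Section density.
Local Open Scope ereal_scope.
Context d (T : measurableType d) (R : realType).
Variables (mu rho : {measure set T -> \bar R}) (f : T -> R).
Hypotheses (mf : measurable_fun [set: T] f) (f0 : forall x, (0 <= f x)%R).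
Hypothesis rhoE : forall A, measurable A -> rho A = \int[mu]_(x in A) (f x)%:E.

Import HBNNSimple.

(** Both sides are limits along the simple functions increasing to [g]; on a level set of a simple
    function the identity is [rhoE]. *)
Lemma ge0_integral_density (g : T -> \bar R) :
  measurable_fun [set: T] g -> (forall x, 0 <= g x) ->
  \int[rho]_x g x = \int[mu]_x (g x * (f x)%:E).
Proof.
move=> mg g0; pose h := nnsfun_approx measurableT mg.
have hcvg x : (EFin \o h n) x @[n --> \oo] --> g x.
  exact: cvg_nnsfun_approx.
have hnd x : {homo (fun n => (h n x)%:E) : a b / (a <= b)%N >-> a <= b}.
  by move=> a b ab; rewrite lee_fin; exact/lefP/nd_nnsfun_approx.
have -> : \int[rho]_x g x = limn (fun n => \int[rho]_x (h n x)%:E).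
  rewrite -monotone_convergence//.
  - by apply: eq_integral => x _; apply/esym/cvg_lim => //; exact: hcvg.
  - by move=> n; exact/measurable_EFinP.
  - by move=> n x _; rewrite lee_fin.
have mf' : measurable_fun [set: T] (EFin \o f) by exact/measurable_EFinP.
have -> : \int[mu]_x (g x * (f x)%:E) =
    limn (fun n => \int[mu]_x ((h n x)%:E * (f x)%:E)).
  rewrite -monotone_convergence//.
  - apply: eq_integral => x _; apply/esym/cvg_lim => //.
    by apply: cvgeZr => //; exact: hcvg.
  - by move=> n; apply: emeasurable_funM => //; exact/measurable_EFinP.
  - by move=> n x _; apply: mule_ge0; rewrite lee_fin.
  - by move=> x _ a b ab; apply: lee_wpmul2r; rewrite lee_fin//; exact/lefP/nd_nnsfun_approx.
congr (limn _); apply/funext => n.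
rewrite integralT_nnsfun sintegralE.
transitivity (\int[mu]_x (\sum_(r \in range (h n))
    (r%:E * ((\1_(h n @^-1` [set r]) x)%:E * (f x)%:E)))).
  rewrite ge0_integral_fsum//; last 2 first.
  - move=> r; apply: measurable_funeM; apply: emeasurable_funM => //.
    exact/measurable_EFinP.
  - move=> r x _; rewrite muleA; apply: mule_ge0; last by rewrite lee_fin.
    exact: nnfun_muleindic_ge0.
  apply: eq_fsbigr => r rh.
  have mA : measurable (h n @^-1` [set r]) by exact: measurable_funPTI.
  rewrite rhoE// integral_mkcond.
  have r0 : (0 <= r)%R by have /set_mem[x _ <-] := rh.
  rewrite ge0_integralZl//; last 2 first.
  - by apply: emeasurable_funM => //; exact/measurable_EFinP.
  - by move=> x _; apply: mule_ge0; rewrite lee_fin.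
  congr (_ * _); apply: eq_integral => x _.
  rewrite patchE indicE; case: ifPn; first by rewrite mul1e.
  by rewrite mul0e.
apply: eq_integral => x _.
rewrite [h n x]fimfunE -fsumEFin//.
rewrite ge0_mule_fsuml; last by move=> y; exact: nnfun_muleindic_ge0.
by apply: eq_fsbigr => r _; rewrite muleA -EFinM.
Qed.

End density.

(** * Lebesgue measure on the canonical measurable structure *)

Section lebesgue_default.
Context {R : realType}.
Local Open Scope ereal_scope.

(* [lebesgue_measure] lives on [R] with the measurable structure generated by
   half-open intervals, which is not the canonical one that products use.  [leb0]
   and, for the exponential law, [expo] below are the same set functions for the
   canonical structure. *)
Definition leb0 (A : set R) : \bar R := @lebesgue_measure R A.

Let leb00 : leb0 set0 = 0. Proof. exact: measure0. Qed.
Let leb0_ge0 A : 0 <= leb0 A. Proof. exact: measure_ge0. Qed.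
Let leb0_sigma : semi_sigma_additive leb0.
Proof. exact: (@measure_semi_sigma_additive _ _ _ (@lebesgue_measure R)). Qed.

HB.instance Definition _ := isMeasure.Build _ _ _ leb0 leb00 leb0_ge0 leb0_sigma.

Let leb0_sigma_finite : sigma_finite setT leb0.
Proof. exact: (@sigma_finiteT _ _ _ (@lebesgue_measure R)). Qed.

HB.instance Definition _ := Measure_isSigmaFinite.Build _ _ _ leb0
  leb0_sigma_finite.

Lemma measurable_id_measurableTypeR :
  measurable_fun [set: measurableTypeR R] (fun x : measurableTypeR R => x : R).
Proof. by move=> _ Y mY; rewrite setTI. Qed.

(** [leb0] is the image of Lebesgue measure under the identity between the two measurable
    structures, so this is a change of variables. *)
Lemma integral_leb0 (D : set R) (g : R -> \bar R) : measurable D ->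
  measurable_fun D g -> (forall x, D x -> 0 <= g x) ->
  \int[lebesgue_measure]_(x in D) g x = \int[leb0]_(x in D) g x.
Proof.
move=> mD mg g0.
have /= <- := @ge0_integral_pushforward _ _ _ _ _ _
  measurable_id_measurableTypeR (@lebesgue_measure R) D g mD mg _ => //.
by move=> x /set_mem; exact: g0.
Qed.

(** [mu] is repackaged as a measure on the structure that carries [lebesgue_measure], where the
    uniqueness theorem applies. *)
Lemma leb0_uniq (mu : {measure set R -> \bar R}) :
  (forall a b : R, leb0 `]a, b] = mu `]a, b]%classic) ->
  forall A, measurable A -> leb0 A = mu A.
Proof.
move=> H A mA.
pose mu' : set (measurableTypeR R) -> \bar R := mu.
have m0 : mu' set0 = 0 by exact: measure0.
have mge0 B : 0 <= mu' B by exact: measure_ge0.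
have ms : semi_sigma_additive mu' by exact: (@measure_semi_sigma_additive _ _ _ mu).
pose M := isMeasure.Build _ (measurableTypeR R) R mu' m0 mge0 ms.
pose m : {measure set (measurableTypeR R) -> \bar R} := HB.pack mu' M.
apply: (@lebesgue_measure_unique R m) => // _ [[a b] _ <-]; exact: H.
Qed.

Lemma leb0_itv (a b : R) (x y : bool) : (a <= b)%R ->
  leb0 [set` Interval (BSide x a) (BSide y b)] = (b - a)%:E.
Proof.
rewrite /leb0 lebesgue_measure_itv/= lte_fin le_eqVlt => /predU1P[->|->].
  by rewrite ltxx subrr.
by rewrite EFinB.
Qed.

Lemma measurable_addr (c : R) : measurable_fun [set: R] (fun x : R => (c + x)%R).
Proof. exact: measurable_funD. Qed.

Lemma measurable_subr (c : R) : measurable_fun [set: R] (fun x : R => (c - x)%R).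
Proof. exact: measurable_funB. Qed.

Lemma ge0_integral_leb0_shift (c : R) (g : R -> \bar R) :
  measurable_fun [set: R] g -> (forall x, 0 <= g x) ->
  \int[leb0]_x g (c + x)%R = \int[leb0]_x g x.
Proof.
move=> mg g0.
have <- := @ge0_integral_pushforward _ _ _ _ _ _ (measurable_addr c) leb0 setT g
  measurableT mg _ => //.
pose m : {measure set R -> \bar R} :=
  @measure_function_pushforward__canonical__measure_function_Measure
  _ _ R R R leb0 _ (measurable_addr c).
apply: (@eq_measure_integral _ _ _ _ leb0 m) => A mA _; apply/esym.
apply: (@leb0_uniq m) => // a b; rewrite /m /= /pushforward.
have -> : (fun x : R => (c + x)%R) @^-1` `]a, b]%classic = `](a - c)%R, (b - c)%R]%classic.
  by apply/seteqP; split => x /=; rewrite !in_itv/= ltrBlDl lerBrDl.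
have [ab|ba] := leP a b.
  by rewrite !leb0_itv ?lerB//; congr EFin; ring.
rewrite !set_itv_ge ?measure0// bnd_simp -leNgt; last exact: ltW.
by rewrite lerB// ltW.
Qed.

Lemma ge0_integral_leb0_refl (c : R) (g : R -> \bar R) :
  measurable_fun [set: R] g -> (forall x, 0 <= g x) ->
  \int[leb0]_x g (c - x)%R = \int[leb0]_x g x.
Proof.
move=> mg g0.
have <- := @ge0_integral_pushforward _ _ _ _ _ _ (measurable_subr c) leb0 setT g
  measurableT mg _ => //.
pose m : {measure set R -> \bar R} :=
  @measure_function_pushforward__canonical__measure_function_Measure
  _ _ R R R leb0 _ (measurable_subr c).
apply: (@eq_measure_integral _ _ _ _ leb0 m) => A mA _; apply/esym.
apply: (@leb0_uniq m) => // a b; rewrite /m /= /pushforward.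
have -> : (fun x : R => (c - x)%R) @^-1` `]a, b]%classic = `[(c - b)%R, (c - a)%R[%classic.
  apply/seteqP; split => x /=; rewrite !in_itv/= => /andP[h1 h2]; apply/andP; split; lra.
have [ab|ba] := leP a b.
  by rewrite !leb0_itv ?lerB//; congr EFin; ring.
rewrite !set_itv_ge ?measure0// bnd_simp -leNgt; last exact: ltW.
by rewrite lerB// ltW.
Qed.

End lebesgue_default.

(** * Convolutions and Erlang laws *)

Section convolution.
Context {R : realType}.
Local Open Scope ereal_scope.
Implicit Types m : probability R R.

Let measurable_add2 : measurable_fun [set: R * R] (fun z : R * R => (z.1 + z.2)%R).
Proof. exact: measurable_funD. Qed.

(** The convolution, written as the very pushforward that occurs in [erlang_prob], so that the two
    agree by unfolding. *)
Definition addlaw m1 m2 : set R -> \bar R :=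
  pushforward (m1 \x m2) (fun z : R * R => (z.1 + z.2)%R).

Section instance.
Variables m1 m2 : probability R R.
Let pm := @measure_function_pushforward__canonical__measure_function_Measure
  _ _ (R * R)%type R R (m1 \x m2) _ measurable_add2.
Let addlaw0 : addlaw m1 m2 set0 = 0. Proof. exact: (measure0 pm). Qed.
Let addlaw_ge0 A : 0 <= addlaw m1 m2 A. Proof. exact: (measure_ge0 pm). Qed.
Let addlaw_sigma : semi_sigma_additive (addlaw m1 m2).
Proof. exact: (@measure_semi_sigma_additive _ _ _ pm). Qed.
HB.instance Definition _ := isMeasure.Build _ _ _ (addlaw m1 m2) addlaw0 addlaw_ge0 addlaw_sigma.
Let addlaw_setT : addlaw m1 m2 setT = 1.
Proof.
rewrite /addlaw /pushforward preimage_setT -setXTT product_measure1E//.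
by rewrite [X in X * _]probability_setT [X in _ * X]probability_setT mule1.
Qed.
HB.instance Definition _ := Measure_isProbability.Build _ _ _ (addlaw m1 m2) addlaw_setT.
End instance.

Lemma ge0_integral_addlaw m1 m2 (g : R -> \bar R) :
  measurable_fun [set: R] g -> (forall x, 0 <= g x) ->
  \int[addlaw m1 m2]_x g x = \int[m1]_x \int[m2]_y g (x + y)%R.
Proof.
move=> mg g0.
rewrite /addlaw ge0_integral_pushforward// preimage_setT fubini_tonelli1//.
- exact: measurableT_comp.
- by move=> x; exact: g0.
Qed.

Lemma measurable_integral_shift (m : probability R R) (g : R -> \bar R) :
  measurable_fun [set: R] g -> (forall x, 0 <= g x) ->
  measurable_fun [set: R] (fun x => \int[m]_y g (x + y)%R).
Proof.
move=> mg g0.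
apply: (@measurable_fun_fubini_tonelli_F _ _ _ _ _ m (fun z : R * R => g (z.1 + z.2)%R)) => //.
exact: measurableT_comp.
Qed.

End convolution.

Section erlang.
Context {R : realType}.
Local Open Scope ereal_scope.
Implicit Types (l : R) (m : probability R R) (g : R -> \bar R).

Definition expo l (l0 : (0 < l)%R) : set R -> \bar R := exponential_prob l.

Section expo_instance.
Variables (l : R) (l0 : (0 < l)%R).
Let pm : probability (measurableTypeR R) R :=
  @exponential_distribution_exponential_prob__canonical__probability_measure_Probability R l l0.
Let expo0 : expo l0 set0 = 0. Proof. exact: (measure0 pm). Qed.
Let expo_ge0 A : 0 <= expo l0 A. Proof. exact: (measure_ge0 pm). Qed.
Let expo_sigma : semi_sigma_additive (expo l0).
Proof. exact: (@measure_semi_sigma_additive _ _ _ pm). Qed.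
HB.instance Definition _ := isMeasure.Build _ _ _ (expo l0) expo0 expo_ge0 expo_sigma.
Let expo_setT : expo l0 setT = 1. Proof. exact: (@probability_setT _ _ _ pm). Qed.
HB.instance Definition _ := Measure_isProbability.Build _ _ _ (expo l0) expo_setT.
End expo_instance.

Lemma measurable_exponential_pdf0 l : measurable_fun [set: R] (@exponential_pdf R l).
Proof. exact: measurable_exponential_pdf. Qed.

Lemma ge0_integral_expo l (l0 : (0 < l)%R) g :
  measurable_fun [set: R] g -> (forall x, 0 <= g x) ->
  \int[expo l0]_x g x = \int[leb0]_x (g x * (exponential_pdf l x)%:E).
Proof.
move=> mg g0; apply: ge0_integral_density => //.
- exact: measurable_exponential_pdf0.
- by move=> x; rewrite exponential_pdf_ge0// ltW.
- move=> A mA; rewrite -[RHS]integral_leb0//.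
    apply/measurable_funTS/measurable_EFinP; exact: measurable_exponential_pdf0.
  by move=> x _; rewrite lee_fin exponential_pdf_ge0// ltW.
Qed.

Lemma expo_gt l (l0 : (0 < l)%R) (u : R) : (0 <= u)%R ->
  expo l0 [set x | (u < x)%R] = (expR (- l * u))%:E.
Proof.
move=> u0.
have -> : [set x | (u < x)%R] = ~` `]-oo, u]%classic.
  by apply/seteqP; split => x /=; rewrite in_itv/= ltNge => /negP.
rewrite probability_setC//.
have e : expo l0 `]-oo, u]%classic = expo l0 `[0%R, u]%classic.
  rewrite /expo /exponential_prob integral_mkcond [RHS]integral_mkcond.
  apply: eq_integral => x _; rewrite !patchE !mem_setE !in_itv/=.
  case: (leP 0%R x) => //= x0; case: ifP => // _.
  by rewrite lt0_exponential_pdf.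
rewrite [X in 1 - X]e.
move: u0 {e}; rewrite le_eqVlt => /predU1P[<-|u0].
  rewrite set_itv1 mulr0 expR0 /expo /exponential_prob integral_set1.
  by rewrite sube0.
rewrite /expo exponential_prob_itv0c//.
by rewrite -[1]/(1%:E) -!EFinB; congr EFin; ring.
Qed.

Lemma expo_lt0 l (l0 : (0 < l)%R) : expo l0 `]-oo, 0%R[%classic = 0.
Proof.
rewrite /expo /exponential_prob integral0_eq// => x /=; rewrite in_itv/= => x0.
by rewrite lt0_exponential_pdf.
Qed.

Lemma eq_integral_ge0 m g h : m `]-oo, 0%R[%classic = 0 ->
  measurable_fun [set: R] g -> measurable_fun [set: R] h ->
  (forall x, 0 <= g x) -> (forall x, 0 <= h x) ->
  (forall x, (0 <= x)%R -> g x = h x) ->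
  \int[m]_x g x = \int[m]_x h x.
Proof.
move=> m0 mg mh g0 h0 gh; apply: ge0_ae_eq_integral => //.
exists `]-oo, 0%R[%classic; split => // x /= ghx; rewrite in_itv/= ltNge.
by apply/negP => x0; apply: ghx => _; exact: gh.
Qed.

Lemma addlaw_lt0 m1 m2 : m1 `]-oo, 0%R[%classic = 0 -> m2 `]-oo, 0%R[%classic = 0 ->
  addlaw m1 m2 `]-oo, 0%R[%classic = 0.
Proof.
move=> m10 m20.
pose f (x : R) : \bar R := (\1_(`]-oo, 0%R[%classic : set R) x)%:E.
have mf : measurable_fun [set: R] f by exact/measurable_EFinP.
have f0 x : 0 <= f x by rewrite lee_fin.
have -> : addlaw m1 m2 `]-oo, 0%R[%classic = \int[addlaw m1 m2]_x f x.
  by rewrite integral_indic// setIT.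
rewrite ge0_integral_addlaw//.
rewrite (@eq_integral_ge0 m1 _ (cst 0))//.
- by rewrite integral0.
- exact: measurable_integral_shift.
- by move=> x; apply: integral_ge0.
- move=> x x0; rewrite (@eq_integral_ge0 m2 _ (cst 0))//.
  + by rewrite integral0.
  + by apply: measurableT_comp => //; exact: measurable_addr.
  + move=> y y0; rewrite /f indicE memNset//= in_itv/=; apply/negP.
    by rewrite -leNgt addr_ge0.
Qed.

Fixpoint erl (a : nat) l (l0 : (0 < l)%R) : probability R R :=
  if a is a'.+1 then addlaw (erl a' l0) (expo l0) else \d_(0%R : R).

Lemma erlang_probE a l (l0 : (0 < l)%R) : erlang_prob a l = erl a l0 :> (set R -> \bar R).
Proof. by elim: a => //= a ->. Qed.

Variables (mu1 mu2 : R) (mu1_gt0 : (0 < mu1)%R) (mu2_gt0 : (0 < mu2)%R).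

(* Law of E(a, mu1) + E(b, mu2). *)
Definition es a b : probability R R := addlaw (erl a mu1_gt0) (erl b mu2_gt0).

Lemma erl_ge0 a l (l0 : (0 < l)%R) : erl a l0 `]-oo, 0%R[%classic = 0.
Proof.
elim: a => [|a IH] /=; last by apply: addlaw_lt0 => //; exact: expo_lt0.
by rewrite diracE memNset//= in_itv/= ltxx.
Qed.

Lemma es_ge0 a b : es a b `]-oo, 0%R[%classic = 0.
Proof. by apply: addlaw_lt0; exact: erl_ge0. Qed.

Lemma erlang_sum_cdfE a b t : (erlang_sum_cdf mu1 mu2 a b t)%:E = es a b `]-oo, t]%classic.
Proof.
rewrite /erlang_sum_cdf (erlang_probE _ mu1_gt0) (erlang_probE _ mu2_gt0).
rewrite -[RHS]fineK//; last exact: fin_num_measure.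
Qed.

Lemma ge0_integral_es00 g : measurable_fun [set: R] g -> (forall x, 0 <= g x) ->
  \int[es 0 0]_x g x = g 0%R.
Proof.
move=> mg g0; rewrite ge0_integral_addlaw//= integral_dirac//.
  by rewrite diracT mul1e integral_dirac ?diracT ?mul1e ?addr0//; apply: measurableT_comp => //; exact: measurable_addr.
exact: measurable_integral_shift.
Qed.

(** The additional exponential sits inside the first Erlang variable; Tonelli moves it past the
    second one. In [ge0_integral_es2] it is already last and associativity suffices. *)
Lemma ge0_integral_es1 a b g : measurable_fun [set: R] g -> (forall x, 0 <= g x) ->
  \int[es a.+1 b]_x g x = \int[es a b]_x \int[expo mu1_gt0]_y g (x + y)%R.
Proof.
move=> mg g0.
have mgy x : measurable_fun [set: R] (fun y => g (x + y)%R).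
  by apply: measurableT_comp => //; exact: measurable_addr.
rewrite !ge0_integral_addlaw//=; first last.
- by move=> x; apply: integral_ge0.
- exact: measurable_integral_shift.
- by move=> x; apply: integral_ge0.
- exact: measurable_integral_shift.
apply: eq_integral => x _.
have m3 : measurable_fun setT (fun z : R * R => g (x + z.1 + z.2)%R).
  by apply: measurableT_comp => //; apply: measurable_funD => //; apply: measurable_funD.
rewrite (fubini_tonelli (fun z : R * R => g (x + z.1 + z.2)%R))//.
apply: eq_integral => y _; apply: eq_integral => z _ /=.
by rewrite addrAC.
Qed.

Lemma ge0_integral_es2 a b g : measurable_fun [set: R] g -> (forall x, 0 <= g x) ->
  \int[es a b.+1]_x g x = \int[es a b]_x \int[expo mu2_gt0]_y g (x + y)%R.
Proof.
move=> mg g0.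
have mgy x : measurable_fun [set: R] (fun y => g (x + y)%R).
  by apply: measurableT_comp => //; exact: measurable_addr.
rewrite !ge0_integral_addlaw//=; first last.
- by move=> x; apply: integral_ge0.
- exact: measurable_integral_shift.
apply: eq_integral => x _; rewrite ge0_integral_addlaw//.
apply: eq_integral => y _; apply: eq_integral => z _ /=.
by rewrite addrA.
Qed.

End erlang.
#[global] Opaque es.

(** * Bounded densities of Erlang sums *)

Section density_conv.
Context {R : realType}.
Local Open Scope ereal_scope.
Implicit Types (l M : R) (m : probability R R) (g : R -> \bar R).

(** Continuity is asked at positive points only, since the exponential density jumps at 0. The
    explicit bound [M] will control how fast the costs can grow with the interarrival time. *)
Definition has_density m (f : R -> R) M :=
  [/\ measurable_fun [set: R] f, forall x, (0 <= f x <= M)%R,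
      forall x, (x < 0)%R -> f x = 0%R,
      forall x : R, (0 < x)%R -> {for x, continuous f} &
      forall g, measurable_fun [set: R] g -> (forall x, 0 <= g x) ->
        \int[m]_x g x = \int[leb0]_x (g x * (f x)%:E)].

Lemma exponential_pdf_le l x : (0 < l)%R -> (0 <= exponential_pdf l x <= l)%R.
Proof.
move=> l0; rewrite (exponential_pdf_ge0 (ltW l0))/=.
have [x0|x0] := ltP x 0%R; first by rewrite lt0_exponential_pdf// ltW.
rewrite exponential_pdfE// ger_pMr// -expR0 ler_expR mulNr oppr_le0 mulr_ge0//.
exact: ltW.
Qed.

Lemma has_density_expo l (l0 : (0 < l)%R) : has_density (expo l0) (exponential_pdf l) l.
Proof.
split.
- exact: measurable_exponential_pdf0.
- by move=> x; exact: exponential_pdf_le.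
- by move=> x; exact: lt0_exponential_pdf.
- by move=> x x0; apply: in_continuous_exponential_pdf; rewrite in_itv/= x0.
- exact: ge0_integral_expo.
Qed.

Lemma has_density_ext m m' f M M' : (M <= M')%R ->
  (forall g, measurable_fun [set: R] g -> (forall x, 0 <= g x) ->
     \int[m']_x g x = \int[m]_x g x) ->
  has_density m f M -> has_density m' f M'.
Proof.
move=> MM' mm' [mf fM f0 fc fE]; split => //.
- by move=> x; have /andP[-> /le_trans->] := fM x.
- by move=> g mg g0; rewrite mm'// fE.
Qed.

Lemma has_density_integral m f M : has_density m f M -> \int[leb0]_x (f x)%:E = 1.
Proof.
case=> mf fM f0 fc fE.
have := fE (cst 1) (measurable_cst _) (fun=> lee01).
rewrite integral_cst// mul1e [X in X = _]probability_setT => ->.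
by apply: eq_integral => x _; rewrite mul1e.
Qed.

Section convolution_step.
Variables (m : probability R R) (f : R -> R) (M l : R) (l0 : (0 < l)%R).
Hypothesis mfM : has_density m f M.

Let mf : measurable_fun [set: R] f. Proof. by case: mfM. Qed.
Let f_ge0 x : (0 <= f x)%R. Proof. by case: mfM => _ /(_ x)/andP[]. Qed.
Let f_le x : (f x <= M)%R. Proof. by case: mfM => _ /(_ x)/andP[]. Qed.

Let k (y : R) : R := (expR (l * y) * f y)%R.

Let mk : measurable_fun [set: R] k.
Proof.
by apply: measurable_funM => //; apply: measurableT_comp => //; exact: measurable_funM.
Qed.

Let intk (u : R) : (@lebesgue_measure R).-integrable `[0%R, u] (EFin \o k).
Proof.
apply: measurable_bounded_integrable => //.
- by rewrite [ltLHS](lebesgue_measure_itv `[0%R, u])/=; case: ifP => // _; rewrite -EFinB ltry.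
- exact: measurable_funTS.
- exists (expR (l * u) * M)%R; split; first by rewrite num_real.
  move=> x ux y /=; rewrite in_itv/= => /andP[y0 yu].
  rewrite ger0_norm ?mulr_ge0 ?expR_ge0// (le_trans _ (ltW ux))//.
  by rewrite ler_pM ?expR_ge0// ler_expR ler_pM2l.
Qed.

(** The convolution of [f] with the exponential density, with [expR (- l * x)] pulled out of the
    integral. What remains is a primitive of a function that is bounded on bounded intervals, hence
    continuous even where [f] is not. *)
Definition conv_pdf (x : R) : R :=
  if (0 <= x)%R then (l * expR (- l * x) * \int[lebesgue_measure]_(y in `[0%R, x]) k y)%R
  else 0%R.

Lemma conv_pdfE x : \int[leb0]_y (f y * exponential_pdf l (x - y))%:E = (conv_pdf x)%:E.
Proof.
rewrite /conv_pdf; case: ifPn => [x0|]; last first.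
  rewrite -ltNge => x0; rewrite integral0_eq// => y _.
  have [y0|y0] := ltP y 0%R; first by case: mfM => _ _ ->//; rewrite mul0r.
  rewrite lt0_exponential_pdf ?mulr0//; lra.
transitivity (\int[leb0]_(y in `[0%R, x]) ((l * expR (- l * x))%:E * (k y)%:E)).
  rewrite [RHS]integral_mkcond; apply: eq_integral => y _.
  rewrite patchE mem_setE in_itv/=.
  have [y0|y0] := ltP y 0%R; first by case: mfM => _ _ ->//; rewrite mul0r.
  have [yx|yx] := leP y x; last by rewrite lt0_exponential_pdf ?mulr0//; lra.
  rewrite exponential_pdfE ?subr_ge0// -EFinM /k; congr EFin.
  rewrite (_ : (- l * (x - y) = - l * x + l * y)%R); last by ring.
  by rewrite expRD; ring.
have mkE (D : set R) : measurable_fun D (fun y => (k y)%:E).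
  by apply/measurable_funTS/measurable_EFinP.
have k0 (D : set R) x1 : D x1 -> 0 <= (k x1)%:E.
  by move=> _; rewrite lee_fin mulr_ge0// expR_ge0.
rewrite ge0_integralZl//; last 2 first.
- exact: k0.
- by rewrite lee_fin mulr_ge0 ?expR_ge0// ltW.
rewrite [RHS]EFinM; congr (_ * _).
rewrite -integral_leb0//; last exact: k0.
by rewrite fineK//; apply: integrable_fin_num => //; exact: intk.
Qed.

Let mf2 : measurable_fun setT (fun z : R * R => (f z.2 * exponential_pdf l (z.1 - z.2))%:E).
Proof.
apply/measurable_EFinP; apply: measurable_funM.
  exact: measurableT_comp.
apply: measurableT_comp; first exact: measurable_exponential_pdf0.
exact: measurable_funB.
Qed.

Let mf2_ge0 z : 0 <= (f z.2 * exponential_pdf l (z.1 - z.2))%:E.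
Proof. by rewrite lee_fin mulr_ge0// exponential_pdf_ge0// ltW. Qed.

Let measurable_conv_pdf : measurable_fun [set: R] conv_pdf.
Proof.
apply/measurable_EFinP.
rewrite (_ : EFin \o _ = fun x => \int[leb0]_y (f y * exponential_pdf l (x - y))%:E); last first.
  by apply/funext => x; rewrite conv_pdfE.
exact: (@measurable_fun_fubini_tonelli_F _ _ _ _ _ leb0
  (fun z : R * R => (f z.2 * exponential_pdf l (z.1 - z.2))%:E)).
Qed.

(** The exponential density is at most [l] and [f] has mass one. The bound does not involve [M], so
    it does not deteriorate as more variables are added. *)
Let conv_pdf_le x : (0 <= conv_pdf x <= l)%R.
Proof.
rewrite -!lee_fin -conv_pdfE; apply/andP; split.
  by apply: integral_ge0 => y _; exact: (mf2_ge0 (x, y)).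
have lE : l%:E = \int[leb0]_y (l%:E * (f y)%:E).
  rewrite ge0_integralZl ?lee_fin//; last exact: ltW.
  - by rewrite (has_density_integral mfM) mule1.
  - exact/measurable_EFinP.
  - by move=> y _; rewrite lee_fin.
rewrite [leRHS]lE; apply: ge0_le_integral => //.
- by move=> y _; exact: (mf2_ge0 (x, y)).
- exact: (measurable_fun_pair2 x mf2).
- by apply: measurable_funeM; exact/measurable_EFinP.
- move=> y _; rewrite -EFinM lee_fin mulrC ler_wpM2r//.
  by have /andP[] := exponential_pdf_le (x - y)%R l0.
Qed.

Let conv_pdf_continuous (x : R) : (0 < x)%R -> {for x, continuous conv_pdf}.
Proof.
move=> x0.
pose F y : R := (\int[lebesgue_measure]_(z in `[0%R, y]) k z)%R.
have cF : {for x, continuous F}.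
  (* The primitive is taken over [[0, x + 1]] so that [x] is an interior point. *)
  have x10 : (0 <= x + 1)%R by lra.
  have x11 : (0 < x + 1)%R by lra.
  have /(continuous_within_itvP _ x11)[+ _ _] :=
    parameterized_integral_continuous x10 (intk (x + 1)).
  by apply; rewrite in_itv/= x0/= ltrDl.
have cE : {for x, continuous (fun y => l * expR (- l * y))%R}.
  apply: (@continuousM R R^o (cst l)); first exact: cst_continuous.
  apply: continuous_comp; last exact: continuous_expR.
  by apply: (@continuousM R R^o (cst (- l)%R) id) => //; exact: cst_continuous.
have cEF := continuousM cE cF.
have E : conv_pdf x = (l * expR (- l * x) * F x)%R by rewrite /conv_pdf (ltW x0).
suff : conv_pdf y @[y --> x] --> conv_pdf x by [].
rewrite E; apply: cvg_trans cEF; apply: near_eq_cvg.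
near=> y; rewrite /conv_pdf ifT// ltW//; near: y; exact: lt_nbhsr.
Unshelve. all: by end_near. Qed.

Lemma has_density_conv : has_density (addlaw m (expo l0)) conv_pdf l.
Proof.
have cc := conv_pdf_continuous; split => //.
- by move=> x x0; rewrite /conv_pdf leNgt x0.
- move=> g mg g0.
  rewrite ge0_integral_addlaw//.
  have mGy : measurable_fun setT (fun z : R * R => g (z.1 + z.2)%R).
    by apply: measurableT_comp => //; exact: measurable_funD.
  case: mfM => _ _ _ _ ->; last 2 first.
  - exact: measurable_integral_shift.
  - by move=> x; apply: integral_ge0.
  pose K (z : R * R) := g z.2 * (f z.1 * exponential_pdf l (z.2 - z.1))%:E.
  have mK : measurable_fun setT K.
    apply: emeasurable_funM; first exact: measurableT_comp.
    apply/measurable_EFinP; apply: measurable_funM; first exact: measurableT_comp.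
    apply: measurableT_comp; first exact: measurable_exponential_pdf0.
    exact: measurable_funB.
  have K0 z : 0 <= K z by rewrite mule_ge0//; exact: (mf2_ge0 (z.2, z.1)).
  (* The exponential variable is replaced by the sum as integration variable; the order of
     integration is exchanged afterwards. *)
  transitivity (\int[leb0]_y \int[leb0]_x K (y, x)).
    apply: eq_integral => y _.
    have mg' : measurable_fun [set: R] (fun x => g x * (exponential_pdf l (x - y))%:E).
      apply: emeasurable_funM => //; apply/measurable_EFinP.
      apply: measurableT_comp; first exact: measurable_exponential_pdf0.
      exact: measurable_funB.
    have g'0 x : 0 <= g x * (exponential_pdf l (x - y))%:E.
      by rewrite mule_ge0// lee_fin exponential_pdf_ge0// ltW.
    rewrite ge0_integral_expo//; last first.
      by apply: measurableT_comp => //; exact: measurable_addr.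
    have -> : \int[leb0]_x (g (y + x)%R * (exponential_pdf l x)%:E) =
              \int[leb0]_x (g (y + x)%R * (exponential_pdf l (y + x - y))%:E).
      by apply: eq_integral => x _; rewrite addrAC subrr add0r.
    rewrite (@ge0_integral_leb0_shift R y _ mg' g'0).
    rewrite -ge0_integralZr//; last by rewrite lee_fin.
    by apply: eq_integral => x _; rewrite /K/= -muleA -EFinM [(_ * f y)%R]mulrC.
  rewrite fubini_tonelli//.
  apply: eq_integral => x _; rewrite -conv_pdfE -ge0_integralZl//.
  - exact: (measurable_fun_pair2 x mf2).
  - by move=> y _; exact: (mf2_ge0 (x, y)).
Qed.

End convolution_step.
End density_conv.

Section es_density.
Context {R : realType} (mu1 mu2 : R) (mu1_gt0 : 0 < mu1) (mu2_gt0 : 0 < mu2).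
Local Open Scope ereal_scope.
Local Notation es := (es mu1_gt0 mu2_gt0).

(** The exponential added last bounds the density by its own rate; [mu1 + mu2] dominates both rates
    and serves all pairs [a], [b] at once. *)
Lemma es_has_density a b : (0 < a + b)%N ->
  exists f, has_density (es a b) f (mu1 + mu2)%R.
Proof.
have le1 : (mu1 <= mu1 + mu2)%R by rewrite lerDl ltW.
have le2 : (mu2 <= mu1 + mu2)%R by rewrite lerDr ltW.
have mshift x (g : R -> \bar R) : measurable_fun [set: R] g ->
    measurable_fun [set: R] (fun y => g (x + y)%R).
  by move=> mg; apply: measurableT_comp => //; exact: measurable_addr.
elim: b => [|b IH].
  rewrite addn0; elim: a => // a IH _.
  case: a IH => [_|a IH].
    exists (exponential_pdf mu1); apply: (has_density_ext le1 _ (has_density_expo mu1_gt0)).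
    move=> g mg g0; rewrite ge0_integral_es1// ge0_integral_es00//.
    - by apply: eq_integral => x _; rewrite add0r.
    - exact: measurable_integral_shift.
    - by move=> x; apply: integral_ge0.
  have [f fd] := IH isT.
  exists (conv_pdf f mu1); apply: (has_density_ext le1 _ (has_density_conv mu1_gt0 fd)).
  by move=> g mg g0; rewrite [RHS](ge0_integral_addlaw _ _ mg g0) (ge0_integral_es1 _ _ _ _ mg g0).
rewrite addnS => _.
have [/eqP|ab] := posnP (a + b)%N.
  rewrite addn_eq0 => /andP[/eqP-> /eqP->].
  exists (exponential_pdf mu2); apply: (has_density_ext le2 _ (has_density_expo mu2_gt0)).
  move=> g mg g0; rewrite ge0_integral_es2// ge0_integral_es00//.
  - by apply: eq_integral => x _; rewrite add0r.
  - exact: measurable_integral_shift.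
  - by move=> x; apply: integral_ge0.
have [f fd] := IH ab.
exists (conv_pdf f mu2); apply: (has_density_ext le2 _ (has_density_conv mu2_gt0 fd)).
by move=> g mg g0; rewrite [RHS](ge0_integral_addlaw _ _ mg g0) (ge0_integral_es2 _ _ _ _ mg g0).
Qed.

(** Only the properties in [has_density] matter, so some density is chosen. For [a = b = 0] the law
    is a point mass and the default [cst 0] is returned. *)
Definition es_pdf a b : R -> R :=
  xget (cst 0%R) [set f | has_density (es a b) f (mu1 + mu2)%R].

Lemma es_pdfP a b : (0 < a + b)%N -> has_density (es a b) (es_pdf a b) (mu1 + mu2)%R.
Proof.
move=> /es_has_density[f fd].
exact: (@xgetPex _ (cst 0%R) [set f | has_density (es a b) f (mu1 + mu2)%R] (ex_intro _ f fd)).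
Qed.

#[global] Opaque es_pdf.

Lemma es_itv a b (t t' : R) : (0 < a + b)%N -> (t <= t')%R ->
  es a b `]t, t']%classic <= ((mu1 + mu2) * (t' - t))%:E.
Proof.
move=> ab tt'; have [mf fM f0 fc fE] := es_pdfP ab.
pose I (x : R) : R := \1_(`]t, t']%classic) x.
have mI : measurable_fun [set: R] (EFin \o I).
  by apply/measurable_EFinP; apply: measurable_indic; exact: measurable_itv.
have I0 x : (0 <= I x)%R by [].
have -> : es a b `]t, t']%classic = \int[es a b]_x (I x)%:E.
  by rewrite integral_indic// setIT.
have -> : ((mu1 + mu2) * (t' - t))%:E = \int[leb0]_x ((mu1 + mu2)%:E * (I x)%:E).
  have e := @leb0_itv R t t' false false tt'.
  rewrite ge0_integralZl//.
  - by rewrite integral_indic// setIT [X in _ * X]e.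
  - by move=> x _; rewrite lee_fin.
  - by rewrite lee_fin addr_ge0// ltW.
rewrite fE//; apply: ge0_le_integral => //.
- by move=> x _; rewrite -EFinM lee_fin mulr_ge0//; have /andP[] := fM x.
- by apply: emeasurable_funM => //; exact/measurable_EFinP.
- exact: measurable_funeM.
- move=> x _; rewrite -!EFinM lee_fin mulrC ler_wpM2r//.
  by have /andP[] := fM x.
Qed.

End es_density.

(** * Idle times and transition densities as integrals against Erlang sums *)

Section erlang_quantities.
Context {R : realType} (p mu1 mu2 : R) (mu1_gt0 : 0 < mu1) (mu2_gt0 : 0 < mu2).
Local Notation es := (es mu1_gt0 mu2_gt0).
Local Notation es_pdf := (es_pdf mu1_gt0 mu2_gt0).

Lemma es_cdf_measurable a b : measurable_fun [set: R] (fun t => es a b `]-oo, t]%classic).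
Proof.
have -> : (fun t => es a b `]-oo, t]%classic) =
    (fun t => (\int[es a b]_x (if (x <= t)%R then 1 else 0))%E).
  apply/funext => t.
  have -> : es a b `]-oo, t]%classic = (\int[es a b]_x (\1_(`]-oo, t]%classic : set R) x)%:E)%E.
    by rewrite integral_indic// setIT.
  by apply: eq_integral => x _; rewrite indicE mem_setE in_itv/=; case: (x <= t).
apply: (@measurable_fun_fubini_tonelli_F _ _ _ _ _ (es a b)
  (fun z : R * R => if (z.2 <= z.1)%R then 1 else 0)%E).
- by apply: measurable_fun_ifT => //; apply: measurable_fun_ler.
- by move=> z; case: ifP.
Qed.

(** For [x >= 0] the set of [s] in [[0, t]] with [x <= s] has length [max 0 (t - x)]; Tonelli
    exchanges the integral over [s] with the law of the sum. So [sigma] is an expected idle time. *)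
Lemma sigmaE a b (t : R) : 0 <= t ->
  ((sigma mu1 mu2 a b t)%:E = \int[es a b]_x (Num.max 0 (t - x))%:E)%E.
Proof.
move=> t0.
have cdf0 s : 0 <= erlang_sum_cdf mu1 mu2 a b s.
  by rewrite -lee_fin (erlang_sum_cdfE mu1_gt0 mu2_gt0).
have mcdf : measurable_fun [set: R] (fun s => (erlang_sum_cdf mu1 mu2 a b s)%:E).
  under eq_fun do rewrite (erlang_sum_cdfE mu1_gt0 mu2_gt0).
  exact: es_cdf_measurable.
have m2 : measurable_fun setT (fun z : R * R =>
    if [&& 0 <= z.1, z.1 <= t & z.2 <= z.1] then 1%E else 0%E : \bar R).
  apply: measurable_fun_ifT => //.
  by apply: measurable_and; [exact: measurable_fun_ler|apply: measurable_and; exact: measurable_fun_ler].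
rewrite /sigma /Rintegral fineK.
  rewrite integral_leb0//; last 2 first.
  - exact: measurable_funTS.
  - by move=> x _; rewrite lee_fin.
  rewrite integral_mkcond/=.
  transitivity (\int[leb0]_s \int[es a b]_x
      (if [&& (0 <= s)%R, (s <= t)%R & (x <= s)%R] then 1 else 0))%E.
    apply: eq_integral => s _; rewrite patchE mem_setE in_itv/=.
    case: (0 <= s) => /=; last by rewrite integral0.
    case: (s <= t) => /=; last by rewrite integral0.
    rewrite (erlang_sum_cdfE mu1_gt0 mu2_gt0).
    have -> : es a b `]-oo, s]%classic = (\int[es a b]_x (\1_(`]-oo, s]%classic : set R) x)%:E)%E.
      by rewrite integral_indic// setIT.
    by apply: eq_integral => x _; rewrite indicE mem_setE in_itv/=; case: (x <= s).
  rewrite (fubini_tonelli _ m2); last by move=> z; case: ifP.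
  apply: eq_integral_ge0.
  - exact: es_ge0.
  - apply: (@measurable_fun_fubini_tonelli_G _ _ _ _ _ leb0 _ m2).
    by move=> z; case: ifP.
  - apply/measurable_EFinP; apply: measurable_maxr => //; exact: measurable_funB.
  - by move=> x; apply: integral_ge0 => s _; case: ifP.
  - by move=> x; rewrite lee_fin le_max lexx.
  move=> x x0.
  transitivity (\int[leb0]_s (\1_(`[x, t]%classic : set R) s)%:E)%E.
    apply: eq_integral => s _; rewrite indicE mem_setE in_itv/=.
    rewrite [X in if X then _ else _](_ : _ = (x <= s <= t)); first by case: (_ && _).
    by have [xs|] := leP x s; rewrite ?andbF ?andbT// (le_trans x0 xs).
  rewrite integral_indic// setIT.
  have [xt|tx] := leP x t; first by rewrite [LHS](leb0_itv true false xt) max_r// subr_ge0.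
  rewrite set_itv_ge ?bnd_simp -?ltNge// measure0 max_l// subr_le0; exact: ltW.
apply: integrable_fin_num => //.
apply: measurable_bounded_integrable => //.
- by rewrite [ltLHS](lebesgue_measure_itv `[0%R, t])/=; case: ifP => // _; rewrite -EFinB ltry.
- by apply/measurable_funTS/measurable_EFinP.
- exists 1; split; first by rewrite num_real.
  move=> x ux y /= _; rewrite ger0_norm// (le_trans _ (ltW ux))//.
  by rewrite -lee_fin (erlang_sum_cdfE mu1_gt0 mu2_gt0) probability_le1.
Qed.

Lemma integral_indic1 (m : probability R R) (A : set R) : measurable A ->
  m A = (\int[m]_x (\1_A x)%:E)%E.
Proof. by move=> mA; rewrite integral_indic// setIT. Qed.

Lemma addlaw_dirac (m : probability R R) (A : set R) : measurable A ->
  addlaw (\d_(0 : R)) m A = m A.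
Proof.
move=> mA.
have mf : measurable_fun [set: R] (fun x => (\1_A x : R)%:E) by exact/measurable_EFinP.
have f0 x : (0 <= (\1_A x : R)%:E)%E by rewrite lee_fin.
rewrite [LHS]integral_indic1// (ge0_integral_addlaw _ _ mf f0).
rewrite integral_dirac//; last exact: (measurable_integral_shift m mf f0).
by rewrite diracT mul1e; under eq_integral do rewrite add0r; rewrite -integral_indic1.
Qed.

Lemma erl1E (l : R) (l0 : 0 < l) (A : set R) : measurable A -> erl 1 l0 A = expo l0 A.
Proof. exact: (addlaw_dirac (expo l0)). Qed.

(** Given that the Erlang sum equals [y], the last exponential exceeds [t - y] with probability
    [exp(-l (t - y))]. The reflection [w = t - y] then makes [v] an upper limit of integration. *)
Lemma chiE (l : R) a b (v t : R) : 0 < l -> (0 < a + b)%N -> 0 <= v <= t ->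
  chi mu1 mu2 l a b v t =
  \int[lebesgue_measure]_(w in `[0, v]) (expR (- l * w) * es_pdf a b (t - w)).
Proof.
move=> l0 ab /andP[v0 vt].
rewrite /chi (erlang_probE _ mu1_gt0) (erlang_probE _ mu2_gt0) (erlang_probE _ l0).
have [mf fM f0 fc fE] := es_pdfP mu1_gt0 mu2_gt0 ab.
rewrite /Rintegral; congr fine.
pose phi (w : R) : \bar R := (if t - v <= w <= t then expR (- l * (t - w)) else 0)%:E.
have mphi : measurable_fun [set: R] phi.
  apply/measurable_EFinP; apply: measurable_fun_ifT => //.
    by apply: measurable_and; exact: measurable_fun_ler.
  apply: measurableT_comp => //; apply: measurable_funM => //; exact: measurable_funB.
have phi0 w : (0 <= phi w)%E by rewrite lee_fin; case: ifP => // _; exact: expR_ge0.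
transitivity (\int[es a b]_w phi w)%E.
  transitivity (\int[erl a mu1_gt0 \x erl b mu2_gt0]_z phi (z.1 + z.2)%R)%E; last first.
    by rewrite fubini_tonelli1// ?ge0_integral_addlaw//; apply: measurableT_comp => //; exact: measurable_funD.
  set A := [set z | _].
  transitivity (\int[erl a mu1_gt0 \x erl b mu2_gt0]_z erl 1 l0 (xsection A z))%E; first by [].
  apply: eq_integral => z _.
  have [zt|zt] := boolP (t - v <= z.1 + z.2 <= t); last first.
    have -> : xsection A z = set0.
      by apply/seteqP; split => y //; rewrite /xsection/= inE/= => -[] zt'; rewrite zt' in zt.
    by rewrite measure0 /phi (negbTE zt).
  have -> : xsection A z = [set y | t - (z.1 + z.2) < y].
    apply/seteqP; split => y; rewrite /xsection/= inE/=; first by case=> _; rewrite ltrBlDl.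
    by rewrite ltrBlDl.
  have mA : measurable [set y : R | t - (z.1 + z.2) < y].
    have -> : [set y : R | t - (z.1 + z.2) < y] = `]t - (z.1 + z.2), +oo[%classic.
      by apply/seteqP; split => y /=; rewrite in_itv/= andbT.
    exact: measurable_itv.
  rewrite [LHS](erl1E l0 mA) expo_gt /phi ?zt// subr_ge0.
  by have /andP[] := zt.
rewrite fE// -(@ge0_integral_leb0_refl R t); last 2 first.
- by apply: emeasurable_funM => //; exact/measurable_EFinP.
- by move=> x; rewrite mule_ge0// lee_fin; have /andP[] := fM x.
rewrite integral_leb0//; last 2 first.
- apply/measurable_funTS/measurable_EFinP; apply: measurable_funM.
    by apply: measurableT_comp => //; exact: measurable_funM.
  by apply: measurableT_comp => //; exact: measurable_funB.
- by move=> x _; rewrite lee_fin mulr_ge0 ?expR_ge0//; have /andP[] := fM (t - x).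
rewrite [RHS]integral_mkcond; apply: eq_integral => w _.
rewrite patchE mem_setE in_itv/= /phi.
rewrite [t - v <= _]lerD2l lerN2 gerBl andbC opprB subrKC.
by case: ifP => _; rewrite -EFinM ?mul0r.
Qed.

(** The fundamental theorem of calculus at [v]: the integrand of [chiE] is continuous there because
    [t - v] is positive. *)
Lemma is_derive_chi (l : R) a b (v t : R) : 0 < l -> (0 < a + b)%N -> 0 < v < t ->
  is_derive v 1 (fun v' => chi mu1 mu2 l a b v' t) (expR (- l * v) * es_pdf a b (t - v)).
Proof.
move=> l0 ab /andP[v0 vt].
have [mf fM f0 fc fE] := es_pdfP mu1_gt0 mu2_gt0 ab.
pose f w := expR (- l * w) * es_pdf a b (t - w).
have mfw : measurable_fun [set: R] f.
  apply: measurable_funM.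
    by apply: measurableT_comp => //; exact: measurable_funM.
  by apply: measurableT_comp => //; exact: measurable_funB.
have intf : (@lebesgue_measure R).-integrable `[0, t] (EFin \o f).
  apply: measurable_bounded_integrable => //.
  - by rewrite [ltLHS](lebesgue_measure_itv `[0%R, t])/=; case: ifP => // _; rewrite -EFinB ltry.
  - exact: measurable_funTS.
  - exists (mu1 + mu2); split; first by rewrite num_real.
    move=> x ux y /=; rewrite in_itv/= => /andP[y0 yu].
    have /andP[g0 gM] := fM (t - y).
    rewrite ger0_norm ?mulr_ge0 ?expR_ge0// (le_trans _ (ltW ux))// -[leRHS]mul1r.
    by rewrite ler_pM ?expR_ge0// -expR0 ler_expR mulNr oppr_le0 mulr_ge0// ltW.
have cf : {for v, continuous f}.
  apply: (@continuousM R R^o (fun w => expR (- l * w)) (fun w => es_pdf a b (t - w))).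
    apply: continuous_comp; last exact: continuous_expR.
    by apply: (@continuousM R R^o (cst (- l)) id) => //; exact: cst_continuous.
  apply: (@continuous_comp _ _ _ (fun w => t - w) (es_pdf a b)).
    by apply: (@continuousB _ R^o _ (cst t) id) => //; exact: cst_continuous.
  by apply: fc; rewrite subr_gt0.
have [df fe] := continuous_FTC1_closed vt intf v0 cf.
apply: (@near_eq_is_derive R R R (fun v' : R => \int[lebesgue_measure]_(w in `[0, v']) f w)).
  near=> w; rewrite chiE//; apply/andP; split; apply: ltW.
    by near: w; exact: lt_nbhsr.
  by near: w; exact: lt_nbhsl.
by apply: DeriveDef; [exact: df|rewrite -derive1E; exact: fe].
Unshelve. all: by end_near. Qed.

Lemma is_derive_big_nat n (h : nat -> R -> R) (dh : nat -> R) (x : R) :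
  (forall j, (j < n)%N -> is_derive x 1 (h j) (dh j)) ->
  is_derive x 1 (fun y => \sum_(0 <= j < n) h j y) (\sum_(0 <= j < n) dh j).
Proof.
elim: n => [|n IH] H.
  rewrite big_geq// (_ : (fun _ => _) = cst 0); first exact: is_derive_cst.
  by apply/funext => y; rewrite big_geq.
rewrite big_nat_recr//= (_ : (fun _ => _) = (fun y => \sum_(0 <= j < n) h j y) + h n).
  by apply: is_deriveD; [apply: IH => j jn; apply: H; exact: ltnW|exact: H].
by apply/funext => y; rewrite big_nat_recr.
Qed.

(** The rate of the client then in service enters the derivative of [chi] only through an
    exponential, so averaging over the two rates produces the common factor [survival v]. *)
Lemma derive1_q1 k l (v t : R) : 0 < v < t ->
  (fun v' => q1 p mu1 mu2 k l v' t)^`()%classic v =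
  survival p mu1 mu2 v *
  \sum_(0 <= j < (k - l).+1) binomial_pmf (k - l) p j * es_pdf j.+1 (k - l - j) (t - v).
Proof.
move=> vt; rewrite derive1E.
have D : is_derive v 1 (fun v' => q1 p mu1 mu2 k l v' t)
  (\sum_(0 <= j < (k - l).+1) binomial_pmf (k - l) p j *
    (p * (expR (- mu1 * v) * es_pdf j.+1 (k - l - j) (t - v)) +
    (1 - p) * (expR (- mu2 * v) * es_pdf j.+1 (k - l - j) (t - v)))).
  apply: is_derive_big_nat => j _.
  apply: is_deriveZ; apply: is_deriveD; apply: is_deriveZ; exact: is_derive_chi.
rewrite derive_val mulr_sumr; apply: eq_bigr => j _.
by rewrite /survival; ring.
Qed.

Lemma derive1_q2 k l (v t : R) : 0 < v < t ->
  (fun v' => q2 p mu1 mu2 k l v' t)^`()%classic v =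
  survival p mu1 mu2 v *
  \sum_(0 <= j < (k - l).+1) binomial_pmf (k - l) p j * es_pdf j (k - l - j).+1 (t - v).
Proof.
move=> vt; rewrite derive1E.
have D : is_derive v 1 (fun v' => q2 p mu1 mu2 k l v' t)
  (\sum_(0 <= j < (k - l).+1) binomial_pmf (k - l) p j *
    (p * (expR (- mu1 * v) * es_pdf j (k - l - j).+1 (t - v)) +
    (1 - p) * (expR (- mu2 * v) * es_pdf j (k - l - j).+1 (t - v)))).
  apply: is_derive_big_nat => j _.
  apply: is_deriveZ; apply: is_deriveD; apply: is_deriveZ;
  by apply: is_derive_chi => //; rewrite addnS.
rewrite derive_val mulr_sumr; apply: eq_bigr => j _.
by rewrite /survival; ring.
Qed.

End erlang_quantities.

(** * Binomial mixtures of Erlang sums *)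

Section mixture.
Context {R : realType} (p mu1 mu2 : R) (mu1_gt0 : 0 < mu1) (mu2_gt0 : 0 < mu2).
Hypothesis p01 : 0 <= p <= 1.
Local Notation es := (es mu1_gt0 mu2_gt0).
Local Notation es_pdf := (es_pdf mu1_gt0 mu2_gt0).
Local Open Scope ereal_scope.
Implicit Types (g h : R -> \bar R) (u t : R) (X Y : nat -> nat -> \bar R).

Let p0 : (0 <= p)%R. Proof. by case/andP: p01. Qed.
Let q0 : (0 <= 1 - p)%R. Proof. by rewrite subr_ge0; case/andP: p01. Qed.

(* Expectation of [X J (m - J)] for [J] distributed as Bin(m, p). *)
Definition bsum m X := \sum_(0 <= j < m.+1) (binomial_pmf m p j)%:E * X j (m - j)%N.

Lemma eq_bsum m X Y : (forall a b, (a + b)%N = m -> X a b = Y a b) -> bsum m X = bsum m Y.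
Proof.
move=> XY; rewrite /bsum; apply: eq_big_nat => j /andP[_ jm]; congr (_ * _).
by apply: XY; rewrite subnKC.
Qed.

Lemma bsum_ge0 m X : (forall a b, 0 <= X a b) -> 0 <= bsum m X.
Proof.
by move=> X0; apply: sume_ge0 => j _; rewrite mule_ge0// lee_fin binomial_pmf_ge0.
Qed.

Lemma le_bsum m X Y : (forall a b, (a + b)%N = m -> X a b <= Y a b) -> bsum m X <= bsum m Y.
Proof.
move=> XY; rewrite /bsum big_nat_cond [leRHS]big_nat_cond.
apply: lee_sum => j; rewrite andbT => /andP[_ jm].
by rewrite lee_wpmul2l ?lee_fin ?binomial_pmf_ge0// XY// subnKC.
Qed.

Lemma bsumD m X Y : (forall a b, 0 <= X a b) -> (forall a b, 0 <= Y a b) ->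
  bsum m (fun a b => X a b + Y a b) = bsum m X + bsum m Y.
Proof.
move=> X0 Y0; rewrite /bsum -big_split/=; apply: eq_bigr => j _.
by rewrite ge0_muleDr.
Qed.

Lemma bsumZ m (c : R) X : (forall a b, 0 <= X a b) ->
  bsum m (fun a b => c%:E * X a b) = c%:E * bsum m X.
Proof.
move=> X0; rewrite /bsum ge0_sume_distrr; last first.
  by move=> j _; rewrite mule_ge0// lee_fin binomial_pmf_ge0.
by apply: eq_bigr => j _; rewrite muleCA.
Qed.

Lemma bsumEFin m (X : nat -> nat -> R) :
  bsum m (fun a b => (X a b)%:E) = (\sum_(0 <= j < m.+1) binomial_pmf m p j * X j (m - j)%N)%:E.
Proof. by rewrite /bsum -sumEFin; apply: eq_bigr => j _; rewrite EFinM. Qed.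

Lemma binomial_pmfS0 m : binomial_pmf m.+1 p 0 = ((1 - p) * binomial_pmf m p 0)%R.
Proof. by rewrite /binomial_pmf !expr0 !mul1r !bin0 !subn0 !mulr1n exprS. Qed.

Lemma binomial_pmfSS m j : binomial_pmf m.+1 p j.+1 =
  (p * binomial_pmf m p j + (1 - p) * binomial_pmf m p j.+1)%R.
Proof.
rewrite /binomial_pmf binS subSS mulrnDr addrC; congr (_ + _)%R.
  by rewrite exprS -mulrA mulrnAr.
have [jm|mj] := ltnP j m; last by rewrite bin_small// !mulr0n mulr0.
have -> : (unstable.onem p ^+ (m - j) = (1 - p) * unstable.onem p ^+ (m - j.+1))%R.
  by rewrite -(subnSK jm) exprS.
by rewrite mulrCA mulrnAr.
Qed.

(** Conditioning on the outcome of one additional Bernoulli trial; for the weights this is Pascal's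
    rule. *)
Lemma bsumS m X : (forall a b, 0 <= X a b) ->
  bsum m.+1 X = p%:E * bsum m (fun a b => X a.+1 b) +
                (1 - p)%:E * bsum m (fun a b => X a b.+1).
Proof.
move=> X0.
have b0 n j : (0 <= binomial_pmf n p j)%R by exact: binomial_pmf_ge0.
(* [A j] and [B j] are the parts of the weight of [j] due to success and failure in the additional
   trial. [A] vanishes at [0] and [B] at [m.+1]. *)
pose A j := if j is j'.+1 then (p * binomial_pmf m p j')%:E else 0.
pose B j := ((1 - p) * binomial_pmf m p j)%:E.
have A0 j : 0 <= A j by case: j => //= j; rewrite lee_fin mulr_ge0.
have B0 j : 0 <= B j by rewrite lee_fin mulr_ge0.
transitivity (\sum_(0 <= j < m.+2) (A j * X j (m.+1 - j)%N + B j * X j (m.+1 - j)%N)).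
  apply: eq_bigr => j _; rewrite -ge0_muleDl//; congr (_ * _).
  case: j => [|j]; rewrite /A/B; first by rewrite add0e binomial_pmfS0.
  by rewrite -EFinD binomial_pmfSS.
rewrite big_split/=; congr (_ + _).
  rewrite big_nat_recl//= mul0e add0e /bsum ge0_sume_distrr; last first.
    by move=> j _; rewrite mule_ge0// lee_fin.
  by apply: eq_bigr => j _; rewrite EFinM muleA subSS.
rewrite big_nat_recr//= /B {2}/binomial_pmf bin_small// mulr0n mulr0 mul0e adde0.
rewrite /bsum ge0_sume_distrr; last by move=> j _; rewrite mule_ge0// lee_fin.
by apply: eq_big_nat => j /andP[_ jm]; rewrite EFinM muleA subSn.
Qed.

(* These are [survival u * gamma1 u] and [survival u * gamma2 u]. *)
Definition weight1 u : R := p * expR (- mu1 * u).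
Definition weight2 u : R := (1 - p) * expR (- mu2 * u).

Lemma weight1_ge0 u : (0 <= weight1 u)%R. Proof. by rewrite mulr_ge0// expR_ge0. Qed.
Lemma weight2_ge0 u : (0 <= weight2 u)%R. Proof. by rewrite mulr_ge0// expR_ge0. Qed.

Lemma survival_gt0 u : (0 < survival p mu1 mu2 u)%R.
Proof.
rewrite /survival; have := expR_gt0 (- mu1 * u); have := expR_gt0 (- mu2 * u).
move: p0 q0; nra.
Qed.

(* The expectation of [g D] on the event that the service in progress exceeds its
   elapsed time [u], where [D] is the time until the [m.+1]-st departure. *)
Definition mix u m g :=
  (weight1 u)%:E * bsum m (fun a b => \int[es a.+1 b]_x g x) +
  (weight2 u)%:E * bsum m (fun a b => \int[es a b.+1]_x g x).

Lemma mix_ge0 u m g : (forall x, 0 <= g x) -> 0 <= mix u m g.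
Proof.
move=> g0; apply: adde_ge0; apply: mule_ge0; rewrite ?lee_fin ?weight1_ge0 ?weight2_ge0//;
by apply: bsum_ge0 => a b; apply: integral_ge0.
Qed.

Lemma mixE u m g (F G : nat -> nat -> R) :
  (forall a b, (a + b)%N = m -> \int[es a.+1 b]_x g x = (F a b)%:E) ->
  (forall a b, (a + b)%N = m -> \int[es a b.+1]_x g x = (G a b)%:E) ->
  mix u m g = (survival p mu1 mu2 u *
     (gamma1 p mu1 mu2 u * \sum_(0 <= j < m.+1) binomial_pmf m p j * F j (m - j)%N +
      gamma2 p mu1 mu2 u * \sum_(0 <= j < m.+1) binomial_pmf m p j * G j (m - j)%N))%:E.
Proof.
move=> gF gG; rewrite /mix (eq_bsum gF) (eq_bsum gG) !bsumEFin -!EFinM -EFinD.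
congr EFin; rewrite /gamma1 /gamma2 -/(weight1 u) -/(weight2 u).
by have := survival_gt0 u; set s := survival _ _ _ _ => s0; field; rewrite gt_eqF.
Qed.

Lemma mix_idle k u t : (0 < k)%N -> (0 <= t)%R ->
  mix u k.-1 (fun x => (Num.max 0 (t - x))%:E) =
  (survival p mu1 mu2 u * fbar p mu1 mu2 k u t)%:E.
Proof.
case: k => // k _ t0.
rewrite (@mixE _ _ _ (fun a b => sigma mu1 mu2 a.+1 b t) (fun a b => sigma mu1 mu2 a b.+1 t));
  [|by move=> a b _; rewrite (sigmaE mu1_gt0 mu2_gt0)..].
rewrite /fbar /fbar1 /fbar2; congr (_ * (_ + _))%:E; congr (_ * _)%R.
by apply: eq_big_nat => j /andP[_ jk]; rewrite /= subSn.
Qed.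

Lemma es_cdfE a b t : \int[es a b]_x (if (x <= t)%R then 1 else 0) =
  (erlang_sum_cdf mu1 mu2 a b t)%:E.
Proof.
rewrite (erlang_sum_cdfE mu1_gt0 mu2_gt0) [RHS]integral_indic1//.
by apply: eq_integral => x _; rewrite indicE mem_setE in_itv/=; case: (x <= t)%R.
Qed.

Lemma mix_down k u t : (0 < k)%N ->
  mix u k.-1 (fun x => if (x <= t)%R then 1 else 0) =
  (survival p mu1 mu2 u * P_down p mu1 mu2 k u t)%:E.
Proof.
case: k => // k _.
rewrite (@mixE _ _ _ (fun a b => erlang_sum_cdf mu1 mu2 a.+1 b t)
  (fun a b => erlang_sum_cdf mu1 mu2 a b.+1 t)); [|by move=> a b _; rewrite es_cdfE..].
congr (_ * _)%:E; rewrite /P_down !mulr_sumr -big_split/=.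
by apply: eq_big_nat => j /andP[_ jk]; rewrite /= subSn//; ring.
Qed.

(** The mean is the integral over [s >= 0] of the tail [exp(-l s)], which is [l^-1] times the
    density. *)
Lemma mean_expo l (l0 : (0 < l)%R) : \int[expo l0]_x (Num.max 0 (x : R))%R%:E = (l^-1)%:E.
Proof.
have m2 : measurable_fun setT (fun z : R * R =>
    if (0 <= z.2)%R && (z.2 < z.1)%R then 1 else 0 : \bar R).
  apply: measurable_fun_ifT => //.
  by apply: measurable_and; [exact: measurable_fun_ler|exact: measurable_fun_ltr].
transitivity (\int[expo l0]_x \int[leb0]_s
    (if (0 <= s)%R && (s < x)%R then 1 else 0 : \bar R)).
  apply: eq_integral => x _; apply/esym.
  transitivity (\int[leb0]_s (\1_(`[0%R, x[%classic : set R) s)%:E).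
    by apply: eq_integral => s _; rewrite indicE mem_setE in_itv/=; case: (_ && _).
  rewrite integral_indic// setIT.
  have [x0|x0] := leP 0%R x; first by rewrite [LHS](leb0_itv true true x0) subr0.
  rewrite set_itv_ge ?bnd_simp -?leNgt ?measure0//; exact: ltW.
rewrite (fubini_tonelli _ m2); last by move=> z; case: ifP.
transitivity (\int[leb0]_s ((l^-1)%:E * (exponential_pdf l s)%:E)).
  apply: eq_integral => s _ /=.
  have [s0|s0] := leP 0%R s => /=; last first.
    by rewrite integral0 lt0_exponential_pdf// mule0.
  rewrite exponential_pdfE// -EFinM mulrA mulVf ?gt_eqF// mul1r -(expo_gt l0 s0).
  rewrite [RHS]integral_indic1; last first.
    by rewrite -[X in measurable X]setTI; apply: measurable_fun_ltr.
  apply: eq_integral => x _; rewrite indicE.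
  by have [sx|sx] := boolP (s < x)%R; [rewrite mem_set|rewrite memNset//; exact/negP].
rewrite ge0_integralZl//.
- rewrite (has_density_integral (has_density_expo l0)) mule1//.
- apply/measurable_EFinP; exact: measurable_exponential_pdf0.
- by move=> x _; rewrite lee_fin exponential_pdf_ge0// ltW.
- by rewrite lee_fin invr_ge0 ltW.
Qed.

(** The expectation of [g (x + B)] for a fresh service [B]. *)
Definition service_int g (x : R) :=
  p%:E * \int[expo mu1_gt0]_y g (x + y)%R + (1 - p)%:E * \int[expo mu2_gt0]_y g (x + y)%R.

Lemma measurable_service_int g : measurable_fun [set: R] g -> (forall x, 0 <= g x) ->
  measurable_fun [set: R] (service_int g).
Proof.
move=> mg g0; apply: emeasurable_funD; apply: measurable_funeM;
exact: measurable_integral_shift.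
Qed.

Lemma service_int_ge0 g x : (forall x, 0 <= g x) -> 0 <= service_int g x.
Proof. by move=> g0; apply: adde_ge0; apply: mule_ge0; rewrite ?lee_fin// integral_ge0. Qed.

Lemma integral_es_service_int a b g : measurable_fun [set: R] g -> (forall x, 0 <= g x) ->
  \int[es a b]_x service_int g x =
  p%:E * \int[es a.+1 b]_x g x + (1 - p)%:E * \int[es a b.+1]_x g x.
Proof.
move=> mg g0; have mi m := measurable_integral_shift m mg g0.
have i0 (m : probability R R) x : 0 <= \int[m]_y g (x + y)%R by apply: integral_ge0.
rewrite ge0_integralD//; first last.
- exact: measurable_funeM.
- by move=> x _; rewrite mule_ge0// lee_fin.
- exact: measurable_funeM.
- by move=> x _; rewrite mule_ge0// lee_fin.
rewrite (ge0_integral_es1 mu1_gt0 mu2_gt0 a b mg g0) (ge0_integral_es2 mu1_gt0 mu2_gt0 a b mg g0).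
by congr (_ + _); apply: ge0_integralZl => //; rewrite lee_fin.
Qed.

(** [bsumS] singles out the type of one more service, and [integral_es_service_int] integrates that
    service out. *)
Lemma mixS u m g : measurable_fun [set: R] g -> (forall x, 0 <= g x) ->
  mix u m.+1 g = mix u m (service_int g).
Proof.
move=> mg g0.
have i0 a b : 0 <= \int[es a b]_x g x by apply: integral_ge0.
rewrite /mix !bsumS//; congr (_ * _ + _ * _); rewrite -!bsumZ// -bsumD//;
  try (by move=> a b; rewrite mule_ge0// lee_fin);
  by apply: eq_bsum => a b _; rewrite integral_es_service_int.
Qed.

(** The substitution [v = t - x] turns the departure time into the service time elapsed at the next
    arrival. *)
Lemma mix_pdf a b t g : (0 < a + b)%N -> (0 <= t)%R ->
  measurable_fun [set: R] g -> (forall x, 0 <= g x) ->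
  \int[es a b]_x (if (x <= t)%R then g (t - x)%R else 0) =
  \int[lebesgue_measure]_(v in `]0%R, t[) (g v * (es_pdf a b (t - v))%:E).
Proof.
move=> ab t0 mg g0; have [mf fM f0 _ fE] := es_pdfP mu1_gt0 mu2_gt0 ab.
have mgt : measurable_fun [set: R] (fun x => if (x <= t)%R then g (t - x)%R else 0).
  apply: measurable_fun_ifT => //; first exact: measurable_fun_ler.
  by apply: measurableT_comp => //; exact: measurable_subr.
have g'0 x : 0 <= (if (x <= t)%R then g (t - x)%R else 0) by case: ifP.
have pdf0 x : (0 <= es_pdf a b x)%R by have /andP[] := fM x.
have mpt : measurable_fun [set: R] (fun x => (es_pdf a b (t - x))%:E).
  by apply/measurable_EFinP; apply: measurableT_comp => //; exact: measurable_subr.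
rewrite fE// -(ge0_integral_leb0_refl t); last 2 first.
- by apply: emeasurable_funM => //; exact/measurable_EFinP.
- by move=> x; rewrite mule_ge0// lee_fin.
(* The test [x <= t] and the vanishing of the density at negative arguments produce the closed
   interval, whose end points are null. *)
rewrite -(@integral_itv_bndoo R 0%R t (fun v => g v * (es_pdf a b (t - v))%:E) true false); last first.
  by apply: measurable_funTS; exact: emeasurable_funM.
rewrite integral_leb0//; last 2 first.
- by apply: measurable_funTS; exact: emeasurable_funM.
- by move=> x _; rewrite mule_ge0// lee_fin.
rewrite [RHS]integral_mkcond; apply: eq_integral => v _.
rewrite patchE mem_setE in_itv/= gerBl opprB subrKC.
have [v0|v0] := leP 0%R v => /=; last by rewrite mul0e.
by have [//|vt] := leP v t; rewrite f0 ?mule0// subr_lt0.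
Qed.

Lemma bsum_integral m t g (d : nat -> nat -> R -> R) :
  (forall a b, measurable_fun [set: R] (d a b)) -> (forall a b x, (0 <= d a b x)%R) ->
  measurable_fun [set: R] g -> (forall x, 0 <= g x) ->
  bsum m (fun a b => \int[lebesgue_measure]_(v in `]0%R, t[) (g v * (d a b v)%:E)) =
  \int[lebesgue_measure]_(v in `]0%R, t[)
    (g v * (\sum_(0 <= j < m.+1) binomial_pmf m p j * d j (m - j)%N v)%:E).
Proof.
move=> md d0 mg g0.
have b0 j : (0 <= binomial_pmf m p j)%R by exact: binomial_pmf_ge0.
have mgd a b : measurable_fun `]0%R, t[ (fun v => g v * (d a b v)%:E).
  by apply: measurable_funTS; apply: emeasurable_funM => //; exact/measurable_EFinP.
have gd0 a b v : 0 <= g v * (d a b v)%:E by rewrite mule_ge0// lee_fin.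
transitivity (\sum_(0 <= j < m.+1) \int[lebesgue_measure]_(v in `]0%R, t[)
    ((binomial_pmf m p j)%:E * (g v * (d j (m - j)%N v)%:E))).
  apply: eq_bigr => j _; rewrite ge0_integralZl ?lee_fin//; exact: (mgd j (m - j)%N).
rewrite -ge0_integral_sum//; last 2 first.
- by move=> j; apply: measurable_funeM; exact: (mgd j (m - j)%N).
- by move=> j x _; apply: mule_ge0; rewrite ?lee_fin.
apply: eq_integral => v _; rewrite -sumEFin ge0_sume_distrr; last first.
  by move=> j _; rewrite lee_fin mulr_ge0.
by apply: eq_bigr => j _; rewrite muleCA EFinM.
Qed.

(** The source of the integral terms in the recursion. By [mix_pdf] each Erlang law becomes a
    density at [t - v], and by [derive1_q1] and [derive1_q2] the binomial sum of these densities,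
    times [survival v], is the derivative that enters [p_trans]. The factor [survival (t - x)] on
    the left supplies this [survival v]. *)
Lemma mix_trans k l u t g : (0 <= t)%R ->
  measurable_fun [set: R] g -> (forall x, 0 <= g x) ->
  mix u (k - l)%N (fun x => if (x <= t)%R
     then (survival p mu1 mu2 (t - x))%:E * g (t - x)%R else 0) =
  (survival p mu1 mu2 u)%:E *
  \int[lebesgue_measure]_(v in `]0%R, t[) ((p_trans p mu1 mu2 k l u v t)%:E * g v).
Proof.
move=> t0 mg g0; set m := (k - l)%N.
pose h v := (survival p mu1 mu2 v)%:E * g v.
have mh : measurable_fun [set: R] h.
  apply: emeasurable_funM => //; apply/measurable_EFinP.
  by apply: measurable_funD; apply: measurable_funM => //;
    apply: measurableT_comp => //; exact: measurable_funM.
have h0 v : 0 <= h v by rewrite mule_ge0// lee_fin ltW// survival_gt0.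
have pdfm a b : (0 < a + b)%N -> measurable_fun [set: R] (fun v => es_pdf a b (t - v)).
  move=> ab; have [mf _ _ _ _] := es_pdfP mu1_gt0 mu2_gt0 ab.
  by apply: measurableT_comp => //; exact: measurable_subr.
have pdf0 a b v : (0 < a + b)%N -> (0 <= es_pdf a b (t - v))%R.
  by move=> ab; have [_ /(_ (t - v)%R)/andP[]] := es_pdfP mu1_gt0 mu2_gt0 ab.
pose d1 := fun v => (\sum_(0 <= j < m.+1) binomial_pmf m p j * es_pdf j.+1 (m - j) (t - v))%R.
pose d2 := fun v => (\sum_(0 <= j < m.+1) binomial_pmf m p j * es_pdf j (m - j).+1 (t - v))%R.
have md1 : measurable_fun [set: R] d1.
  by apply: measurable_sum => j; apply: measurable_funM => //; exact: pdfm.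
have md2 : measurable_fun [set: R] d2.
  by apply: measurable_sum => j; apply: measurable_funM => //; apply: pdfm; rewrite addnS.
have d10 v : (0 <= d1 v)%R.
  by apply: sumr_ge0 => j _; rewrite mulr_ge0 ?binomial_pmf_ge0 ?pdf0.
have d20 v : (0 <= d2 v)%R.
  by apply: sumr_ge0 => j _; rewrite mulr_ge0 ?binomial_pmf_ge0 ?pdf0// addnS.
have mhd d : measurable_fun [set: R] d ->
    measurable_fun `]0%R, t[ (fun v => h v * (d v)%:E).
  by move=> md; apply: measurable_funTS; apply: emeasurable_funM => //; exact/measurable_EFinP.
pose G1 := gamma1 p mu1 mu2 u; pose G2 := gamma2 p mu1 mu2 u.
have G10 : (0 <= G1)%R by rewrite /G1/gamma1 divr_ge0 ?weight1_ge0// ltW// survival_gt0.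
have G20 : (0 <= G2)%R by rewrite /G2/gamma2 divr_ge0 ?weight2_ge0// ltW// survival_gt0.
have ab1 a b : (0 < a + b.+1)%N by rewrite addnS.
pose I1 := \int[lebesgue_measure]_(v in `]0%R, t[) (h v * (d1 v)%:E).
pose I2 := \int[lebesgue_measure]_(v in `]0%R, t[) (h v * (d2 v)%:E).
have I10 : 0 <= I1 by apply: integral_ge0 => v _; rewrite mule_ge0// lee_fin.
have I20 : 0 <= I2 by apply: integral_ge0 => v _; rewrite mule_ge0// lee_fin.
transitivity ((weight1 u)%:E * I1 + (weight2 u)%:E * I2).
  congr (_ * _ + _ * _); (apply: etrans; [apply: eq_bsum => a b _|]).
  - exact: (@mix_pdf a.+1 b t h).
  - exact: (@bsum_integral m t h (fun a b v => es_pdf a.+1 b (t - v))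
      (fun a b => pdfm a.+1 b isT) (fun a b v => pdf0 a.+1 b v isT) mh h0).
  - exact: (@mix_pdf a b.+1 t h (ab1 a b)).
  - exact: (@bsum_integral m t h (fun a b v => es_pdf a b.+1 (t - v))
      (fun a b => pdfm a b.+1 (ab1 a b)) (fun a b v => pdf0 a b.+1 v (ab1 a b)) mh h0).
transitivity ((survival p mu1 mu2 u)%:E *
  \int[lebesgue_measure]_(v in `]0%R, t[) (h v * (G1 * d1 v + G2 * d2 v)%:E)); last first.
  congr (_ * _); apply: eq_integral => v; rewrite inE/= in_itv/= => vt.
  rewrite /p_trans (derive1_q1 p mu1_gt0 mu2_gt0 k l vt) (derive1_q2 p mu1_gt0 mu2_gt0 k l vt).
  rewrite -/m -/(d1 v) -/(d2 v) -/G1 -/G2 /h muleAC -EFinM; congr (_%:E * _); ring.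
transitivity ((survival p mu1 mu2 u)%:E * (G1%:E * I1 + G2%:E * I2)).
  have s0 := survival_gt0 u; clearbody I1 I2.
  rewrite ge0_muleDr; [|by rewrite mule_ge0// lee_fin..].
  rewrite !muleA -!EFinM; congr (_%:E * _ + _%:E * _).
    by rewrite /G1/gamma1 mulrC divfK// gt_eqF.
  by rewrite /G2/gamma2 mulrC divfK// gt_eqF.
rewrite /I1 /I2.
congr (_ * _); rewrite -!ge0_integralZl//; first last.
- by move=> v _; rewrite mule_ge0// lee_fin.
- exact: (mhd d1 md1).
- by move=> v _; rewrite mule_ge0// lee_fin.
- exact: (mhd d2 md2).
rewrite -ge0_integralD//; first last.
- by apply: measurable_funeM; exact: (mhd d2 md2).
- by move=> v _; apply: mule_ge0; [rewrite lee_fin|rewrite mule_ge0// lee_fin].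
- by apply: measurable_funeM; exact: (mhd d1 md1).
- by move=> v _; apply: mule_ge0; [rewrite lee_fin|rewrite mule_ge0// lee_fin].
apply: eq_integral => v _; rewrite EFinD ge0_muleDr; [|rewrite lee_fin; exact: mulr_ge0..].
by congr (_ + _); rewrite EFinM; exact: muleCA.
Qed.

End mixture.

(** * Measurability of sample paths *)

Section measurability.
Context {R : realType} d (T : measurableType d).

(** The number of clients is a random index into families of functions; splitting along its
    countably many values reduces measurability to a fixed index. *)
Lemma measurable_nat_param d' (U : measurableType d') (N : T -> nat) (h : nat -> T -> U) :
  measurable_fun [set: T] N -> (forall k, measurable_fun [set: T] (h k)) ->
  measurable_fun [set: T] (fun x => h (N x) x).
Proof.
move=> mN mh _ Y mY; rewrite setTI.
have -> : (fun x => h (N x) x) @^-1` Y = \bigcup_k (N @^-1` [set k] `&` (h k @^-1` Y)).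
  apply/seteqP; split => [x /= Yx|x [k _ [/= <-]]//].
  by exists (N x).
apply: bigcupT_measurable => k; apply: measurableI.
  by rewrite -[X in measurable X]setTI; exact: mN.
by rewrite -[X in measurable X]setTI; exact: mh.
Qed.

Lemma measurable_nat_comp (N : T -> nat) d' (U : measurableType d') (h : nat -> U) :
  measurable_fun [set: T] N -> measurable_fun [set: T] (fun x => h (N x)).
Proof. by move=> mN; apply: (measurable_nat_param (h := fun k _ => h k) mN). Qed.

Lemma measurable_count (I : Type) (s : seq I) (b : I -> T -> bool) :
  (forall i, measurable_fun [set: T] (b i)) ->
  measurable_fun [set: T] (fun x => count (b^~ x) s).
Proof.
move=> mb; elim: s => [|i s IH]/=; first exact: measurable_cst.
rewrite (_ : (fun _ => _) = fun x => if b i x then (count (b^~ x) s).+1 else count (b^~ x) s); last first.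
  by apply/funext => x; case: (b i x).
by apply: measurable_fun_ifT => //; exact: (measurable_nat_comp S).
Qed.

Variables (s : nat -> T -> R) (n : nat).
Hypothesis ms : forall c, measurable_fun [set: T] (s c).

Lemma measurable_departure j k m (u : T -> R) : measurable_fun [set: T] u ->
  measurable_fun [set: T] (fun x => departure (s^~ x) j k (u x) m).
Proof.
move=> mu; apply: measurable_funB => //; exact: measurable_sum.
Qed.

Section state.
Variables (k : T -> nat) (u : T -> R).
Hypotheses (mk : measurable_fun [set: T] k) (mu : measurable_fun [set: T] u).

Lemma measurable_waiting j : measurable_fun [set: T] (fun x => waiting (s^~ x) j (k x, u x)).
Proof.
apply: (@measurable_nat_param _ _ _ (fun k x => waiting (s^~ x) j (k, u x))) => // m.
by rewrite /waiting/=; case: (m == 1%N) => //; exact: measurable_departure.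
Qed.

Lemma measurable_idle j (t : T -> R) : measurable_fun [set: T] t ->
  measurable_fun [set: T] (fun x => idle (s^~ x) j (k x, u x) (t x)).
Proof.
move=> mt; apply: (@measurable_nat_param _ _ _ (fun k x => idle (s^~ x) j (k, u x) (t x))) => // m.
apply: measurable_maxr => //; apply: measurable_funB => //; exact: measurable_departure.
Qed.

Lemma measurable_nb_departures j (t : T -> R) : measurable_fun [set: T] t ->
  measurable_fun [set: T] (fun x => nb_departures (s^~ x) j (k x, u x) (t x)).
Proof.
move=> mt.
apply: (@measurable_nat_param _ _ _ (fun k x => nb_departures (s^~ x) j (k, u x) (t x))) => // m.
apply: (@measurable_count _ _ (fun i x => departure (s^~ x) j m (u x) i <= t x)) => i.
by apply: measurable_fun_ler => //; exact: measurable_departure.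
Qed.

Lemma measurable_next_state1 j (t : T -> R) : measurable_fun [set: T] t ->
  measurable_fun [set: T] (fun x => (next_state (s^~ x) j (k x, u x) (t x)).1).
Proof.
move=> mt; have md := measurable_nb_departures j mt.
apply: (eq_measurable_fun (fun x => if nb_departures (s^~ x) j (k x, u x) (t x) == 0%N
   then (k x).+1 else if (nb_departures (s^~ x) j (k x, u x) (t x) < k x)%N
   then (k x - nb_departures (s^~ x) j (k x, u x) (t x)).+1 else 1%N)).
  by move=> x _; rewrite /next_state; do 2 case: ifP => //.
apply: (@measurable_nat_param _ _ _ (fun m x => if m == 0%N then (k x).+1
   else if (m < k x)%N then (k x - m).+1 else 1%N)) => // m.
by apply: (measurable_nat_comp (fun q => if m == 0%N then q.+1
   else if (m < q)%N then (q - m).+1 else 1%N)).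
Qed.

Lemma measurable_next_state2 j (t : T -> R) : measurable_fun [set: T] t ->
  measurable_fun [set: T] (fun x => (next_state (s^~ x) j (k x, u x) (t x)).2).
Proof.
move=> mt; have md := measurable_nb_departures j mt.
apply: (eq_measurable_fun (fun x => if nb_departures (s^~ x) j (k x, u x) (t x) == 0%N
   then u x + t x else if (nb_departures (s^~ x) j (k x, u x) (t x) < k x)%N
   then t x - departure (s^~ x) j (k x) (u x) (nb_departures (s^~ x) j (k x, u x) (t x)) else 0)).
  by move=> x _; rewrite /next_state; do 2 case: ifP => //.
apply: (@measurable_nat_param _ _ _ (fun m x => if m == 0%N then u x + t x
   else if (m < k x)%N then t x - departure (s^~ x) j (k x) (u x) m else 0)) => // m.
apply: (@measurable_nat_param _ _ _ (fun q x => if m == 0%N then u x + t x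
   else if (m < q)%N then t x - departure (s^~ x) j q (u x) m else 0)) => // q.
case: (m == 0%N); first exact: measurable_funD.
case: (m < q)%N => //; apply: measurable_funB => //; exact: measurable_departure.
Qed.

End state.

Variable tau : nat -> nat -> R -> R.
Hypothesis mtau : forall j k, measurable_fun [set: R] (tau j k).

Lemma measurable_tau j (k : T -> nat) (u : T -> R) :
  measurable_fun [set: T] k -> measurable_fun [set: T] u ->
  measurable_fun [set: T] (fun x => tau j (k x) (u x)).
Proof.
move=> mk mu; apply: (@measurable_nat_param _ _ _ (fun k x => tau j k (u x))) => // m.
exact: measurableT_comp.
Qed.

Lemma measurable_state i k (u : T -> R) r : measurable_fun [set: T] u ->
  measurable_fun [set: T] (fun x => (state tau (s^~ x) i (k, u x) r).1) /\
  measurable_fun [set: T] (fun x => (state tau (s^~ x) i (k, u x) r).2).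
Proof.
move=> mu; elim: r => [|r [IH1 IH2]] /=; first by split => //; exact: measurable_cst.
have mt := measurable_tau (i + r) IH1 IH2.
have e x : state tau (s^~ x) i (k, u x) r =
  ((state tau (s^~ x) i (k, u x) r).1, (state tau (s^~ x) i (k, u x) r).2).
  by case: (state _ _ _ _ _).
split.
  under eq_fun do rewrite {1}e.
  exact: (measurable_next_state1 IH1 IH2).
under eq_fun do rewrite {1}e.
exact: (measurable_next_state2 IH1 IH2).
Qed.

(** The elapsed time may depend on the point: it will be the random one after a transition, or a
    coordinate of a product space. *)
Lemma measurable_path_cost omega i k (u : T -> R) : measurable_fun [set: T] u ->
  measurable_fun [set: T] (fun x => path_cost omega n tau i k (u x) (s^~ x)).
Proof.
move=> mu; rewrite /path_cost; apply: measurable_funD; apply: measurable_funM => //;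
  apply: measurable_sum => j.
- have [m1 m2] := measurable_state i k (j - i) mu.
  have := measurable_idle m1 m2 j (measurable_tau j m1 m2).
  by apply: eq_measurable_fun => x _; rewrite -surjective_pairing.
- have [m1 m2] := measurable_state i k (j - i) mu.
  have := measurable_waiting m1 m2 j.
  by apply: eq_measurable_fun => x _; rewrite -surjective_pairing.
Qed.

End measurability.

(** * Independence of blocks of services *)

Section sub_sigma_algebra.
Context d (Omega : measurableType d) (R : realType) (P : probability Omega R).
Local Open Scope ereal_scope.
Implicit Types G : set (set Omega).

Section sub_probability.
Variables (G : set (set Omega)) (mG : G `<=` measurable).

(** The inclusion is an argument because the measure structure attached to this function depends on
    it. *)
Definition sub_prob (_ : G `<=` measurable) : set (g_sigma_algebraType G) -> \bar R := P.

Lemma sub_measurable A : <<s G >> A -> measurable A.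
Proof. by apply: smallest_sub => //; exact: sigma_algebra_measurable. Qed.

Let sub_prob0 : sub_prob mG set0 = 0. Proof. exact: measure0. Qed.
Let sub_prob_ge0 A : 0 <= sub_prob mG A. Proof. exact: measure_ge0. Qed.
Let sub_prob_sigma : semi_sigma_additive (sub_prob mG).
Proof.
move=> F mF tF mUF; apply: (@measure_semi_sigma_additive _ _ _ P) => //.
- by move=> i; apply: sub_measurable; exact: mF.
- exact: sub_measurable.
Qed.
HB.instance Definition _ := isMeasure.Build _ _ _ (sub_prob mG)
  sub_prob0 sub_prob_ge0 sub_prob_sigma.
Let sub_prob_setT : sub_prob mG setT = 1. Proof. exact: probability_setT. Qed.
HB.instance Definition _ := Measure_isProbability.Build _ _ _ (sub_prob mG) sub_prob_setT.

Lemma measurable_id_sub :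
  measurable_fun [set: Omega] (fun x : Omega => x : g_sigma_algebraType G).
Proof. by move=> _ Y mY; rewrite setTI; exact: sub_measurable. Qed.

Lemma ge0_integral_sub_prob (f : Omega -> \bar R) :
  measurable_fun [set: g_sigma_algebraType G] f -> (forall x, 0 <= f x) ->
  \int[sub_prob mG]_x f x = \int[P]_x f x.
Proof.
move=> mf f0; rewrite -[RHS](@ge0_integral_pushforward _ _ _ _ _ _ measurable_id_sub P setT f)//.
Qed.

End sub_probability.

(** For fixed [A] both sides are finite measures in [B] that agree on the pi-system [G]. *)
Lemma indep_sigma1 G A : G `<=` measurable -> setI_closed G -> G setT -> measurable A ->
  (forall B, G B -> P (A `&` B) = P A * P B) ->
  forall B, <<s G >> B -> P (A `&` B) = P A * P B.
Proof.
move=> mG GI GT mA AB B sB.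
have PA0 : (0 <= fine (P A))%R by rewrite fine_ge0.
pose m1 : {measure set Omega -> \bar R} := mrestr P mA.
pose m2 : {measure set Omega -> \bar R} := mscale (NngNum PA0) P.
have m2E C : m2 C = P A * P C.
  by rewrite /m2/= /mscale/= fineK// fin_num_measure.
rewrite -m2E setIC; apply: (g_sigma_algebra_measure_unique G mG (fun=> setT) _ _ m1 m2) => //.
- by rewrite bigcup_const.
- by move=> C GC; rewrite m2E -AB// setIC.
- by move=> k; rewrite /m1/= /mrestr setTI; apply: (le_lt_trans (probability_le1 _ _)) => //; rewrite ltry.
Qed.

Lemma indep_sigma2 G1 G2 : G1 `<=` measurable -> setI_closed G1 -> G1 setT ->
  G2 `<=` measurable -> setI_closed G2 -> G2 setT ->
  (forall A B, G1 A -> G2 B -> P (A `&` B) = P A * P B) ->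
  forall A B, <<s G1 >> A -> <<s G2 >> B -> P (A `&` B) = P A * P B.
Proof.
move=> mG1 G1I G1T mG2 G2I G2T H A B sA sB.
rewrite setIC muleC; apply: (indep_sigma1 mG1) => //.
  exact: (sub_measurable mG2).
move=> C GC; rewrite setIC muleC; apply: (indep_sigma1 mG2) => //.
  exact: mG1.
by move=> E GE; exact: H.
Qed.

(* The law of [x |-> (x, x)] on the product of the two sub-sigma-algebras is the
   product law, so Tonelli applies to integrals on the diagonal. *)
Lemma indep_integral G1 G2 (mG1 : G1 `<=` measurable) (mG2 : G2 `<=` measurable)
    (F : g_sigma_algebraType G1 * g_sigma_algebraType G2 -> \bar R) :
  (forall A B, <<s G1 >> A -> <<s G2 >> B -> P (A `&` B) = P A * P B) ->
  measurable_fun setT F -> (forall z, 0 <= F z) ->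
  \int[P]_x F (x, x) = \int[P]_x \int[P]_y F (x, y).
Proof.
move=> ind mF F0.
have mdiag : measurable_fun [set: Omega]
    (fun x => (x, x) : g_sigma_algebraType G1 * g_sigma_algebraType G2).
  by apply: measurable_fun_pair; exact: measurable_id_sub.
transitivity (\int[pushforward P (fun x => (x, x) : g_sigma_algebraType G1 * g_sigma_algebraType G2)]_z F z).
  by rewrite ge0_integral_pushforward.
pose m : {measure set (g_sigma_algebraType G1 * g_sigma_algebraType G2) -> \bar R} :=
  @measure_function_pushforward__canonical__measure_function_Measure _ _ _ _ R P _ mdiag.
rewrite -[LHS]/(\int[m]_z F z).
have -> : \int[m]_z F z = \int[sub_prob mG1 \x sub_prob mG2]_z F z.
  apply: eq_measure_integral => A mA _; apply/esym.
  by apply: product_measure_unique.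
rewrite fubini_tonelli1// ge0_integral_sub_prob; last 2 first.
- exact: measurable_fun_fubini_tonelli_F.
- by move=> x; apply: integral_ge0.
apply: eq_integral => x _; rewrite /fubini_F ge0_integral_sub_prob//.
exact: measurable_fun_pair2.
Qed.

End sub_sigma_algebra.

Section block_independence.
Context d (Omega : measurableType d) (R : realType) (P : probability Omega R).
Variables (S : nat -> {RV P >-> R}) (n : nat).
Hypothesis S_indep : mutually_independent [pred j | (1 <= j <= n)%N] S.
Local Open Scope ereal_scope.

(* A pi-system generating the sigma-algebra of the services [a <= c < b]. *)
Definition block a b : set (set Omega) :=
  [set B | exists2 A : nat -> set R, (forall j, measurable (A j)) &
     B = \big[setI/setT]_(a <= j < b) (S j @^-1` A j)].

Lemma block_measurable a b : block a b `<=` measurable.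
Proof.
move=> _ [A mA ->]; apply: bigsetI_measurable => j _.
by rewrite -[X in measurable X]setTI; apply: measurable_funP.
Qed.

Lemma block_setI a b : setI_closed (block a b).
Proof.
move=> _ _ [A mA ->] [B mB ->]; exists (fun j => A j `&` B j).
  by move=> j; exact: measurableI.
by rewrite -big_split; apply: eq_bigr => j _; rewrite preimage_setI.
Qed.

Lemma block_setT a b : block a b setT.
Proof.
exists (fun=> setT) => //; rewrite big1// => j _; exact: preimage_setT.
Qed.

Lemma block_indep a b c : (1 <= a)%N -> (a <= b <= c)%N -> (c <= n.+1)%N ->
  forall A B, <<s block a b >> A -> <<s block b c >> B -> P (A `&` B) = P A * P B.
Proof.
move=> a1 /andP[ab bc] cn.
apply: indep_sigma2; [exact: block_measurable|exact: block_setI|exact: block_setT|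
  exact: block_measurable|exact: block_setI|exact: block_setT|].
move=> _ _ [A mA ->] [B mB ->].
have sub x y : (1 <= x)%N -> (y <= n.+1)%N -> {subset index_iota x y <= [pred j | (1 <= j <= n)%N]}.
  move=> x1 yn j; rewrite mem_index_iota inE => /andP[xj jy].
  by rewrite (leq_trans x1 xj) -ltnS (leq_trans jy yn).
(* Gluing the two families at [b] makes the intersection of the two events a single intersection
   over [a <= j < c], to which mutual independence applies. *)
pose C j := if (j < b)%N then A j else B j.
have mC j : measurable (C j) by rewrite /C; case: ifP.
have eA : \big[setI/setT]_(a <= j < b) (S j @^-1` A j) =
          \big[setI/setT]_(a <= j < b) (S j @^-1` C j).
  by apply: eq_big_nat => j /andP[_ jb]; rewrite /C jb.
have eB : \big[setI/setT]_(b <= j < c) (S j @^-1` B j) =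
          \big[setI/setT]_(b <= j < c) (S j @^-1` C j).
  by apply: eq_big_nat => j /andP[bj _]; rewrite /C ltnNge bj.
rewrite eA eB -big_cat_nat//.
rewrite (S_indep (iota_uniq _ _) (sub _ _ a1 cn) mC).
rewrite (S_indep (iota_uniq _ _) (sub _ _ a1 (leq_trans bc cn)) mC).
rewrite (S_indep (iota_uniq _ _) (sub _ _ (leq_trans a1 ab) cn) mC).
by rewrite -big_cat_nat.
Qed.

Lemma measurable_block a b j : (a <= j < b)%N ->
  measurable_fun [set: g_sigma_algebraType (block a b)] (S j).
Proof.
move=> ajb _ Y mY; rewrite setTI; apply: sub_sigma_algebra.
exists (fun i => if i == j then Y else setT); first by move=> i; case: ifP.
rewrite big_mkcond/= (bigD1_seq j)/= ?mem_index_iota ?iota_uniq// eqxx big1 ?setIT//.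
by move=> i /negbTE ->; exact: preimage_setT.
Qed.

Lemma block_integral a b c (F : g_sigma_algebraType (block a b) *
    g_sigma_algebraType (block b c) -> \bar R) :
  (1 <= a)%N -> (a <= b <= c)%N -> (c <= n.+1)%N ->
  measurable_fun setT F -> (forall z, 0 <= F z) ->
  \int[P]_x F (x, x) = \int[P]_x \int[P]_y F (x, y).
Proof.
move=> a1 abc cn; apply: indep_integral; [exact: block_measurable|exact: block_measurable|].
exact: block_indep.
Qed.

End block_independence.

(** * Sample paths *)

Arguments departure : simpl never.
Arguments next_state : simpl never.
Arguments nb_departures : simpl never.
Arguments path_cost : simpl never.

Section sample_paths.
Context {R : realType}.
Implicit Types (s : nat -> R) (tau : nat -> nat -> R -> R) (u t : R).

Lemma departureS s j k u m :
  departure s j k u m.+1 = departure s j k u m + s ((j - k).+1 + m)%N.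
Proof. by rewrite /departure addnS big_nat_recr ?leq_addr//= addrAC. Qed.

Lemma departure1 s j k u : departure s j k u 1 = s (j - k).+1 - u.
Proof. by rewrite /departure addn1 big_nat1. Qed.

(** A predicate that holds on an initial segment is determined by how often it holds. As departures
    are ordered in time, this identifies the count [nb_departures] with the index of the last
    departure. *)
Lemma count_iota_antitone (b : pred nat) k m :
  (forall i, (1 <= i)%N -> b i.+1 -> b i) ->
  (1 <= m <= k)%N -> b m = (m <= count b (iota 1 k))%N.
Proof.
move=> bS; elim: k => [|k IH]; first by case: m.
have -> : count b (iota 1 k.+1) = (count b (iota 1 k) + b k.+1)%N.
  by rewrite -[in LHS](addn1 k) iotaD count_cat/= add1n addn0.
have allb : b k.+1 -> forall i, (1 <= i <= k.+1)%N -> b i.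
  move=> bk i /andP[i1 ik]; rewrite -(subKn ik).
  have := leq_subr i k.+1; set q := (k.+1 - i)%N.
  have : (q < k.+1)%N by rewrite /q ltn_subrL ltn0Sn andbT.
  elim: q => [|q IHq] qk _; first by rewrite subn0.
  apply: bS; first by rewrite subn_gt0.
  by have -> : (k.+1 - q.+1).+1 = (k.+1 - q)%N; [lia|apply: IHq; lia].
move=> /andP[m1]; rewrite leq_eqVlt => /predU1P[->|mk].
  case bk : (b k.+1); last first.
    by apply/esym/negbTE; rewrite -ltnNge addn0 ltnS (leq_trans (count_size _ _))// size_iota.
  rewrite addn1 (_ : count _ _ = k) ?leqnn//; rewrite -{2}(size_iota 1 k); apply/eqP.
  rewrite -all_count; apply/allP => i; rewrite mem_iota add1n ltnS => /andP[i1 ik].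
  by apply: allb => //; rewrite i1 ltnW.
have mk' : (1 <= m <= k)%N by rewrite m1 -ltnS.
case bk : (b k.+1); last by rewrite addn0 IH.
rewrite allb//; last by rewrite m1 ltnW.
apply/esym/(leq_trans (_ : m <= k)%N) => //; apply: leq_trans (leq_addr _ _).
rewrite -{1}(size_iota 1 k) -(eqP (_ : count b (iota 1 k) == size (iota 1 k)))//.
rewrite -all_count; apply/allP => i; rewrite mem_iota add1n ltnS => /andP[i1 ik].
by apply: allb => //; rewrite i1 ltnW.
Qed.

Lemma nb_departuresP s j k u t m : (forall c, 0 <= s c) -> (1 <= m <= k)%N ->
  (departure s j k u m <= t) = (m <= nb_departures s j (k, u) t)%N.
Proof.
move=> s0 mk.
apply: (@count_iota_antitone (fun m => departure s j k u m <= t)) => // i _.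
by apply: le_trans; rewrite departureS lerDl.
Qed.

Lemma nb_departures_le s j k u t : (nb_departures s j (k, u) t <= k)%N.
Proof. by rewrite /nb_departures (leq_trans (count_size _ _))// size_iota. Qed.

(** The second part says that the index of the client in service never decreases, so that a path
    reads no service before the one in progress. *)
Lemma next_state_bounds s j k u t : (1 <= k <= j)%N ->
  (1 <= (next_state s j (k, u) t).1 <= j.+1)%N /\
  (j - k <= j.+1 - (next_state s j (k, u) t).1)%N.
Proof.
move=> /andP[k1 kj]; rewrite /next_state.
case: ifPn => [_|d0]/=; first by rewrite ltnS kj subSS.
case: ifPn => [dk|_]/=; last by rewrite subSS subn0 leq_subr.
by rewrite ltnS (leq_trans (leq_subr _ _) kj) subSS leq_sub2l// leq_subr.
Qed.

(** If the system is not empty at the next arrival, the departure following the last counted one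
    comes after [t], so the service in progress is longer than its elapsed time. If it is empty, the
    elapsed time is 0. *)
Lemma next_stateP s j k u t : (forall c, 0 <= s c) -> (1 <= k <= j)%N -> 0 <= u -> 0 <= t ->
  0 <= (next_state s j (k, u) t).2 <= s (j.+1 - (next_state s j (k, u) t).1).+1.
Proof.
move=> s0 /andP[k1 kj] u0 t0; rewrite /next_state.
have dk := nb_departures_le s j k u t.
have dP := @nb_departuresP s j k u t _ s0.
move: dk dP; set d := nb_departures _ _ _ _ => dk dP.
case: ifPn => [/eqP d0|d0]/=.
  have := dP 1%N; rewrite k1 d0 => /(_ isT)/negbT; rewrite -ltNge departure1 subSS => h.
  by rewrite addr_ge0//= addrC -lerBrDr ltW.
case: ifPn => [dk'|dk']/=; last by rewrite lexx s0.
have d1 : (1 <= d <= k)%N by rewrite lt0n d0.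
have := dP _ d1; rewrite leqnn => dt; rewrite subr_ge0 dt/=.
have := dP d.+1; rewrite ltnn => /(_ dk')/negbT; rewrite -ltNge departureS.
have -> : (j.+1 - (k - d).+1).+1 = ((j - k).+1 + d)%N by lia.
move=> h; by rewrite lerBlDr ltW// addrC.
Qed.

(** [state] appends steps at the end, whereas the recursion for the cost peels off the first one. *)
Lemma stateS tau s i x r :
  state tau s i x r.+1 = state tau s i.+1 (next_state s i x (tau i x.1 x.2)) r.
Proof.
elim: r => [|r IH]; first by rewrite /= addn0.
by rewrite [LHS]/= -/(state tau s i x r.+1) IH /= addSnnS.
Qed.

Lemma path_cost_last omega n tau k u s :
  path_cost omega n tau n k u s = (1 - omega) * waiting s n (k, u).
Proof. by rewrite /path_cost big_geq// mulr0 add0r big_nat1 subnn. Qed.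

Lemma path_costS omega n tau i k u s : (i < n)%N ->
  path_cost omega n tau i k u s =
  omega * idle s i (k, u) (tau i k u) + (1 - omega) * waiting s i (k, u) +
  path_cost omega n tau i.+1 (next_state s i (k, u) (tau i k u)).1
    (next_state s i (k, u) (tau i k u)).2 s.
Proof.
move=> ni; rewrite /path_cost -surjective_pairing.
have e (F : nat -> nat * R -> R) b : \sum_(i.+1 <= j < b) F j (state tau s i (k, u) (j - i)) =
    \sum_(i.+1 <= j < b) F j (state tau s i.+1 (next_state s i (k, u) (tau i k u)) (j - i.+1)).
  by apply: eq_big_nat => j /andP[ij _]; rewrite -(subnSK ij) stateS.
rewrite big_ltn// (@big_ltn _ _ _ i n.+1) 1?ltnW// subnn/=.
rewrite (e (fun j y => idle s j y (tau j y.1 y.2))) (e (fun j y => waiting s j y)).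
by ring.
Qed.

Lemma path_cost_ind (Q : nat -> nat -> R -> Prop) n :
  (forall k u, (1 <= k <= n)%N -> Q n k u) ->
  (forall i k u, (i < n)%N -> (1 <= k <= i)%N ->
    (forall k' u', (1 <= k' <= i.+1)%N -> Q i.+1 k' u') -> Q i k u) ->
  forall i k u, (i <= n)%N -> (1 <= k <= i)%N -> Q i k u.
Proof.
move=> Qn Qi i k u ni; rewrite -(subKn ni).
have := leq_subr i n; move: (n - i)%N => r; elim: r k u => [|r IH] k u rn ki.
  by rewrite subn0 in ki *; exact: Qn.
apply: Qi => //; first by rewrite ltn_subrL/= (leq_trans _ rn).
by move=> k' u'; rewrite subnSK// => k'i; apply: IH => //; exact: ltnW.
Qed.

Lemma eq_departure s s' j k u m f n : (k <= j)%N -> (j <= n)%N -> (m <= k)%N -> (f <= (j - k).+1)%N ->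
  (forall c, (f <= c <= n)%N -> s c = s' c) ->
  departure s j k u m = departure s' j k u m.
Proof.
move=> kj jn mk fj ss; rewrite /departure; congr (_ - _).
apply: eq_big_nat => c /andP[cj cm]; apply: ss; rewrite (leq_trans fj cj)/=.
by rewrite -ltnS (leq_trans cm)// addSn ltnS (leq_trans _ jn)// -leq_subRL// ?leq_subr// subKn.
Qed.

(** Clients ahead of the one in service have left and clients after [n] never arrive. This makes
    costs measurable for a block of services. *)
Lemma path_cost_local omega n tau f s s' : (forall c, (f <= c <= n)%N -> s c = s' c) ->
  forall i k u, (i <= n)%N -> (1 <= k <= i)%N -> (f <= (i - k).+1)%N ->
  path_cost omega n tau i k u s = path_cost omega n tau i k u s'.
Proof.
move=> ss; apply: path_cost_ind => [k u|i k u ni] /andP[k1 ki].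
  move=> fk; rewrite !path_cost_last /waiting/=; case: eqP => // _; congr (_ * _).
  by apply: (@eq_departure s s' n k u _ f n) => //; exact: leq_pred.
move=> IH fk; rewrite !(path_costS _ _ _ _ _ ni).
have e m : (m <= k)%N -> departure s i k u m = departure s' i k u m.
  by move=> mk; apply: (@eq_departure s s' i k u m f n) => //; exact: ltnW.
have eN : next_state s i (k, u) (tau i k u) = next_state s' i (k, u) (tau i k u).
  have ed : nb_departures s i (k, u) (tau i k u) = nb_departures s' i (k, u) (tau i k u).
    apply: eq_in_count => m; rewrite mem_iota add1n ltnS => /andP[_ mk]/=.
    by rewrite e.
  by rewrite /next_state ed e// nb_departures_le.
rewrite eN; congr (_ * _ + _ * _ + _).
- by rewrite /idle/= e.
- by rewrite /waiting/=; case: eqP => // _; rewrite e// leq_pred.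
have ki' : (1 <= k <= i)%N by rewrite k1.
have [h1 h2] := next_state_bounds s' u (tau i k u) ki'.
by apply: IH => //; rewrite (leq_trans fk)// ltnS.
Qed.

Lemma waiting_ge0 s i k u : (forall c, 0 <= s c) -> (1 <= k)%N -> u <= s (i - k).+1 ->
  0 <= waiting s i (k, u).
Proof.
move=> s0; rewrite /waiting/=; case: k => [//|[//|k]] _ us /=.
suff H m : 0 <= departure s i k.+2 u m.+1 by exact: H.
by elim: m => [|m IH]; [rewrite departure1 subr_ge0|rewrite departureS addr_ge0].
Qed.

Lemma path_cost_ge0 omega n tau s : 0 <= omega <= 1 -> policy tau -> (forall c, 0 <= s c) ->
  forall i k u, (i <= n)%N -> (1 <= k <= i)%N -> 0 <= u <= s (i - k).+1 ->
  0 <= path_cost omega n tau i k u s.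
Proof.
move=> /andP[w0 w1] ptau s0; apply: path_cost_ind => [k u /andP[k1 ki]|i k u ni /andP[k1 ki] IH] /andP[u0 us].
  by rewrite path_cost_last mulr_ge0 ?subr_ge0// waiting_ge0.
rewrite (path_costS _ _ _ _ _ ni); apply: addr_ge0; first apply: addr_ge0.
- by rewrite mulr_ge0// /idle le_max lexx.
- by rewrite mulr_ge0 ?subr_ge0// waiting_ge0.
have t0 : 0 <= tau i k u by have [_] := ptau i k; apply.
have ki' : (1 <= k <= i)%N by rewrite k1.
have [h1 h2] := next_state_bounds s u (tau i k u) ki'.
by apply: IH => //; exact: next_stateP.
Qed.

(** Exactly one of the [k.+1] tests succeeds, namely the one indexed by the number of departures
    before the next arrival. Each test is written with departure times and the one service then in
    progress, which belong to disjoint blocks. *)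
Lemma next_state_split (Phi : nat -> R -> \bar R) s j k u t :
  (forall c, 0 <= s c) -> (1 <= k <= j)%N ->
  Phi (next_state s j (k, u) t).1 (next_state s j (k, u) t).2 =
    ((if (u + t < s (j - k).+1)%R then Phi k.+1 (u + t)%R else 0) +
    \sum_(1 <= m < k) (if ((departure s j k u m <= t) &&
                          (t - departure s j k u m < s ((j - k).+1 + m)%N))%R
                       then Phi (k - m).+1 (t - departure s j k u m)%R else 0) +
    (if (departure s j k u k <= t)%R then Phi 1%N 0%R else 0))%E.
Proof.
move=> s0 /andP[k1 kj].
have dk := nb_departures_le s j k u t.
have dP := @nb_departuresP s j k u t _ s0.
rewrite /next_state.
move: dk dP; set d := nb_departures _ _ _ _ => dk dP.
have c0 : (u + t < s (j - k).+1) = (d == 0%N).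
  have := dP 1%N; rewrite k1 => /(_ isT); rewrite departure1 => /(congr1 negb).
  by rewrite -ltNge -ltnNge ltnS leqn0 => <-; rewrite addrC ltrBrDr.
have cm m : (1 <= m < k)%N -> (departure s j k u m <= t) &&
    (t - departure s j k u m < s ((j - k).+1 + m)%N) = (d == m).
  move=> /andP[m1 mk]; rewrite dP ?m1 ?(ltnW mk)//.
  have := dP m.+1; rewrite mk => /(_ isT) /(congr1 negb).
  by rewrite -ltNge -ltnNge ltnS departureS ltrBlDl => ->; rewrite andbC -eqn_leq.
have ck : (departure s j k u k <= t) = (d == k).
  by rewrite dP ?k1 ?leqnn// eqn_leq dk.
rewrite c0 ck (eq_big_nat _ _ (F2 := fun m => if d == m
    then Phi (k - m).+1 (t - departure s j k u m) else 0%E)); last first.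
  by move=> m mk; rewrite cm.
have [d0|d0] := eqVneq d 0%N.
  rewrite d0 eq_sym (gtn_eqF k1) adde0 big_nat_cond big1 ?adde0//.
  by move=> m /andP[/andP[m1 _] _]; rewrite eq_sym gtn_eqF.
rewrite add0e; have [dk'|dk'] := ltnP d k.
  rewrite (ltn_eqF dk') adde0 (bigD1_seq d)/= ?iota_uniq//; last first.
    by rewrite mem_index_iota lt0n d0.
  by rewrite eqxx big1 ?adde0// => m; rewrite eq_sym => /negbTE ->.
have ek : d = k by apply/eqP; rewrite eqn_leq dk.
rewrite ek eqxx big_nat_cond big1 ?add0e//.
by move=> m /andP[/andP[_ mk] _]; rewrite gtn_eqF.
Qed.

End sample_paths.

(** * One step of the system *)

Lemma measurable_fun_fst d1 d2 d3 (T1 : measurableType d1) (T2 : measurableType d2)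
    (T3 : measurableType d3) (h : T1 -> T3) : measurable_fun [set: T1] h ->
  measurable_fun [set: T1 * T2] (fun z => h z.1).
Proof. by move=> mh; exact: measurableT_comp. Qed.

Lemma measurable_fun_snd d1 d2 d3 (T1 : measurableType d1) (T2 : measurableType d2)
    (T3 : measurableType d3) (h : T2 -> T3) : measurable_fun [set: T2] h ->
  measurable_fun [set: T1 * T2] (fun z => h z.2).
Proof. by move=> mh; exact: measurableT_comp. Qed.

Section laws.
Context d (Omega : measurableType d) (R : realType) (P : probability Omega R).
Variables (n : nat) (p mu1 mu2 : R) (mu1_gt0 : 0 < mu1) (mu2_gt0 : 0 < mu2).
Variable S : nat -> {RV P >-> R}.
Hypothesis p01 : 0 <= p <= 1.
Hypothesis S_indep : mutually_independent [pred j | (1 <= j <= n)%N] S.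
Hypothesis S_law : forall j, (1 <= j <= n)%N -> forall A, measurable A ->
  distribution P (S j) A = hyperexp_prob p mu1 mu2 A.
Local Open Scope ereal_scope.
Local Notation mix := (mix p mu1_gt0 mu2_gt0).
Local Notation service_int := (service_int p mu1_gt0 mu2_gt0).
Implicit Types (g : R -> \bar R) (u t : R).

Let p0 : (0 <= p)%R. Proof. by case/andP: p01. Qed.
Let q0 : (0 <= 1 - p)%R. Proof. by rewrite subr_ge0; case/andP: p01. Qed.

Lemma integral_service c g : (1 <= c <= n)%N ->
  measurable_fun [set: R] g -> (forall x, 0 <= g x) ->
  \int[P]_x g (S c x) = p%:E * \int[expo mu1_gt0]_y g y + (1 - p)%:E * \int[expo mu2_gt0]_y g y.
Proof.
move=> cn mg g0.
pose m1 : {measure set R -> \bar R} := mscale (NngNum p0) (expo mu1_gt0).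
pose m2 : {measure set R -> \bar R} := mscale (NngNum q0) (expo mu2_gt0).
transitivity (\int[distribution P (S c)]_y g y).
  by rewrite ge0_integral_distribution.
transitivity (\int[measure_add m1 m2]_y g y).
  apply: eq_measure_integral => A mA _; rewrite [LHS](S_law cn mA).
  by transitivity (m1 A + m2 A); last exact/esym/measure_addE.
rewrite ge0_integral_measure_add//; congr (_ + _);
by rewrite ge0_integral_mscale.
Qed.

Lemma expo_memoryless l (l0 : (0 < l)%R) u g : (0 <= u)%R ->
  measurable_fun [set: R] g -> (forall x, 0 <= g x) ->
  \int[expo l0]_y (if (u < y)%R then g (y - u)%R else 0) =
  (expR (- l * u))%:E * \int[expo l0]_y g y.
Proof.
move=> u0 mg g0.
have mpdf : measurable_fun [set: R] (fun x => (exponential_pdf l x)%:E).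
  by apply/measurable_EFinP; exact: measurable_exponential_pdf0.
have pdf0 x : (0 <= exponential_pdf l x)%R by rewrite exponential_pdf_ge0// ltW.
have mif : measurable_fun [set: R] (fun y => if (u < y)%R then g (y - u)%R else 0).
  apply: measurable_fun_ifT => //; first exact: measurable_fun_ltr.
  by apply: measurableT_comp => //; exact: measurable_funB.
have if0 y : 0 <= if (u < y)%R then g (y - u)%R else 0 by case: ifP.
rewrite !ge0_integral_expo// -ge0_integralZl//; last 2 first.
- exact: emeasurable_funM.
- by move=> x _; rewrite mule_ge0// lee_fin.
rewrite -(ge0_integral_leb0_shift u); last 2 first.
- exact: emeasurable_funM.
- by move=> x; rewrite mule_ge0// lee_fin.
apply: ge0_ae_eq_integral => //.
- apply: emeasurable_funM.
    by apply: (measurableT_comp mif); exact: measurable_addr.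
  by apply: (measurableT_comp mpdf); exact: measurable_addr.
- by apply: measurable_funeM; exact: emeasurable_funM.
- by move=> x _; rewrite mule_ge0// lee_fin.
- by move=> x _; rewrite mule_ge0 ?lee_fin ?expR_ge0// mule_ge0// lee_fin.
(* At [y = 0] the strict test [u < u + y] fails although the density is positive, so the integrands
   may differ there. *)
exists [set 0%R]; split => //; first exact: lebesgue_measure_set1.
move=> y /= H; apply: contrapT => y0; apply: H => _.
rewrite ltrDl; have [ygt|yle] := ltP 0%R y.
  rewrite addrAC subrr add0r muleCA -EFinM; congr (_ * _%:E).
  rewrite !exponential_pdfE ?addr_ge0// ?ltW// mulrDr expRD; ring.
rewrite mul0e lt0_exponential_pdf ?mule0//.
by rewrite lt_neqAle yle andbT; apply/eqP.
Qed.

(* Path functionals of [trunc a b s] are measurable for [block S a b], whereas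
   those of [s] read, syntactically, all services. *)
Definition trunc a b (s : nat -> R) c : R := if (a <= c < b)%N then s c else 0%R.

Lemma measurable_trunc a b c :
  measurable_fun [set: g_sigma_algebraType (block S a b)] (fun x => trunc a b (S^~ x) c).
Proof.
by case cab : (a <= c < b)%N; rewrite /trunc cab; [exact: measurable_block|exact: measurable_cst].
Qed.

(** This is [departure] in terms of the client [f] in service; the induction on [m] below keeps [f]
    fixed. *)
Definition elapsed (s : nat -> R) f u m : R := (\sum_(f <= c < f + m) s c - u)%R.

Lemma elapsed_trunc s f u m b : (f + m <= b)%N ->
  elapsed (trunc f b s) f u m = elapsed s f u m.
Proof.
move=> mb; rewrite /elapsed; congr (_ - _)%R; apply: eq_big_nat => c /andP[fc cm].
by rewrite /trunc fc (leq_trans cm mb).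
Qed.

Lemma measurable_elapsed f u m b :
  measurable_fun [set: g_sigma_algebraType (block S f b)]
    (fun x => elapsed (trunc f b (S^~ x)) f u m).
Proof.
apply: measurable_funB => //; apply: measurable_sum => c; exact: measurable_trunc.
Qed.

Lemma mix0 u g : measurable_fun [set: R] g -> (forall x, 0 <= g x) ->
  mix u 0 g = (weight1 p mu1 u)%:E * \int[expo mu1_gt0]_y g y +
              (weight2 p mu2 u)%:E * \int[expo mu2_gt0]_y g y.
Proof.
move=> mg g0; rewrite /mix /bsum !big_nat1 /binomial_pmf !expr0 mulr1 bin0 mulr1n !mul1e subnn.
rewrite (ge0_integral_es1 mu1_gt0 mu2_gt0 0 0 mg g0) (ge0_integral_es2 mu1_gt0 mu2_gt0 0 0 mg g0).
have i0 (m : probability R R) x : 0 <= \int[m]_y g (x + y)%R by apply: integral_ge0.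
by congr (_ * _ + _ * _); (rewrite ge0_integral_es00//; last exact: measurable_integral_shift);
  apply: eq_integral => y _; rewrite add0r.
Qed.

(** Induction on [m]. For [m = 0] memorylessness turns the condition [u < S f] into the two weights.
    In the step, the last service is independent of the preceding ones; integrating it out replaces
    [g] by [service_int g], and [mixS] does the same to the mixture. *)
Lemma integral_elapsed f u m g : (1 <= f)%N -> (f + m <= n)%N -> (0 <= u)%R ->
  measurable_fun [set: R] g -> (forall x, 0 <= g x) ->
  \int[P]_x (if (u < S f x)%R then g (elapsed (S^~ x) f u m.+1) else 0) = mix u m g.
Proof.
move=> f1 + u0; elim: m g => [|m IH] g fmn mg g0.
  have fn : (1 <= f <= n)%N by rewrite f1 -(addn0 f).
  have mif : measurable_fun [set: R] (fun y => if (u < y)%R then g (y - u)%R else 0).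
    apply: measurable_fun_ifT => //; first exact: measurable_fun_ltr.
    by apply: measurableT_comp => //; exact: measurable_funB.
  transitivity (\int[P]_x ((fun y => if (u < y)%R then g (y - u)%R else 0) (S f x))).
    by apply: eq_integral => x _; rewrite /elapsed addn1 big_nat1.
  rewrite (integral_service fn mif); last by move=> y; case: ifP.
  by rewrite !expo_memoryless// mix0// !muleA -!EFinM.
(* The client that departs last; its service alone forms the second block. *)
pose c := (f + m.+1)%N.
pose F (z : g_sigma_algebraType (block S f c) * g_sigma_algebraType (block S c c.+1)) :=
  if (u < trunc f c (S^~ z.1) f)%R
  then g (elapsed (trunc f c (S^~ z.1)) f u m.+1 + trunc c c.+1 (S^~ z.2) c)%R else 0.
have tf x : trunc f c (S^~ x) f = S f x by rewrite /trunc leqnn /c -addSnnS leq_addr.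
have tc x : trunc c c.+1 (S^~ x) c = S c x by rewrite /trunc !leqnn.
have mF : measurable_fun setT F.
  apply: measurable_fun_ifT => //.
    apply: measurable_fun_ltr => //.
    exact: (measurable_fun_fst (@measurable_trunc f c f)).
  apply: measurableT_comp => //; apply: measurable_funD.
    exact: (measurable_fun_fst (@measurable_elapsed f u m.+1 c)).
  exact: (measurable_fun_snd (@measurable_trunc c c.+1 c)).
have F0 z : 0 <= F z by rewrite /F; case: ifP.
have fcc : (f <= c <= c.+1)%N by rewrite leqnSn leq_addr.
transitivity (\int[P]_x F (x, x)).
  apply: eq_integral => x _; rewrite /F/= tf tc elapsed_trunc//.
  by rewrite /elapsed addnS big_nat_recr ?leq_addr//= addrAC.
rewrite (block_integral S_indep f1 fcc _ mF F0)//.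
rewrite mixS// -IH//; last 3 first.
- by rewrite (leq_trans _ fmn)// leq_add2l.
- exact: measurable_service_int.
- by move=> x; exact: service_int_ge0.
apply: eq_integral => x _; rewrite /F/= tf elapsed_trunc//; case: ifP => _; last first.
  by rewrite integral0.
under eq_integral do rewrite tc.
have cn : (1 <= c <= n)%N by rewrite fmn (leq_trans f1)// leq_addr.
apply: (integral_service (g := fun y => g (elapsed (S^~ x) f u m.+1 + y)%R) cn) => //.
by apply: measurableT_comp => //; exact: measurable_addr.
Qed.

Lemma prob_survival c u : (1 <= c <= n)%N -> (0 <= u)%R ->
  \int[P]_x (if (u < S c x)%R then 1 else 0) = (survival p mu1 mu2 u)%:E.
Proof.
move=> cn u0.
have m1 : measurable_fun [set: R] (fun y => if (u < y)%R then 1 else 0 : \bar R).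
  by apply: measurable_fun_ifT => //; exact: measurable_fun_ltr.
rewrite (integral_service cn m1); last by move=> y; case: ifP.
have H l (l0 : (0 < l)%R) : \int[expo l0]_y (if (u < y)%R then 1 else 0) = (expR (- l * u))%:E.
  rewrite (@expo_memoryless l l0 u (cst 1))// integral_cst// mul1e.
  by rewrite [X in _ * X]probability_setT mule1.
by rewrite !H -!EFinM -EFinD.
Qed.

End laws.

Section transitions.
Context d (Omega : measurableType d) (R : realType) (P : probability Omega R).
Variables (n : nat) (p mu1 mu2 : R) (mu1_gt0 : 0 < mu1) (mu2_gt0 : 0 < mu2).
Variable S : nat -> {RV P >-> R}.
Hypothesis p01 : 0 <= p <= 1.
Hypothesis S_indep : mutually_independent [pred j | (1 <= j <= n)%N] S.
Hypothesis S_law : forall j, (1 <= j <= n)%N -> forall A, measurable A ->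
  distribution P (S j) A = hyperexp_prob p mu1 mu2 A.
Hypothesis S_ge0 : forall c x, 0 <= S c x.
Local Open Scope ereal_scope.
Local Notation mix := (mix p mu1_gt0 mu2_gt0).
Local Notation survival := (survival p mu1 mu2).
Implicit Types (g : R -> \bar R) (u t : R).

Lemma measurable_fun_comp2 d0 d1 d2 d3 (T0 : measurableType d0) (T1 : measurableType d1)
    (T2 : measurableType d2) (T3 : measurableType d3) (h : T1 -> T2 -> T3) (a : T0 -> T1) (b : T0 -> T2) :
  measurable_fun [set: T1 * T2] (fun z => h z.1 z.2) ->
  measurable_fun [set: T0] a -> measurable_fun [set: T0] b ->
  measurable_fun [set: T0] (fun x => h (a x) (b x)).
Proof.
move=> mh ma mb; exact: (measurableT_comp mh (measurable_fun_pair ma mb)).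
Qed.

Lemma measurable_partial d1 d2 (T1 : measurableType d1) (T2 : measurableType d2)
    (G : set (set T2)) (mG : G `<=` measurable)
    (Psi : T1 * g_sigma_algebraType G -> \bar R) (m : probability T2 R) :
  measurable_fun setT Psi -> (forall z, 0 <= Psi z) ->
  measurable_fun setT (fun w => \int[m]_y Psi (w, y)).
Proof.
move=> mPsi Psi0.
apply: (@measurable_fun_fubini_tonelli_F _ _ T1 T2 R m (fun z => Psi z)) => //.
have mid : measurable_fun [set: T1 * T2]
    (fun z => (z.1, z.2) : T1 * g_sigma_algebraType G).
  apply: measurable_fun_pair => //.
  exact: (measurable_fun_snd (measurable_id_sub mG)).
by have := measurableT_comp mPsi mid; apply: eq_measurable_fun => -[].
Qed.

(** The departure time reads the services up to [f + m], and [Psi] otherwise reads later ones. So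
    the later ones can be integrated with the departure time frozen, which leaves a function of that
    time alone. *)
Lemma integral_elapsed_block f u m (Psi : R * g_sigma_algebraType (block S (f + m.+1) n.+1) -> \bar R) :
  (1 <= f)%N -> (f + m <= n)%N -> (0 <= u)%R ->
  measurable_fun setT Psi -> (forall z, 0 <= Psi z) ->
  \int[P]_x (if (u < S f x)%R then Psi (elapsed (S^~ x) f u m.+1, x) else 0) =
  mix u m (fun w => \int[P]_y Psi (w, y)).
Proof.
move=> f1 fmn u0 mPsi Psi0; set c := (f + m.+1)%N.
have tf x : trunc f c (S^~ x) f = S f x by rewrite /trunc leqnn /c -addSnnS leq_addr.
pose F (z : g_sigma_algebraType (block S f c) * g_sigma_algebraType (block S c n.+1)) :=
  if (u < trunc f c (S^~ z.1) f)%R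
  then Psi (elapsed (trunc f c (S^~ z.1)) f u m.+1, z.2) else 0.
have mF : measurable_fun setT F.
  apply: measurable_fun_ifT => //.
    by apply: measurable_fun_ltr => //; exact: (measurable_fun_fst (@measurable_trunc _ _ _ _ _ f c f)).
  apply: (measurableT_comp mPsi); apply: measurable_fun_pair => //.
  exact: (measurable_fun_fst (@measurable_elapsed _ _ _ _ _ f u m.+1 c)).
have F0 z : 0 <= F z by rewrite /F; case: ifP.
have fcn : (f <= c <= n.+1)%N by rewrite leq_addr /c addnS ltnS.
transitivity (\int[P]_x F (x, x)).
  by apply: eq_integral => x _; rewrite /F/= tf elapsed_trunc.
rewrite (block_integral S_indep f1 fcn _ mF F0)//.
rewrite -(integral_elapsed mu1_gt0 mu2_gt0 p01 S_indep S_law f1 fmn u0)//; last 2 first.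
- exact: (measurable_partial (@block_measurable _ _ _ _ _ _ _)).
- by move=> w; exact: integral_ge0.
apply: eq_integral => x _; rewrite /F/= tf elapsed_trunc//.
by case: ifP => // _; rewrite integral0.
Qed.

Section next_state.
Variables (j k : nat) (u t : R) (Phi : nat -> R -> Omega -> \bar R).
Hypotheses (jn : (j < n)%N) (kj : (1 <= k <= j)%N) (u0 : (0 <= u)%R) (t0 : (0 <= t)%R).
Hypothesis Phi0 : forall l v y, 0 <= Phi l v y.
Hypothesis mPhi : forall l, (1 <= l <= j.+1)%N -> measurable_fun setT
  (fun z : R * g_sigma_algebraType (block S (j.+1 - l).+1 n.+1) => Phi l z.1 z.2).

(** [next_state_split] under the integral. In the term with [m] departures, the test that the next
    service is still in progress is a condition on the later block and stays inside the inner
    integral. *)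
Lemma integral_next_state :
  \int[P]_x (if (u < S (j - k).+1 x)%R
             then Phi (next_state (S^~ x) j (k, u) t).1 (next_state (S^~ x) j (k, u) t).2 x
             else 0) =
  \int[P]_y (if (u + t < S (j - k).+1 y)%R then Phi k.+1 (u + t)%R y else 0) +
  \sum_(1 <= m < k) mix u m.-1 (fun w => if (w <= t)%R then
     \int[P]_y (if (t - w < S ((j - k).+1 + m)%N y)%R then Phi (k - m).+1 (t - w)%R y else 0)
     else 0) +
  mix u k.-1 (fun w => if (w <= t)%R then \int[P]_y Phi 1%N 0%R y else 0).
Proof.
case/andP: (kj) => k1 kj'; set f := (j - k).+1.
have fm m : (m <= k)%N -> (1 <= m)%N -> (f + m.-1 <= n)%N by rewrite /f; lia.
pose Psi m (z : R * g_sigma_algebraType (block S (f + m)%N n.+1)) :=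
  if (z.1 <= t)%R then if (t - z.1 < S (f + m)%N z.2)%R then Phi (k - m).+1 (t - z.1)%R z.2 else 0 else 0.
pose Psik (z : R * g_sigma_algebraType (block S (f + k)%N n.+1)) :=
  if (z.1 <= t)%R then Phi 1%N 0%R z.2 else 0.
have Psi0 m z : 0 <= Psi m z by rewrite /Psi; do 2 case: ifP => //.
have Psik0 z : 0 <= Psik z by rewrite /Psik; case: ifP.
have mPsi m : (1 <= m < k)%N -> measurable_fun setT (Psi m).
  move=> mk; have lj : (1 <= (k - m).+1 <= j.+1)%N by lia.
  have := mPhi lj; have -> : (j.+1 - (k - m).+1).+1 = (f + m)%N by rewrite /f; lia.
  move=> mPhi'; apply: measurable_fun_ifT => //; first exact: measurable_fun_ler.
  have mtz : measurable_fun setT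
      (fun z : R * g_sigma_algebraType (block S (f + m)%N n.+1) => (t - z.1)%R).
    exact: measurable_funB.
  apply: measurable_fun_ifT => //.
    apply: measurable_fun_ltr => //.
    have fmn : (f + m <= f + m < n.+1)%N by rewrite /f; lia.
    exact: (measurable_fun_snd (@measurable_block _ _ _ _ S _ _ _ fmn)).
  exact: (measurable_fun_comp2 mPhi' mtz (@measurable_snd _ _ _ _)).
have mPsik : measurable_fun setT Psik.
  have := mPhi (l := 1%N) isT; have -> : (j.+1 - 1).+1 = (f + k)%N by rewrite /f; lia.
  move=> mPhi'; apply: measurable_fun_ifT => //; first exact: measurable_fun_ler.
  have mc : measurable_fun setT
      (fun _ : R * g_sigma_algebraType (block S (f + k)%N n.+1) => 0%R : R) by [].
  exact: (measurable_fun_comp2 mPhi' mc (@measurable_snd _ _ _ _)).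
pose T0 x := if (u + t < S f x)%R then Phi k.+1 (u + t)%R x else 0.
(* [T1 m] is 0 outside the range of summation so that it is measurable and nonnegative for every
   [m]. *)
pose T1 m x := if (1 <= m < k)%N then
  if (u < S f x)%R then Psi m (elapsed (S^~ x) f u m, x) else 0 else 0.
pose T2 x := if (u < S f x)%R then Psik (elapsed (S^~ x) f u k, x) else 0.
have mid m : measurable_fun setT (fun x : Omega => (elapsed (S^~ x) f u m, x) :
    R * g_sigma_algebraType (block S (f + m)%N n.+1)).
  apply: measurable_fun_pair; last by apply: measurable_id_sub; exact: block_measurable.
  by apply: measurable_funB => //; exact: measurable_sum.
have mT1 m : measurable_fun setT (T1 m).
  rewrite /T1; have [mk|//] := boolP (1 <= m < k)%N; apply: measurable_fun_ifT => //; first exact: measurable_fun_ltr.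
  by apply: (measurableT_comp (mPsi m mk)).
have mT2 : measurable_fun setT T2.
  apply: measurable_fun_ifT => //; first exact: measurable_fun_ltr.
  exact: (measurableT_comp mPsik (mid k)).
have mT0 : measurable_fun setT T0.
  apply: measurable_fun_ifT => //; first exact: measurable_fun_ltr.
  have lj : (1 <= k.+1 <= j.+1)%N by lia.
  apply: (measurable_fun_comp2 (a := fun=> (u + t)%R) (mPhi lj) (measurable_cst _)).
  by apply: measurable_id_sub; exact: block_measurable.
have T00 x : 0 <= T0 x by rewrite /T0; case: ifP.
have T10 m x : 0 <= T1 m x by rewrite /T1; case: ifP => // _; case: ifP.
have T20 x : 0 <= T2 x by rewrite /T2; case: ifP.
have mT1' : measurable_fun setT (fun x => \sum_(1 <= m < k) T1 m x).
  exact: emeasurable_sum.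
transitivity (\int[P]_x (T0 x + \sum_(1 <= m < k) T1 m x + T2 x)).
  apply: eq_integral => x _.
  rewrite (next_state_split (fun l v => Phi l v x) u t (fun c => S_ge0 c x) kj).
  rewrite /T0 /T1 /T2 -/f; have [uS|Su] := ltP u (S f x).
    congr (_ + _ + _); apply: eq_big_nat => m ->; rewrite /Psi/=.
    rewrite /departure -/f -/(elapsed (S^~ x) f u m).
    by case: (_ <= t)%R => //=.
  rewrite big1; last by move=> m _; case: ifP.
  rewrite !adde0 ltNge (le_trans Su)//.
  by rewrite lerDl.
rewrite ge0_integralD//; last 2 first.
- by move=> x _; rewrite adde_ge0// sume_ge0.
- exact: emeasurable_funD.
rewrite ge0_integralD//; last by move=> x _; exact: sume_ge0.
congr (_ + _ + _).
- rewrite ge0_integral_sum//; apply: eq_big_nat => -[//|m] mk.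
  rewrite /T1 mk [LHS](integral_elapsed_block _ _ _ (mPsi _ mk))//; last first.
    by rewrite /f; lia.
  congr (mix _ _ _); apply/funext => w; rewrite /Psi/=.
  by case: ifP => // _; rewrite integral0.
- rewrite /T2 -(prednK k1) in mPsik Psik0 *.
  rewrite [LHS](integral_elapsed_block _ _ _ mPsik)//; last first.
    by rewrite /f; lia.
  congr (mix _ _ _); apply/funext => w; rewrite /Psik/=.
  by case: ifP => // _; rewrite integral0.
Qed.

End next_state.
End transitions.

(** The integral of a nonnegative function is a supremum over simple functions below it, hence
    monotone without measurability. Comparisons with the cost of a policy as a function of the
    elapsed time rely on this. *)
Lemma ge0_le_integral_nonmeas d (T : measurableType d) (R : realType)
    (m : {measure set T -> \bar R}) (g h : T -> \bar R) :
  (forall x, 0 <= g x)%E -> (forall x, g x <= h x)%E ->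
  (\int[m]_x g x <= \int[m]_x h x)%E.
Proof.
move=> g0 gh; rewrite !ge0_integralTE//; last by move=> x; exact: le_trans (g0 x) (gh x).
apply: ereal_sup_le => _ [f fg <-]; exists f => // x; exact: le_trans (fg x) (gh x).
Qed.

(** * Linearity and monotonicity of the mixtures *)

Section mix_theory.
Context {R : realType} (p mu1 mu2 : R) (mu1_gt0 : 0 < mu1) (mu2_gt0 : 0 < mu2).
Hypothesis p01 : 0 <= p <= 1.
Local Open Scope ereal_scope.
Local Notation mix := (mix p mu1_gt0 mu2_gt0).
Local Notation survival := (survival p mu1 mu2).
Implicit Types (g h : R -> \bar R) (u t : R).

Let es_int g a b := \int[es mu1_gt0 mu2_gt0 a b]_x g x.

Let bsum_es_ge0 m g (c e : nat -> nat) : (forall x, 0 <= g x) ->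
  0 <= bsum p m (fun a b => es_int g (c a) (e b)).
Proof. by move=> g0; apply: bsum_ge0 => // a b; apply: integral_ge0. Qed.

Let mix_es_int u m g : mix u m g =
  (weight1 p mu1 u)%:E * bsum p m (fun a b => es_int g (S a) (id b)) +
  (weight2 p mu2 u)%:E * bsum p m (fun a b => es_int g (id a) (S b)).
Proof. by []. Qed.

Lemma mixD u m g h : measurable_fun [set: R] g -> (forall x, 0 <= g x) ->
  measurable_fun [set: R] h -> (forall x, 0 <= h x) ->
  mix u m (fun x => g x + h x) = mix u m g + mix u m h.
Proof.
move=> mg g0 mh h0.
have H (c e : nat -> nat) : bsum p m (fun a b => es_int (fun x => g x + h x) (c a) (e b)) =
    bsum p m (fun a b => es_int g (c a) (e b)) + bsum p m (fun a b => es_int h (c a) (e b)).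
  rewrite -bsumD; [|by move=> a b; apply: integral_ge0..].
  by apply: eq_bsum => a b _; rewrite /es_int ge0_integralD.
have := bsum_es_ge0 m S id g0; have := bsum_es_ge0 m id S g0.
have := bsum_es_ge0 m S id h0; have := bsum_es_ge0 m id S h0.
rewrite !mix_es_int (H S id) (H id S).
move: (bsum p m (fun a b => es_int g _ _)) (bsum p m (fun a b => es_int g _ _)).
move: (bsum p m (fun a b => es_int h _ _)) (bsum p m (fun a b => es_int h _ _)).
move=> a b c e a0 b0 c0 e0.
by rewrite (ge0_muleDr _ e0 b0) (ge0_muleDr _ c0 a0) addeACA.
Qed.

Lemma mixZ u m (c : R) g : (0 <= c)%R -> measurable_fun [set: R] g -> (forall x, 0 <= g x) ->
  mix u m (fun x => c%:E * g x) = c%:E * mix u m g.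
Proof.
move=> c0 mg g0.
have H (f e : nat -> nat) : bsum p m (fun a b => es_int (fun x => c%:E * g x) (f a) (e b)) =
    c%:E * bsum p m (fun a b => es_int g (f a) (e b)).
  rewrite -(bsumZ p01); last by move=> a b; apply: integral_ge0.
  by apply: eq_bsum => a b _; rewrite /es_int ge0_integralZl// lee_fin.
have := bsum_es_ge0 m S id g0; have := bsum_es_ge0 m id S g0.
rewrite !mix_es_int (H S id) (H id S).
move: (bsum _ _ _) (bsum _ _ _) => a b a0 b0.
have wa : 0 <= (weight1 p mu1 u)%:E * a by apply: mule_ge0; rewrite ?lee_fin ?weight1_ge0.
have wb : 0 <= (weight2 p mu2 u)%:E * b by apply: mule_ge0; rewrite ?lee_fin ?weight2_ge0.
by rewrite (ge0_muleDr _ wa wb) muleCA [X in _ + X]muleCA.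
Qed.

Lemma le_mix u m g h : (forall x, 0 <= g x) -> (forall x, g x <= h x) -> mix u m g <= mix u m h.
Proof.
move=> g0 gh.
have H (c e : nat -> nat) : bsum p m (fun a b => es_int g (c a) (e b)) <=
    bsum p m (fun a b => es_int h (c a) (e b)).
  by apply: (le_bsum p01) => a b _; exact: ge0_le_integral_nonmeas.
rewrite !mix_es_int; apply: leeD.
  by apply: (lee_wpmul2l _ (H S id)); rewrite lee_fin weight1_ge0.
by apply: (lee_wpmul2l _ (H id S)); rewrite lee_fin weight2_ge0.
Qed.

Lemma le_mix_weight u v m g : (u <= v)%R -> (forall x, 0 <= g x) -> mix v m g <= mix u m g.
Proof.
move=> uv g0; have b0 X : (forall a b, 0 <= X a b) -> 0 <= bsum p m X by exact: bsum_ge0.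
have [p0 q0] : (0 <= p /\ 0 <= 1 - p)%R by split; rewrite ?subr_ge0; case/andP: p01.
apply: leeD; apply: lee_wpmul2r; rewrite ?lee_fin; try (by apply: b0 => a b; apply: integral_ge0);
  by apply: ler_wpM2l => //; rewrite ler_expR !mulNr lerN2 ler_wpM2l// ltW.
Qed.

Lemma mix_cst u m : mix u m (cst 1) = (survival u)%:E.
Proof.
have e1 (mu : probability R R) : \int[mu]_y (cst 1 : R -> \bar R) y = 1.
  by rewrite integral_cst// mul1e; exact: probability_setT.
elim: m => [|m IH].
  by rewrite mix0// !e1 !mule1 -EFinD.
rewrite mixS// (_ : service_int _ _ _ _ = cst 1)//.
by apply/funext => x; rewrite /service_int !e1 !mule1 -EFinD addrC subrK.
Qed.

(* [l] clients remain just after the next arrival, the one in service having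
   elapsed time [t - w], if the [(k - l).+1]-st departure occurs at [w <= t]. *)
Definition transition (W : nat -> R -> \bar R) k u t :=
  \sum_(2 <= l < k.+1) mix u (k - l) (fun w => if (w <= t)%R then W l (t - w)%R else 0) +
  mix u k.-1 (fun w => if (w <= t)%R then W 1%N 0%R else 0) + W k.+1 (u + t)%R.

Lemma survivalM_hbar k u : (survival u * hbar p mu1 mu2 k u =
  weight1 p mu1 u * hbarz p mu1 mu2 k mu1 + weight2 p mu2 u * hbarz p mu1 mu2 k mu2)%R.
Proof.
rewrite /hbar /gamma1 /gamma2 -/(weight1 p mu1 u) -/(weight2 p mu2 u).
have := survival_gt0 mu1 mu2 p01 u; set s := survival u => s0; field.
by rewrite gt_eqF.
Qed.

End mix_theory.

Section one_step.
Context d (Omega : measurableType d) (R : realType) (P : probability Omega R).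
Variables (n : nat) (p mu1 mu2 omega : R) (mu1_gt0 : 0 < mu1) (mu2_gt0 : 0 < mu2).
Variable S : nat -> {RV P >-> R}.
Hypothesis p01 : 0 <= p <= 1.
Hypothesis omega01 : 0 <= omega <= 1.
Hypothesis S_indep : mutually_independent [pred j | (1 <= j <= n)%N] S.
Hypothesis S_law : forall j, (1 <= j <= n)%N -> forall A, measurable A ->
  distribution P (S j) A = hyperexp_prob p mu1 mu2 A.
Hypothesis S_ge0 : forall c x, 0 <= S c x.
Local Open Scope ereal_scope.
Local Notation mix := (mix p mu1_gt0 mu2_gt0).
Local Notation survival := (survival p mu1 mu2).
Local Notation fbar := (fbar p mu1 mu2).
Local Notation hbar := (hbar p mu1 mu2).
Implicit Types (g h : R -> \bar R) (u t : R) (W : nat -> R -> \bar R).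

Lemma elapsed_ge0 x f u m : (u < S f x)%R -> (0 <= elapsed (S^~ x) f u m.+1)%R.
Proof.
move=> uS; rewrite /elapsed addnS subr_ge0 big_ltn ?ltnS ?leq_addr//.
by rewrite (le_trans (ltW uS))// lerDl sumr_ge0.
Qed.

(** The mixture is realized by an actual departure time, which is nonnegative on the event that the
    service in progress exceeds [u]. The bound [m < n] provides enough clients. *)
Lemma eq_mix u m g h : (m < n)%N -> (0 <= u)%R ->
  measurable_fun [set: R] g -> (forall x, 0 <= g x) ->
  measurable_fun [set: R] h -> (forall x, 0 <= h x) ->
  (forall x, (0 <= x)%R -> g x = h x) -> mix u m g = mix u m h.
Proof.
move=> mn u0 mg g0 mh h0 gh.
rewrite -!(integral_elapsed mu1_gt0 mu2_gt0 p01 S_indep S_law (f := 1%N))//.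
by apply: eq_integral => x _; case: ifP => // uS; rewrite gh// elapsed_ge0.
Qed.

(** The residual service has mean [mu1^-1] or [mu2^-1] by memorylessness, and on nonnegative
    arguments each fresh service adds its mean. The maximum with 0 only serves to make the integrand
    nonnegative everywhere. *)
Lemma mix_elapsed u m : (m < n)%N -> (0 <= u)%R ->
  mix u m (fun x => (Num.max 0 x)%:E) =
  (weight1 p mu1 u * (mu1^-1 + m%:R * mean_service p mu1 mu2) +
   weight2 p mu2 u * (mu2^-1 + m%:R * mean_service p mu1 mu2))%:E.
Proof.
move=> + u0; pose g (x : R) := (Num.max 0 x)%:E : \bar R.
have mg : measurable_fun [set: R] g.
  by apply/measurable_EFinP; exact: measurable_maxr.
have g0 x : 0 <= g x by rewrite lee_fin le_max lexx.
have mean0 : (0 <= mean_service p mu1 mu2)%R.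
  case/andP: p01 => p0 p1; rewrite addr_ge0 ?divr_ge0 ?subr_ge0//; exact: ltW.
elim: m => [|m IH] mn.
  by rewrite mix0//= !mean_expo !mul0r !addr0 -!EFinM -EFinD.
rewrite mixS//.
transitivity (mix u m (fun x => g x + (mean_service p mu1 mu2)%:E * cst 1 x)).
  apply: eq_mix; rewrite ?(ltnW mn)//.
  - exact: measurable_service_int.
  - by move=> x; exact: service_int_ge0.
  - by apply: emeasurable_funD => //; exact: measurable_cst.
  - by move=> x; rewrite adde_ge0//= mule1 lee_fin.
  move=> x x0; rewrite /service_int.
  have H l (l0 : (0 < l)%R) : \int[expo l0]_y (Num.max 0 (x + y))%:E = (x + l^-1)%:E.
    have -> : \int[expo l0]_y (Num.max 0 (x + y))%:E = \int[expo l0]_y (x%:E + (Num.max 0 (y : R))%:E).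
      apply: eq_integral_ge0.
      - exact: expo_lt0.
      - apply/measurable_EFinP; apply: measurable_maxr => //; exact: measurable_addr.
      - by apply: emeasurable_funD => //; exact: measurable_cst.
      - by move=> y; rewrite lee_fin le_max lexx.
      - by move=> y; rewrite -EFinD lee_fin addr_ge0// le_max lexx.
      - by move=> y y0; rewrite !max_r// addr_ge0.
    rewrite ge0_integralD//; last by move=> y _; rewrite lee_fin le_max lexx.
    rewrite mean_expo integral_cst// [X in _ * X]probability_setT mule1//.
  rewrite !H /g mule1 max_r// -!EFinM -!EFinD; congr EFin; rewrite /mean_service; ring.
rewrite mixD//; last by move=> x; rewrite mule1 lee_fin.
rewrite mixZ// mix_cst// IH; last exact: ltnW.
rewrite -EFinM -EFinD /Defs.survival -/(weight1 p mu1 u) -/(weight2 p mu2 u); congr EFin.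
rewrite -natr1; ring.
Qed.

End one_step.

(** * The one-step equation for the cost of a policy *)

Section one_step_cost.
Context d (Omega : measurableType d) (R : realType) (P : probability Omega R).
Variables (n : nat) (p mu1 mu2 omega : R) (mu1_gt0 : 0 < mu1) (mu2_gt0 : 0 < mu2).
Variable S : nat -> {RV P >-> R}.
Hypothesis p01 : 0 <= p <= 1.
Hypothesis omega01 : 0 <= omega <= 1.
Hypothesis S_indep : mutually_independent [pred j | (1 <= j <= n)%N] S.
Hypothesis S_law : forall j, (1 <= j <= n)%N -> forall A, measurable A ->
  distribution P (S j) A = hyperexp_prob p mu1 mu2 A.
Hypothesis S_ge0 : forall c x, 0 <= S c x.
Local Open Scope ereal_scope.
Local Notation mix := (mix p mu1_gt0 mu2_gt0).
Local Notation survival := (survival p mu1 mu2).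
Local Notation fbar := (fbar p mu1 mu2).
Local Notation hbar := (hbar p mu1 mu2).
Implicit Types (g h : R -> \bar R) (u t : R) (W : nat -> R -> \bar R).

Local Notation transition := (transition p mu1_gt0 mu2_gt0).

Lemma prob_service_le0 c : (1 <= c <= n)%N -> P [set x | (S c x <= 0)%R] = 0.
Proof.
move=> cn; have m0 : measurable [set x | (0 < S c x)%R].
  by rewrite -[X in measurable X]setTI; apply: measurable_fun_ltr.
transitivity (P (~` [set x | (0 < S c x)%R])).
  by congr (P _); apply/seteqP; split => x /=; rewrite leNgt => /negP.
rewrite probability_setC// (_ : P _ = 1) ?subee//.
transitivity (\int[P]_x (\1_[set x | (0 < S c x)%R] x)%:E).
  by rewrite integral_indic// setIT.
transitivity (survival 0)%:E; last by rewrite /survival !mulr0 expR0 !mulr1 addrC subrK.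
rewrite -(prob_survival mu1_gt0 mu2_gt0 p01 S_law cn (lexx 0%R)).
apply: eq_integral => x _; rewrite indicE.
by have [h|h] := boolP (0 < S c x)%R; [rewrite mem_set|rewrite memNset//; exact/negP].
Qed.

Lemma integral_waiting k u i : (i <= n)%N -> (1 <= k <= i)%N -> (0 <= u)%R ->
  \int[P]_x (if (u < S (i - k).+1 x)%R then (waiting (S^~ x) i (k, u))%:E else 0) =
  (survival u * hbar k u)%:E.
Proof.
move=> ni /andP[k1 ki] u0; rewrite survivalM_hbar// /hbarz /waiting/=.
case: k k1 ki => // -[|k] _ ki /=.
  rewrite !mulr0 addr0; under eq_integral do rewrite if_same.
  exact: integral0.
have mm : measurable_fun [set: R] (fun x : R => (Num.max 0 x)%:E).
  by apply/measurable_EFinP; exact: measurable_maxr.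
(* With [k.+2] clients present, the last one waits for [k.+1] departures: the residual service and
   [k] fresh ones. *)
rewrite subn2/= -(mix_elapsed mu1_gt0 mu2_gt0 p01 S_indep S_law S_ge0)//; last by lia.
rewrite -(integral_elapsed mu1_gt0 mu2_gt0 p01 S_indep S_law (f := (i - k.+2).+1))//;
  [|by lia|by move=> y; rewrite lee_fin le_max lexx].
apply: eq_integral => x _; case: ifP => // uS.
by rewrite max_r// (elapsed_ge0 S_ge0).
Qed.

Lemma integral_idle k u i t : (i < n)%N -> (1 <= k <= i)%N -> (0 <= u)%R -> (0 <= t)%R ->
  \int[P]_x (if (u < S (i - k).+1 x)%R then (idle (S^~ x) i (k, u) t)%:E else 0) =
  (survival u * fbar k u t)%:E.
Proof.
move=> ni /andP[k1 ki] u0 t0; rewrite -(mix_idle mu1_gt0 mu2_gt0 p01)//.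
rewrite -(integral_elapsed mu1_gt0 mu2_gt0 p01 S_indep S_law (f := (i - k).+1))//.
- by rewrite prednK.
- by lia.
- by apply/measurable_EFinP; apply: measurable_maxr => //; exact: measurable_subr.
- by move=> x; rewrite lee_fin le_max lexx.
Qed.

(** After [m] departures out of [k], the next arrival makes [l = (k - m).+1] clients; the sum is
    reindexed from [m] to [l]. *)
Lemma sum_departures k (F : nat -> \bar R) :
  \sum_(1 <= m < k) F m = \sum_(2 <= l < k.+1) F (k - l).+1.
Proof.
rewrite [RHS]big_add1/= big_nat_rev/= add1n; apply: eq_big_nat => m /andP[m1 mk].
by congr F; lia.
Qed.

Lemma eq_transition W W' i k u t : (k <= i)%N -> (0 <= u)%R -> (0 <= t)%R ->
  (forall l v, (1 <= l <= i.+1)%N -> (0 <= v)%R -> W l v = W' l v) ->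
  transition W k u t = transition W' k u t.
Proof.
move=> ki u0 t0 WW; rewrite /transition; congr (_ + _ + _).
- apply: eq_big_nat => l lk; congr (mix _ _ _); apply/funext => w.
  by case: ifP => // wt; apply: WW; [lia|rewrite subr_ge0].
- by congr (mix _ _ _); apply/funext => w; rewrite WW.
- by rewrite WW ?addr_ge0//; lia.
Qed.

Lemma integral_transition i k u t (Phi : nat -> R -> Omega -> \bar R) :
  (i < n)%N -> (1 <= k <= i)%N -> (0 <= u)%R -> (0 <= t)%R ->
  (forall l v y, 0 <= Phi l v y) ->
  (forall l, (1 <= l <= i.+1)%N -> measurable_fun setT
    (fun z : R * g_sigma_algebraType (block S (i.+1 - l).+1 n.+1) => Phi l z.1 z.2)) ->
  \int[P]_x (if (u < S (i - k).+1 x)%R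
             then Phi (next_state (S^~ x) i (k, u) t).1 (next_state (S^~ x) i (k, u) t).2 x
             else 0) =
  transition (fun l v => \int[P]_y (if (v < S (i.+1 - l).+1 y)%R then Phi l v y else 0)) k u t.
Proof.
move=> ni ki u0 t0 Phi0 mPhi; have /andP[k1 ki'] := ki.
rewrite (integral_next_state mu1_gt0 mu2_gt0 p01 S_indep S_law S_ge0 ni ki u0 t0 Phi0 mPhi).
have rot (x y z : \bar R) : x + y + z = y + z + x by rewrite -addeA addeC.
have add3 (x x' y y' z z' : \bar R) : x = x' -> y = y' -> z = z' -> x + y + z = x' + y' + z'.
  by move=> -> -> ->.
rewrite [LHS]rot; apply: add3.
- rewrite sum_departures; apply: eq_big_nat => l /andP[l2 lk].
  have e1 : (k - (k - l).+1).+1 = l by lia.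
  have e2 : ((i - k).+1 + (k - l).+1)%N = (i.+1 - l).+1 by lia.
  by rewrite e1 e2.
- congr (mix _ _ _); apply/funext => w; case: ifP => // _.
  have n1 : (1 <= (i.+1 - 1).+1 <= n)%N by lia.
  have mN : measurable [set x | (S (i.+1 - 1).+1 x <= 0)%R].
    by rewrite -[X in measurable X]setTI; apply: measurable_fun_ler.
  have mP1 : measurable_fun setT (Phi 1%N 0%R).
    have mc : measurable_fun setT (fun _ : Omega => 0%R : R) by [].
    apply: (measurable_fun_comp2 (mPhi 1%N isT) mc).
    by apply: measurable_id_sub; exact: block_measurable.
  (* When the system has emptied, the arriving client is subject to no test, whereas [transition]
     asks for a service larger than 0. The two differ on a null set. *)
  apply: ge0_ae_eq_integral => //.
  + by apply: measurable_fun_ifT => //; apply: measurable_fun_ltr.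
  + by move=> x _; case: ifP.
  exists [set x | (S (i.+1 - 1).+1 x <= 0)%R]; split => //; first exact: prob_service_le0.
  by move=> x /= H; rewrite leNgt; apply/negP => h; apply: H => _; rewrite h.
- by rewrite subSS.
Qed.

(** Conservation of probability: [integral_transition] for [Phi = 1]. *)
Lemma mass_balance k u i t : (i < n)%N -> (1 <= k <= i)%N -> (0 <= u)%R -> (0 <= t)%R ->
  (survival u)%:E = transition (fun _ v => (survival v)%:E) k u t.
Proof.
move=> ni ki u0 t0; have /andP[k1 ki'] := ki.
have fn : (1 <= (i - k).+1 <= n)%N by lia.
rewrite -(prob_survival mu1_gt0 mu2_gt0 p01 S_law fn u0).
transitivity (transition (fun l v => \int[P]_y (if (v < S (i.+1 - l).+1 y)%R then 1 else 0)) k u t).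
  rewrite -(integral_transition (Phi := fun _ _ _ => 1) ni ki u0 t0)//.
have H l v : (1 <= l <= i.+1)%N -> (0 <= v)%R ->
    \int[P]_y (if (v < S (i.+1 - l).+1 y)%R then 1 else 0) = (survival v)%:E.
  by move=> li v0; rewrite (prob_survival mu1_gt0 mu2_gt0 p01 S_law)//; lia.
exact: eq_transition (ki') u0 t0 H.
Qed.

(** The expression minimized in the recursion, times [survival u], where [W l v] stands for
    [survival v] times the cost in state [(l, v)]. *)
Definition onestep W k u t : \bar R :=
  (survival u * (omega * fbar k u t + (1 - omega) * hbar k u))%:E + transition W k u t.

Section policy.
Variable tau : nat -> nat -> R -> R.
Hypothesis ptau : policy tau.

(* The expected cost times the probability [survival u] of the event conditioned
   on. *)
Definition total_cost i k u := \int[P]_x (if (u < S (i - k).+1 x)%R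
  then (path_cost omega n tau i k u (S^~ x))%:E else 0).

Lemma total_cost_last k u : (1 <= k <= n)%N -> (0 <= u)%R ->
  total_cost n k u = ((1 - omega) * (survival u * hbar k u))%:E.
Proof.
move=> kn u0; rewrite EFinM -(integral_waiting (leqnn n) kn u0) -ge0_integralZl//.
- apply: eq_integral => x _; rewrite path_cost_last EFinM.
  by case: ifP; rewrite ?mule0.
- apply: measurable_fun_ifT => //; first exact: measurable_fun_ltr.
  apply/measurable_EFinP; apply: (@measurable_waiting _ _ _ (fun c x => S c x) _ (fun=> k) (fun=> u)) => //.
- move=> x _; case: ifP => // uS.
  by rewrite lee_fin waiting_ge0//; [case/andP: kn|exact: ltW].
- by rewrite lee_fin subr_ge0; case/andP: omega01.
Qed.

Lemma total_cost_onestep i k u : (i < n)%N -> (1 <= k <= i)%N -> (0 <= u)%R ->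
  total_cost i k u = onestep (total_cost i.+1) k u (tau i k u).
Proof.
move=> ni ki u0; have [mt /(_ u) t0] := ptau i k; set t := tau i k u.
have /andP[k1 ki'] := ki.
(* For an elapsed time beyond the service in progress, [path_cost] may be negative. Such states do
   not occur on the paths considered, so the positive part changes nothing there and makes [Phi]
   nonnegative everywhere. *)
pose Phi l v y := (Num.max 0 (path_cost omega n tau i.+1 l v (S^~ y)))%:E.
have Phi0 l v y : 0 <= Phi l v y by rewrite lee_fin le_max lexx.
have mPhi l : (1 <= l <= i.+1)%N -> measurable_fun setT
    (fun z : R * g_sigma_algebraType (block S (i.+1 - l).+1 n.+1) => Phi l z.1 z.2).
  move=> li; apply/measurable_EFinP; apply: measurable_maxr => //.
  have ms c : measurable_fun setT
      (fun z : R * g_sigma_algebraType (block S (i.+1 - l).+1 n.+1) =>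
        trunc (i.+1 - l).+1 n.+1 (S^~ z.2) c).
    exact: (measurable_fun_snd (@measurable_trunc _ _ _ _ _ _ _ c)).
  have mpc := measurable_path_cost n ms (fun j k => proj1 (ptau j k)) omega i.+1 l (@measurable_fst _ _ _ _).
  move: mpc; apply: eq_measurable_fun => z _ /=; apply: (@path_cost_local _ _ _ _ (i.+1 - l).+1) => //.
    by move=> c; rewrite /trunc ltnS => ->.
have nx x : (u < S (i - k).+1 x)%R ->
    (path_cost omega n tau i.+1 (next_state (S^~ x) i (k, u) t).1 (next_state (S^~ x) i (k, u) t).2 (S^~ x))%:E =
    Phi (next_state (S^~ x) i (k, u) t).1 (next_state (S^~ x) i (k, u) t).2 x.
  move=> uS; rewrite /Phi max_r//.
  have [h1 h2] := next_state_bounds (S^~ x) u t ki.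
  by apply: path_cost_ge0 => //; exact: next_stateP.
pose I x := if (u < S (i - k).+1 x)%R then (idle (S^~ x) i (k, u) t)%:E else 0.
pose W x := if (u < S (i - k).+1 x)%R then (waiting (S^~ x) i (k, u))%:E else 0.
pose N x := if (u < S (i - k).+1 x)%R then
  Phi (next_state (S^~ x) i (k, u) t).1 (next_state (S^~ x) i (k, u) t).2 x else 0.
have [w0 w1] : (0 <= omega)%R /\ (0 <= 1 - omega)%R.
  by case/andP: omega01; rewrite subr_ge0.
have I0 x : 0 <= I x by rewrite /I; case: ifP => // _; rewrite lee_fin le_max lexx.
have W0 x : 0 <= W x.
  by rewrite /W; case: ifP => // uS; rewrite lee_fin waiting_ge0//; exact: ltW.
have N0 x : 0 <= N x by rewrite /N; case: ifP.
have mI : measurable_fun setT I.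
  apply: measurable_fun_ifT => //; first exact: measurable_fun_ltr.
  apply/measurable_EFinP; exact: (@measurable_idle _ _ _ (fun c x => S c x) _ (fun=> k) (fun=> u) _ _ i (fun=> t)).
have mW : measurable_fun setT W.
  apply: measurable_fun_ifT => //; first exact: measurable_fun_ltr.
  apply/measurable_EFinP; exact: (@measurable_waiting _ _ _ (fun c x => S c x) _ (fun=> k) (fun=> u)).
have mN : measurable_fun setT N.
  apply: measurable_fun_ifT => //; first exact: measurable_fun_ltr.
  apply/measurable_EFinP; apply: measurable_maxr => //.
  pose s c x := S c x.
  have ms c : measurable_fun setT (s c) by [].
  apply: (@measurable_nat_param _ _ _ _ _ (fun l x => path_cost omega n tau i.+1 l
    (next_state (S^~ x) i (k, u) t).2 (S^~ x))).
    exact: (@measurable_next_state1 _ _ _ s ms (fun=> k) (fun=> u) _ _ i (fun=> t)).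
  move=> l; apply: (@measurable_path_cost _ _ _ s n ms tau (fun j k => proj1 (ptau j k))).
  exact: (@measurable_next_state2 _ _ _ s ms (fun=> k) (fun=> u) _ _ i (fun=> t)).
transitivity (\int[P]_x (omega%:E * I x + (1 - omega)%:E * W x + N x)).
  apply: eq_integral => x _; rewrite /I /W /N; case: ifP => uS.
    by rewrite -nx// -!EFinM -!EFinD (path_costS _ _ _ _ _ ni).
  by rewrite !mule0 !adde0.
rewrite ge0_integralD//; last 2 first.
- by move=> x _; rewrite adde_ge0// mule_ge0.
- by apply: emeasurable_funD; exact: measurable_funeM.
rewrite ge0_integralD//; last 4 first.
- by move=> x _; rewrite mule_ge0.
- exact: measurable_funeM.
- by move=> x _; rewrite mule_ge0.
- exact: measurable_funeM.
rewrite !ge0_integralZl//.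
rewrite integral_idle// integral_waiting//; last exact: ltnW.
rewrite integral_transition// -!EFinM -EFinD /onestep; congr (_%:E + _); first by ring.
apply: (eq_transition ki' u0 t0) => l v li v0; apply: eq_integral => y _.
case: ifP => // vS; rewrite /Phi max_r//.
by apply: path_cost_ge0 => //; rewrite v0 ltW.
Qed.
End policy.
End one_step_cost.

(** * Value iteration *)

Section value_iteration.
Context {R : realType} (p mu1 mu2 omega : R) (mu1_gt0 : 0 < mu1) (mu2_gt0 : 0 < mu2).
Hypothesis p01 : 0 <= p <= 1.
Hypothesis omega01 : 0 <= omega <= 1.
Local Open Scope ereal_scope.
Local Notation mix := (mix p mu1_gt0 mu2_gt0).
Local Notation survival := (survival p mu1 mu2).
Local Notation fbar := (fbar p mu1 mu2).
Local Notation hbar := (hbar p mu1 mu2).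
Local Notation transition := (transition p mu1_gt0 mu2_gt0).
Local Notation onestep := (onestep p omega mu1_gt0 mu2_gt0).
Implicit Types (g h : R -> \bar R) (u t : R) (W : nat -> R -> \bar R).

Let w0 : (0 <= omega)%R. Proof. by case/andP: omega01. Qed.
Let w1 : (0 <= 1 - omega)%R. Proof. by rewrite subr_ge0; case/andP: omega01. Qed.
Let p0 : (0 <= p)%R. Proof. by case/andP: p01. Qed.
Let q0 : (0 <= 1 - p)%R. Proof. by rewrite subr_ge0; case/andP: p01. Qed.

Lemma survival_noninc u v : (u <= v)%R -> (survival v <= survival u)%R.
Proof.
by move=> uv; rewrite /survival lerD// ler_wpM2l// ler_expR !mulNr lerN2 ler_wpM2l// ltW.
Qed.

Lemma hbarz_ge0 k mu : (0 < mu)%R -> (0 <= hbarz p mu1 mu2 k mu)%R.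
Proof.
move=> mu0; rewrite /hbarz; case: ifP => // _.
rewrite addr_ge0 ?invr_ge0 ?(ltW mu0)// mulr_ge0//.
by rewrite /mean_service; apply: addr_ge0; apply: divr_ge0 => //; exact: ltW.
Qed.

Lemma survival_hbar_ge0 k u : (0 <= survival u * hbar k u)%R.
Proof.
rewrite survivalM_hbar//; apply: addr_ge0; apply: mulr_ge0.
- exact: weight1_ge0.
- exact: hbarz_ge0.
- exact: weight2_ge0.
- exact: hbarz_ge0.
Qed.

Lemma survival_hbar_noninc k u v : (u <= v)%R ->
  (survival v * hbar k v <= survival u * hbar k u)%R.
Proof.
move=> uv; rewrite !survivalM_hbar// /weight1 /weight2 lerD// ler_wpM2r ?hbarz_ge0//;
  by rewrite ler_wpM2l// ler_expR !mulNr lerN2 ler_wpM2l// ltW.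
Qed.

Lemma onestepE W k u t : (1 <= k)%N -> (0 <= t)%R ->
  onestep W k u t = omega%:E * mix u k.-1 (fun x => (Num.max 0 (t - x))%:E) +
    ((1 - omega) * (survival u * hbar k u))%:E + transition W k u t.
Proof.
move=> k1 t0; rewrite mix_idle// -EFinM -EFinD.
have -> : onestep W k u t =
  (survival u * (omega * fbar k u t + (1 - omega) * hbar k u))%:E + transition W k u t by [].
by congr (_%:E + _); ring.
Qed.

Definition truncated t g (w : R) : \bar R := if (w <= t)%R then g (t - w)%R else 0.

Lemma truncated_ge0 t g w : (forall v, 0 <= g v) -> 0 <= truncated t g w.
Proof. by rewrite /truncated; case: ifP. Qed.

Lemma measurable_truncated t g : measurable_fun setT g -> measurable_fun setT (truncated t g).
Proof.
move=> mg; apply: measurable_fun_ifT => //; first exact: measurable_fun_ler.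
by apply: measurableT_comp => //; exact: measurable_subr.
Qed.

Lemma transitionE W k u t : transition W k u t =
  \sum_(2 <= l < k.+1) mix u (k - l) (truncated t (W l)) +
  mix u k.-1 (truncated t (fun=> W 1%N 0%R)) + W k.+1 (u + t)%R.
Proof. by []. Qed.

Lemma transition_ge0 W k u t : (forall l v, (1 <= l)%N -> 0 <= W l v) -> 0 <= transition W k u t.
Proof.
move=> W0; rewrite transitionE; apply: adde_ge0; last exact: W0.
apply: adde_ge0; last by apply: mix_ge0 => // x; apply: truncated_ge0 => v; exact: W0.
rewrite big_nat_cond; apply: sume_ge0 => l; rewrite andbT => /andP[l2 _].
by apply: mix_ge0 => // x; apply: truncated_ge0 => v; apply: W0; exact: ltnW.
Qed.

Lemma le_transition W W' i k u t : (k <= i)%N -> (0 <= u)%R -> (0 <= t)%R ->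
  (forall l v, (1 <= l <= i.+1)%N -> (0 <= v)%R -> 0 <= W l v <= W' l v) ->
  transition W k u t <= transition W' k u t.
Proof.
move=> ki u0 t0 WW; rewrite !transitionE; apply: leeD; first apply: leeD.
- rewrite big_nat_cond [leRHS]big_nat_cond.
  apply: lee_sum => l; rewrite andbT => /andP[l2 lk].
  have H w : (w <= t)%R -> 0 <= W l (t - w)%R <= W' l (t - w)%R.
    move=> wt; apply: WW; last by rewrite subr_ge0.
    by rewrite (ltnW l2)/= ltnW// (leq_trans lk).
  by apply: le_mix => // x; rewrite /truncated; case: ifP => // /H /andP[].
- have /andP[h1 h2] : 0 <= W 1%N 0%R <= W' 1%N 0%R by apply: WW.
  by apply: le_mix => // x; rewrite /truncated; case: ifP.
- by have /andP[] : 0 <= W k.+1 (u + t)%R <= W' k.+1 (u + t)%R by apply: WW; rewrite ?addr_ge0.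
Qed.

Lemma transition_noninc W k u v t : (u <= v)%R ->
  (forall l x, (1 <= l)%N -> 0 <= W l x) ->
  (forall l x y, (1 <= l)%N -> (x <= y)%R -> W l y <= W l x) ->
  transition W k v t <= transition W k u t.
Proof.
move=> uv W0 Wn; rewrite !transitionE; apply: leeD; first apply: leeD.
- rewrite big_nat_cond [leRHS]big_nat_cond.
  apply: lee_sum => l; rewrite andbT => /andP[l2 lk].
  by apply: le_mix_weight => // x; apply: truncated_ge0 => y; apply: W0; exact: ltnW.
- by apply: le_mix_weight => // x; apply: truncated_ge0 => y; exact: W0.
- by apply: Wn => //; rewrite lerD2r.
Qed.

Lemma mix_bound u m g (c : R) : (0 <= c)%R ->
  (forall a b, (0 < a + b)%N -> \int[es mu1_gt0 mu2_gt0 a b]_x g x <= c%:E) ->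
  mix u m g <= (c * survival u)%:E.
Proof.
move=> c0 gc.
have e1 : mix u m (fun x => c%:E * cst 1 x) = (c * survival u)%:E.
  by rewrite mixZ// mix_cst// EFinM.
have ec a b : \int[es mu1_gt0 mu2_gt0 a b]_x (c%:E * cst 1 x) = c%:E.
  by under eq_integral do rewrite mule1; rewrite integral_cst// [X in _ * X]probability_setT mule1.
rewrite -e1 /mix; apply: leeD.
- apply: lee_wpmul2l; first by rewrite lee_fin weight1_ge0.
  by apply: (le_bsum p01) => a b _; rewrite ec gc// addnS.
- apply: lee_wpmul2l; first by rewrite lee_fin weight2_ge0.
  by apply: (le_bsum p01) => a b _; rewrite ec gc// addnS.
Qed.

(* On [w <= t], monotonicity of [g] gives [g (t' - w) <= g (t - w)]; the event
   [t < w <= t'] has probability at most [(mu1 + mu2) * (t' - t)]. *)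
Lemma mix_truncated_right u m g (G t t' : R) : (t <= t')%R -> (0 <= G)%R ->
  measurable_fun setT g -> (forall v, 0 <= g v) ->
  (forall x y, (x <= y)%R -> g y <= g x) -> g 0%R <= G%:E ->
  mix u m (truncated t' g) <=
  mix u m (truncated t g) + (G * ((mu1 + mu2) * (t' - t) * survival u))%:E.
Proof.
move=> tt' G0 mg g0 gn gG.
pose I (w : R) := if (t < w <= t')%R then 1 else 0 : \bar R.
have mI : measurable_fun setT I.
  apply: measurable_fun_ifT => //.
  by apply: measurable_and; [exact: measurable_fun_ltr|exact: measurable_fun_ler].
have I0 w : 0 <= I w by rewrite /I; case: ifP.
have mtg := measurable_truncated t mg.
have tg0 w : 0 <= truncated t g w by exact: truncated_ge0.
apply: (@le_trans _ _ (mix u m (fun w => truncated t g w + G%:E * I w))).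
  apply: le_mix => // w; first by exact: truncated_ge0.
  rewrite /truncated /I; have [wt|tw] := leP w t.
    by rewrite (le_trans wt tt') mule0 adde0 gn// lerD2r.
  rewrite add0e; have [wt'|//] := leP w t'; last by rewrite mule0.
  by rewrite mule1 (le_trans _ gG)// gn// subr_ge0.
rewrite mixD//; last 2 first.
- exact: measurable_funeM.
- by move=> w; rewrite mule_ge0// lee_fin.
rewrite mixZ// leeD2l// EFinM lee_wpmul2l// ?lee_fin//.
have mu0 : (0 <= mu1 + mu2)%R by rewrite addr_ge0// ltW.
apply: mix_bound => [|a b ab]; first by rewrite mulr_ge0// subr_ge0.
apply: le_trans (es_itv mu1_gt0 mu2_gt0 ab tt').
rewrite [leRHS]integral_indic1//.
rewrite le_eqVlt; apply/orP; left; apply/eqP; apply: eq_integral => w _.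
by rewrite /I indicE mem_setE in_itv/=; case: (_ && _).
Qed.

(** The slope is made of the values of [W] at elapsed time 0, which bound it on nonnegative times.
    The summand without departure can only decrease with [t]. *)
Lemma transition_right W k u : (1 <= k)%N ->
  (forall l, (1 <= l)%N -> measurable_fun setT (W l)) ->
  (forall l x, (1 <= l)%N -> 0 <= W l x) ->
  (forall l x y, (1 <= l)%N -> (x <= y)%R -> W l y <= W l x) ->
  (forall l x, (1 <= l)%N -> W l x < +oo) ->
  exists2 L : R, (0 <= L)%R & forall t t', (t <= t')%R ->
    transition W k u t' <= transition W k u t + (L * (t' - t))%:E.
Proof.
move=> k1 mW W0 Wn Woo.
have Wfin l x : (1 <= l)%N -> W l x \is a fin_num.
  by move=> l1; rewrite ge0_fin_numE ?W0 ?Woo.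
have fW0 l x : (1 <= l)%N -> (0 <= fine (W l x))%R by move=> l1; rewrite fine_ge0// W0.
have mu0 : (0 <= mu1 + mu2)%R by rewrite addr_ge0// ltW.
have s0 := survival_gt0 mu1 mu2 p01 u.
pose c := ((mu1 + mu2) * survival u)%R.
have c0 : (0 <= c)%R by rewrite mulr_ge0// ltW.
exists (\sum_(2 <= l < k.+1) fine (W l 0%R) * c + fine (W 1%N 0%R) * c)%R.
  rewrite addr_ge0//; last by rewrite mulr_ge0// fW0.
  by rewrite big_nat_cond sumr_ge0// => l; rewrite andbT => /andP[l2 _]; rewrite mulr_ge0// fW0// ltnW.
move=> t t' tt'; rewrite !transitionE mulrDl.
have AC (x y z : \bar R) (a b : R) : x + y + z + (a + b)%:E = (x + a%:E) + (y + b%:E) + z.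
  by rewrite EFinD addeAC addeACA.
rewrite AC; apply: leeD; last by apply: Wn => //; rewrite lerD2l.
apply: leeD.
- rewrite mulr_suml -sumEFin -big_split/= big_nat_cond [leRHS]big_nat_cond.
  apply: lee_sum => l; rewrite andbT => /andP[l2 lk]; have l1 : (1 <= l)%N by exact: ltnW.
  have := @mix_truncated_right u (k - l) (W l) (fine (W l 0%R)) t t' tt' (fW0 l 0%R l1) (mW l l1)
    (fun x => W0 l x l1) (fun x y => Wn l x y l1).
  rewrite fineK ?Wfin// lexx => /(_ isT); congr (_ <= _ + _%:E); rewrite /c; ring.
- have := @mix_truncated_right u k.-1 (fun=> W 1%N 0%R) (fine (W 1%N 0%R)) t t' tt' (fW0 1%N 0%R isT).
  rewrite fineK ?Wfin// => /(_ (measurable_cst _) (fun=> W0 1%N 0%R isT) (fun _ _ _ => lexx _) (lexx _)).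
  congr (_ <= _ + _%:E); rewrite /c; ring.
Qed.

Lemma transition_lty W k u t : (1 <= k)%N -> (0 <= t)%R ->
  (forall l x, (1 <= l)%N -> 0 <= W l x) ->
  (forall l x y, (1 <= l)%N -> (x <= y)%R -> W l y <= W l x) ->
  (forall l x, (1 <= l)%N -> W l x < +oo) ->
  transition W k u t < +oo.
Proof.
move=> k1 t0 W0 Wn Woo.
have Wfin l x : (1 <= l)%N -> W l x \is a fin_num.
  by move=> l1; rewrite ge0_fin_numE ?W0 ?Woo.
have H m g (G : R) : (0 <= G)%R -> (forall v, 0 <= g v) -> (forall v, (0 <= v)%R -> g v <= G%:E) ->
    mix u m (truncated t g) <= (G * survival u)%:E.
  move=> G0 g0 gG; rewrite EFinM -(mix_cst mu1_gt0 mu2_gt0 p01 u m) -mixZ//.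
  apply: le_mix => // w; first exact: truncated_ge0.
  by rewrite mule1 /truncated; case: ifP => [wt|_]; rewrite ?lee_fin// gG// subr_ge0.
have fW0 l x : (1 <= l)%N -> (0 <= fine (W l x))%R by move=> l1; rewrite fine_ge0// W0.
rewrite transitionE; apply: lte_add_pinfty; last exact: Woo.
apply: (@le_lt_trans _ _ (\sum_(2 <= l < k.+1) fine (W l 0%R) * survival u +
  fine (W 1%N 0%R) * survival u)%:E); last exact: ltry.
rewrite EFinD; apply: leeD.
- rewrite -sumEFin big_nat_cond [leRHS]big_nat_cond.
  apply: lee_sum => l; rewrite andbT => /andP[l2 lk]; have l1 : (1 <= l)%N by exact: ltnW.
  by apply: H => [||v v0]; rewrite ?fW0 ?fineK ?Wfin//; [move=> v; exact: W0|exact: Wn].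
- by apply: H => [||v v0]; rewrite ?fW0 ?fineK ?Wfin// => v; exact: W0.
Qed.

Lemma onestep_ge0 W k u t : (1 <= k)%N -> (0 <= t)%R ->
  (forall l x, (1 <= l)%N -> 0 <= W l x) -> 0 <= onestep W k u t.
Proof.
move=> k1 t0 W0; rewrite onestepE//; apply: adde_ge0; last exact: transition_ge0.
apply: adde_ge0; last by rewrite lee_fin mulr_ge0// survival_hbar_ge0.
by rewrite mule_ge0// mix_ge0// => x; rewrite lee_fin le_max lexx.
Qed.

Lemma onestep_noninc W k u v t : (1 <= k)%N -> (0 <= t)%R -> (u <= v)%R ->
  (forall l x, (1 <= l)%N -> 0 <= W l x) ->
  (forall l x y, (1 <= l)%N -> (x <= y)%R -> W l y <= W l x) ->
  onestep W k v t <= onestep W k u t.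
Proof.
move=> k1 t0 uv W0 Wn; rewrite !onestepE//; apply: leeD; last exact: transition_noninc.
apply: leeD; last by rewrite lee_fin ler_wpM2l// survival_hbar_noninc.
by apply: lee_wpmul2l => //; apply: le_mix_weight => // x; rewrite lee_fin le_max lexx.
Qed.

(** The idle time [max 0 (t - x)] has slope at most 1 in [t] and the mixture has mass [survival u],
    whence the additional [omega * survival u]. *)
Lemma onestep_right W k u : (1 <= k)%N ->
  (forall l, (1 <= l)%N -> measurable_fun setT (W l)) ->
  (forall l x, (1 <= l)%N -> 0 <= W l x) ->
  (forall l x y, (1 <= l)%N -> (x <= y)%R -> W l y <= W l x) ->
  (forall l x, (1 <= l)%N -> W l x < +oo) ->
  exists2 L : R, (0 <= L)%R & forall t t', (0 <= t)%R -> (t <= t')%R ->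
    onestep W k u t' <= onestep W k u t + (L * (t' - t))%:E.
Proof.
move=> k1 mW W0 Wn Woo; have [L L0 HL] := transition_right u k1 mW W0 Wn Woo.
have s0 := survival_gt0 mu1 mu2 p01 u.
exists (omega * survival u + L)%R; first by rewrite addr_ge0// mulr_ge0// ltW.
move=> t t' t0 tt'; rewrite !onestepE ?(le_trans t0)// (mulrDl _ L) EFinD [leRHS]addeACA.
apply: leeD; last exact: HL.
rewrite [leRHS]addeAC; apply: leeD => //.
pose g t (x : R) := (Num.max 0 (t - x))%:E : \bar R.
have mg s : measurable_fun setT (g s).
  by apply/measurable_EFinP; apply: measurable_maxr => //; exact: measurable_subr.
have g0 s x : 0 <= g s x by rewrite lee_fin le_max lexx.
rewrite -mulrA EFinM -ge0_muleDr//; last 2 first.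
- by apply: mix_ge0 => // x; exact: (g0 t).
- by rewrite lee_fin mulr_ge0 ?subr_ge0// ltW.
apply: lee_wpmul2l => //.
have tt0 : (0 <= t' - t)%R by rewrite subr_ge0.
rewrite mulrC EFinM -(mix_cst mu1_gt0 mu2_gt0 p01 u k.-1) -mixZ//.
have -> : mix u k.-1 (g t) + mix u k.-1 (fun x => (t' - t)%:E * cst 1 x) =
    mix u k.-1 (fun x => g t x + (t' - t)%:E * cst 1 x).
  by rewrite -mixD// => x; rewrite mule1 lee_fin.
apply: le_mix => // x; first exact: (g0 t').
rewrite /g mule1 lee_fin ge_max addr_ge0 ?le_max ?lexx//=.
by have [h|h] := leP 0%R (t - x)%R; lra.
Qed.

(** [r] counts the arrivals still to come. The arrival index itself is absent because all services
    have the same law. *)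
Fixpoint value r k u : \bar R :=
  if r is r'.+1 then ereal_inf [set onestep (value r') k u t | t in [set t : R | (0 <= t)%R]]
  else ((1 - omega) * (survival u * hbar k u))%:E.

(** Proved together because finiteness and monotonicity of the next iterate each use several
    properties of the current one. *)
Lemma value_props r :
  [/\ forall k u, (1 <= k)%N -> 0 <= value r k u,
      forall k u v, (1 <= k)%N -> (u <= v)%R -> value r k v <= value r k u &
      forall k u, (1 <= k)%N -> value r k u < +oo].
Proof.
elim: r => [|r [V0 Vn Voo]]; split => [k u k1|k u v k1 uv|k u k1] /=.
- by rewrite lee_fin mulr_ge0// survival_hbar_ge0.
- by rewrite lee_fin ler_wpM2l// survival_hbar_noninc.
- exact: ltry.
- by apply: le_ereal_inf_tmp => _ [t t0 <-]; exact: onestep_ge0.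
- apply: le_ereal_inf_tmp => _ [t t0 <-]; apply: le_trans (onestep_noninc k1 t0 uv V0 Vn).
  by apply: ereal_inf_lbound; exists t.
(* The admissible decision [t = 0] already has finite cost. *)
- apply: (@le_lt_trans _ _ (onestep (value r) k u 0%R)).
    by apply: ereal_inf_lbound; exists 0%R => /=.
  by apply: lte_add_pinfty; [exact: ltry|exact: transition_lty].
Qed.

Lemma value_ge0 r k u : (1 <= k)%N -> 0 <= value r k u.
Proof. by move=> k1; have [V0 Vn Voo] := value_props r; auto. Qed.

Lemma value_noninc r k u v : (1 <= k)%N -> (u <= v)%R -> value r k v <= value r k u.
Proof. by move=> k1 uv; have [V0 Vn Voo] := value_props r; auto. Qed.

Lemma value_lty r k u : (1 <= k)%N -> value r k u < +oo.
Proof. by move=> k1; have [V0 Vn Voo] := value_props r; auto. Qed.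

Lemma value_fin r k u : (1 <= k)%N -> value r k u \is a fin_num.
Proof. by move=> k1; rewrite ge0_fin_numE ?value_ge0 ?value_lty. Qed.

Lemma noninc_measurable g : (forall x, g x \is a fin_num) ->
  (forall x y, (x <= y)%R -> g y <= g x) -> measurable_fun setT g.
Proof.
move=> gfin gn; rewrite (_ : g = EFin \o (fine \o g)); last first.
  by apply/funext => x /=; rewrite fineK.
apply/measurable_EFinP; apply: nonincreasing_measurable => // x y xy /=.
by rewrite fine_le// gn.
Qed.

Lemma measurable_value r k : (1 <= k)%N -> measurable_fun setT (value r k).
Proof.
by move=> k1; apply: noninc_measurable => [x|x y xy]; [exact: value_fin|exact: value_noninc].
Qed.

Lemma onestep_value_fin r k u t : (1 <= k)%N -> (0 <= t)%R ->
  onestep (value r) k u t \is a fin_num.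
Proof.
have [V0 Vn Voo] := value_props r.
move=> k1 t0; rewrite ge0_fin_numE ?onestep_ge0//.
by apply: lte_add_pinfty; [exact: ltry|exact: transition_lty].
Qed.

Lemma measurable_first d (T : measurableType d) (b : nat -> T -> bool) :
  (forall i, measurable_fun setT (b i)) ->
  exists2 N : T -> nat, measurable_fun setT N & forall x, (exists i, b i x) -> b (N x) x.
Proof.
move=> mb; pose N x := if pselect (exists i, b i x) is left H then ex_minn H else 0%N.
have mbi i v : measurable [set x | b i x = v].
  by rewrite -[X in measurable X]setTI; exact: (mb i _ [set v]).
exists N; last by move=> x H; rewrite /N; case: pselect => // H'; case: ex_minnP.
move=> _ Y mY; rewrite setTI.
have -> : N @^-1` Y = \bigcup_(m in Y) (N @^-1` [set m]).
  by apply/seteqP; split => [x Yx|x [m Ym /= NE]]; [exists (N x)|rewrite /preimage/= NE].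
apply: bigcup_measurable => m _.
(* The second set accounts for the default value 0 of [N] where no [b i] holds. *)
have -> : N @^-1` [set m] = ([set x | b m x = true] `&` \bigcap_(i < m) [set x | b i x = false]) `|`
    (if m == 0%N then \bigcap_i [set x | b i x = false] else set0).
  apply/seteqP; split => x /=.
    rewrite /N; case: pselect => [H|H].
      case: ex_minnP => i bi imin <-; left; split => // j /= ji.
      by apply/negP => /imin; rewrite leqNgt ji.
    by move=> <-; right => i _ /=; apply/negP => bi; apply: H; exists i.
  move=> [[bm bim]|].
    rewrite /N; case: pselect => [H|[]]; last by exists m.
    case: ex_minnP => i bi imin; apply/eqP; rewrite eqn_leq imin// leqNgt.
    by apply/negP => /bim; rewrite /= bi.
  case: eqP => // -> bF; rewrite /N; case: pselect => // -[i bi]; exfalso.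
  by have := bF i I; rewrite /= bi.
apply: measurableU; first apply: measurableI => //.
  by apply: bigcap_measurableType => i _.
by case: ifP => // _; apply: bigcap_measurableType => i _.
Qed.

(** Absolute values make every grid point an admissible decision while leaving the nonnegative
    rationals as they are; a number that encodes no rational gives 0. *)
Definition grid (i : nat) : R := if unpickle i is Some x then `|ratr (x : rat)|%R else 0.

Lemma grid_dense t t' : (0 <= t)%R -> (t < t')%R -> exists i, (t < grid i < t')%R.
Proof.
move=> t0 tt'; have [x] := rat_in_itvoo tt'; rewrite in_itv/= => xtt.
exists (pickle x); rewrite /grid pickleK ger0_norm//.
by case/andP: xtt => /ltW tx _; exact: le_trans tx.
Qed.

Lemma grid_ge0 i : (0 <= grid i)%R.
Proof. by rewrite /grid; case: unpickle. Qed.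

Lemma value_selector r k (e : R) : (1 <= k)%N -> (0 < e)%R ->
  exists f : R -> R, [/\ measurable_fun setT f, forall u, (0 <= f u)%R &
    forall u, onestep (value r) k u (f u) <= value r.+1 k u + (e * survival u)%:E].
Proof.
move=> k1 e0; have [V0 Vn Voo] := value_props r.
have Vm l : (1 <= l)%N -> measurable_fun setT (value r l) by exact: measurable_value.
pose J t u := fine (onestep (value r) k u t).
have JE t u : (0 <= t)%R -> onestep (value r) k u t = (J t u)%:E.
  by move=> t0; rewrite fineK// onestep_value_fin.
pose v u := fine (value r.+1 k u).
have vE u : value r.+1 k u = (v u)%:E by rewrite fineK// value_fin.
have mv : measurable_fun setT v.
  apply/measurable_EFinP; rewrite (_ : EFin \o v = value r.+1 k); first exact: measurable_value.
  by apply/funext => u; rewrite /= -vE.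
have mJ t : (0 <= t)%R -> measurable_fun setT (J t).
  move=> t0; apply/measurable_EFinP; rewrite (_ : EFin \o J t = onestep (value r) k ^~ t); last first.
    by apply/funext => u; rewrite /= -JE.
  apply: noninc_measurable => [x|x y xy]; first exact: onestep_value_fin.
  exact: onestep_noninc.
have ms : measurable_fun setT (survival : R -> R).
  by apply: nonincreasing_measurable => // x y xy; exact: survival_noninc.
have mb i : measurable_fun setT (fun u => (J (grid i) u < v u + e * survival u)%R).
  apply: measurable_fun_ltr; first by apply: mJ; exact: grid_ge0.
  by apply: measurable_funD => //; exact: measurable_funM.
have [N mN NP] := measurable_first mb.
exists (fun u => grid (N u)); split => [|u|u].
- exact: (measurable_nat_comp grid mN).
- exact: grid_ge0.
rewrite JE ?grid_ge0// vE -EFinD lee_fin ltW//; apply: NP.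
have s0 := survival_gt0 mu1 mu2 p01 u.
have : value r.+1 k u < (v u + e * survival u)%:E.
  by rewrite vE lte_fin ltrDl mulr_gt0.
move=> /ereal_inf_lt[_ [t t0 <-]]; rewrite JE// lte_fin => Jt.
have [L L0 HL] := onestep_right u k1 Vm V0 Vn Voo.
(* The slack left by [t], divided by [L + 1]: moving right by less than [dl] costs at most [L * dl],
   strictly less than the slack. The added 1 also covers [L = 0]. *)
pose dl := ((v u + e * survival u - J t u) / (L + 1))%R.
have dl0 : (0 < dl)%R by rewrite divr_gt0 ?subr_gt0// ltr_wpDl.
have [i /andP[ti it]] : exists i, (t < grid i < t + dl)%R by apply: grid_dense => //; rewrite ltrDl.
exists i; have := HL _ _ t0 (ltW ti); rewrite !JE ?grid_ge0// -EFinD lee_fin => /le_lt_trans; apply.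
rewrite addrC -ltrBrDr; apply: (@lt_le_trans _ _ ((L + 1) * dl)%R); last first.
  by rewrite /dl mulrC divfK// gt_eqF// ltr_wpDl.
apply: (@le_lt_trans _ _ (L * dl)%R); last by rewrite ltr_pM2r// ltrDl.
by rewrite ler_wpM2l// lerBlDl ltW.
Qed.

End value_iteration.

(** * Optimal cost *)

Section optimal_cost.
Context d (Omega : measurableType d) (R : realType) (P : probability Omega R).
Variables (n : nat) (p mu1 mu2 omega : R) (mu1_gt0 : 0 < mu1) (mu2_gt0 : 0 < mu2).
Variable S : nat -> {RV P >-> R}.
Hypothesis p01 : 0 <= p <= 1.
Hypothesis omega01 : 0 <= omega <= 1.
Hypothesis S_indep : mutually_independent [pred j | (1 <= j <= n)%N] S.
Hypothesis S_law : forall j, (1 <= j <= n)%N -> forall A, measurable A ->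
  distribution P (S j) A = hyperexp_prob p mu1 mu2 A.
Hypothesis S_ge0 : forall c x, 0 <= S c x.
Local Open Scope ereal_scope.
Local Notation mix := (mix p mu1_gt0 mu2_gt0).
Local Notation survival := (survival p mu1 mu2).
Local Notation transition := (transition p mu1_gt0 mu2_gt0).
Local Notation onestep := (onestep p omega mu1_gt0 mu2_gt0).
Local Notation value := (value p omega mu1_gt0 mu2_gt0).
Local Notation total_cost := (total_cost n omega S).
Implicit Types (u t : R) (W : nat -> R -> \bar R).

Lemma total_cost_ge0 tau i k u : policy tau -> (i <= n)%N -> (1 <= k <= i)%N -> (0 <= u)%R ->
  0 <= total_cost tau i k u.
Proof.
move=> ptau ni ki u0; apply: integral_ge0 => x _; case: ifP => // uS.
by rewrite lee_fin; apply: path_cost_ge0 => //; rewrite u0 ltW.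
Qed.

Lemma value_le_total_cost tau r : policy tau -> forall i k u, (i + r)%N = n ->
  (1 <= k <= i)%N -> (0 <= u)%R -> value r k u <= total_cost tau i k u.
Proof.
move=> ptau; elim: r => [|r IH] i k u irn ki u0.
  have ein : i = n by rewrite -irn addn0.
  rewrite ein in ki *.
  by rewrite (total_cost_last mu1_gt0 mu2_gt0 p01 omega01 S_indep S_law S_ge0).
have ni : (i < n)%N by rewrite -irn -addSnnS leq_addr.
have /andP[k1 ki'] := ki; have [_ /(_ u) t0] := ptau i k.
rewrite (total_cost_onestep mu1_gt0 mu2_gt0 p01 omega01 S_indep S_law S_ge0 ptau ni ki u0).
apply: (@le_trans _ _ (onestep (value r) k u (tau i k u))).
  by apply: ereal_inf_lbound; exists (tau i k u).
apply: leeD => //; apply: (le_transition mu1_gt0 mu2_gt0 p01 ki' u0 t0) => l v li v0.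
have /andP[l1 _] := li; rewrite value_ge0//=.
by apply: IH => //; rewrite addSnnS.
Qed.

Lemma transition_add W W' (c : R) k u t : (1 <= k)%N -> (0 <= c)%R ->
  (forall l, (1 <= l)%N -> measurable_fun setT (W l)) ->
  (forall l v, (1 <= l)%N -> 0 <= W l v) ->
  (forall l, (1 <= l)%N -> measurable_fun setT (W' l)) ->
  (forall l v, (1 <= l)%N -> 0 <= W' l v) ->
  transition (fun l v => W l v + c%:E * W' l v) k u t = transition W k u t + c%:E * transition W' k u t.
Proof.
move=> k1 c0 mW W0 mW' W'0.
have H m (g h : R -> \bar R) : measurable_fun setT g -> (forall v, 0 <= g v) ->
    measurable_fun setT h -> (forall v, 0 <= h v) ->
    mix u m (truncated t (fun v => g v + c%:E * h v)) =
    mix u m (truncated t g) + c%:E * mix u m (truncated t h).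
  move=> mg g0 mh h0.
  have mtg := measurable_truncated t mg; have mth := measurable_truncated t mh.
  have tg0 w : 0 <= truncated t g w by exact: truncated_ge0.
  have th0 w : 0 <= truncated t h w by exact: truncated_ge0.
  rewrite -mixZ// -mixD//; last 2 first.
  - exact: measurable_funeM.
  - by move=> w; rewrite mule_ge0.
  congr (mix _ _ _); apply/funext => w; rewrite /truncated.
  by case: ifP => // _; rewrite mule0 adde0.
have M0 m (g : R -> \bar R) : (forall v, 0 <= g v) -> 0 <= mix u m (truncated t g).
  by move=> g0; apply: mix_ge0 => // w; exact: truncated_ge0.
rewrite !transitionE (H _ (fun=> W 1%N 0%R) (fun=> W' 1%N 0%R))//;
  [|by move=> v; exact: W0|by move=> v; exact: W'0].
have -> : \sum_(2 <= l < k.+1) mix u (k - l) (truncated t (fun v => W l v + c%:E * W' l v)) =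
    \sum_(2 <= l < k.+1) mix u (k - l) (truncated t (W l)) +
    c%:E * \sum_(2 <= l < k.+1) mix u (k - l) (truncated t (W' l)).
  rewrite !big_nat ge0_sume_distrr; last first.
    by move=> l /andP[l2 _]; apply: M0 => v; apply: W'0; exact: ltnW.
  rewrite -big_split; apply: eq_bigr => l /andP[l2 _]; have l1 := ltnW l2.
  by apply: H => [|v||v]; [exact: mW|exact: W0|exact: mW'|exact: W'0].
set A' := \sum_(_ <= _ < _) mix u _ (truncated t (W' _)).
have A'0 : 0 <= A'.
  rewrite /A' big_nat; apply: sume_ge0 => l /andP[l2 _].
  by apply: M0 => v; apply: W'0; exact: ltnW.
have B'0 : 0 <= mix u k.-1 (truncated t (fun=> W' 1%N 0%R)) by apply: M0 => v; exact: W'0.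
have C'0 : 0 <= W' k.+1 (u + t)%R by exact: W'0.
move: A' (mix u k.-1 (truncated t (fun=> W' 1%N 0%R))) (W' k.+1 (u + t)%R) A'0 B'0 C'0 => A' B' C' A'0 B'0 C'0.
rewrite (ge0_muleDr _ (adde_ge0 A'0 B'0) C'0) (ge0_muleDr _ A'0 B'0).
have AC (x y z a b e : \bar R) : x + a + (y + b) + (z + e) = x + y + z + (a + b + e).
  by rewrite (addeACA x a) (addeACA (x + y)).
exact: AC.
Qed.

(** One policy serves all states and all arrivals at once; the error grows by [e * survival u] for
    each decision still to be made. *)
Lemma near_optimal_policy (e : R) : (0 < e)%R -> exists2 tau, policy tau &
  forall r i k u, (i + r)%N = n -> (1 <= k <= i)%N -> (0 <= u)%R ->
    total_cost tau i k u <= value r k u + (r%:R * e * survival u)%:E.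
Proof.
move=> e0.
(* One selector per pair of an arrival [j] and a number of clients, so that a single use of choice
   gives the policy. After the decision at [j], the index [n - j.+1] counts the arrivals after
   client [j.+1]; for zero clients any admissible decision will do. *)
have sel (jk : nat * nat) : exists f : R -> R, [/\ measurable_fun setT f, forall u, (0 <= f u)%R &
    (1 <= jk.2)%N -> forall u, onestep (value (n - jk.1.+1)) jk.2 u (f u) <=
      value (n - jk.1.+1).+1 jk.2 u + (e * survival u)%:E].
  have [k1|k0] := leqP 1 jk.2; last by exists (fun=> 0%R); split.
  by have [f [mf f0 fP]] := value_selector mu1_gt0 mu2_gt0 p01 omega01 (n - jk.1.+1) k1 e0; exists f.
have [tau0 tauP] := choice sel.
pose tau j k := tau0 (j, k).
have ptau : policy tau by move=> j k; have [] := tauP (j, k).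
exists tau => //; elim=> [|r IH] i k u irn ki u0.
  have ein : i = n by rewrite -irn addn0.
  rewrite ein in ki *.
  rewrite (total_cost_last mu1_gt0 mu2_gt0 p01 omega01 S_indep S_law S_ge0)//.
  by rewrite !mul0r adde0.
have ni : (i < n)%N by rewrite -irn -addSnnS leq_addr.
have /andP[k1 ki'] := ki; have [_ /(_ u) t0] := ptau i k.
rewrite (total_cost_onestep mu1_gt0 mu2_gt0 p01 omega01 S_indep S_law S_ge0 ptau ni ki u0).
have re0 : (0 <= r%:R * e)%R by rewrite mulr_ge0// ltW.
have s0 v : (0 <= survival v)%R by rewrite ltW// survival_gt0.
have er : (n - i.+1)%N = r by rewrite -irn -addSnnS addKn.
pose W l v := value r l v + (r%:R * e)%:E * (survival v)%:E.
apply: (@le_trans _ _ (onestep W k u (tau i k u))).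
  apply: leeD => //; apply: (le_transition mu1_gt0 mu2_gt0 p01 ki' u0 t0) => l v li v0.
  have /andP[l1 li'] := li; rewrite total_cost_ge0//= /W -EFinM.
  by apply: IH => //; rewrite addSnnS.
have ms : measurable_fun [set: R] (fun v => (survival v)%:E).
  apply/measurable_EFinP; apply: nonincreasing_measurable => // x y xy.
  exact: survival_noninc.
rewrite /onestep transition_add//; last 3 first.
- by move=> l l1; exact: measurable_value.
- by move=> l v l1; exact: value_ge0.
- by move=> l v l1; rewrite lee_fin.
rewrite -(mass_balance mu1_gt0 mu2_gt0 p01 omega01 S_indep S_law S_ge0 ni ki u0 t0).
rewrite addeA -[X in X + _]/(onestep (value r) k u (tau i k u)) -EFinM.
have [_ _ /(_ k1 u)] := tauP (i, k); rewrite er => h.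
apply: (@le_trans _ _ (value r.+1 k u + (e * survival u)%:E + (r%:R * e * survival u)%:E)).
  exact: leeD.
rewrite -addeA -EFinD (_ : (_ + _)%R = (r.+1%:R * e * survival u)%R)//.
by rewrite -natr1; ring.
Qed.

Lemma expected_costE tau i k u : (i <= n)%N -> (1 <= k <= i)%N -> (0 <= u)%R ->
  expected_cost S omega n tau i k u = ((survival u)^-1)%:E * total_cost tau i k u.
Proof.
move=> ni /andP[k1 ki] u0; rewrite /expected_cost.
have cn : (1 <= (i - k).+1 <= n)%N by lia.
have mS : measurable [set x | (u < S (i - k).+1 x)%R].
  by rewrite -[X in measurable X]setTI; apply: measurable_fun_ltr.
have -> : P [set x | (u < S (i - k).+1 x)%R] = (survival u)%:E.
  rewrite -(prob_survival mu1_gt0 mu2_gt0 p01 S_law cn u0).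
  transitivity (\int[P]_x (\1_[set x | (u < S (i - k).+1 x)%R] x)%:E).
    by rewrite integral_indic// setIT.
  apply: eq_integral => x _; rewrite indicE.
  by have [h|h] := boolP (u < S (i - k).+1 x)%R; [rewrite mem_set|rewrite memNset//; exact/negP].
congr (_ * _); rewrite [LHS]integral_mkcond; apply: eq_integral => x _; rewrite patchE.
by have [h|h] := boolP (u < S (i - k).+1 x)%R; [rewrite mem_set|rewrite memNset//; exact/negP].
Qed.

Lemma optimal_costE r i k u : (i + r)%N = n -> (1 <= k <= i)%N -> (0 <= u)%R ->
  optimal_cost S omega n i k u = ((survival u)^-1)%:E * value r k u.
Proof.
move=> irn ki u0; have /andP[k1 ki'] := ki.
have ni : (i <= n)%N by rewrite -irn leq_addr.
have s0 := survival_gt0 mu1 mu2 p01 u.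
have is0 : 0 <= ((survival u)^-1)%:E :> \bar R by rewrite lee_fin invr_ge0 ltW.
apply/eqP; rewrite eq_le; apply/andP; split.
  (* The total error [r%:R * e] must not exceed [dl]; dividing by [r.+1] instead of [r] covers
     [r = 0]. *)
  apply/lee_addgt0Pr => dl dl0; pose e := (dl / r.+1%:R)%R.
  have e0 : (0 < e)%R by rewrite divr_gt0.
  have [tau ptau H] := near_optimal_policy e0.
  apply: (@le_trans _ _ (expected_cost S omega n tau i k u)).
    by apply: ereal_inf_lbound; exists tau.
  rewrite expected_costE//.
  apply: (@le_trans _ _ (((survival u)^-1)%:E * (value r k u + (r%:R * e * survival u)%:E))).
    by rewrite lee_wpmul2l// H.
  rewrite ge0_muleDr ?value_ge0//; last by rewrite lee_fin !mulr_ge0// ltW.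
  rewrite leeD2l// -EFinM lee_fin mulrC mulfK ?gt_eqF// /e mulrA ler_pdivrMr//.
  by rewrite mulrC ler_pM2l// ler_nat.
apply: le_ereal_inf_tmp => _ [tau ptau <-]; rewrite expected_costE//.
by rewrite lee_wpmul2l// value_le_total_cost.
Qed.

End optimal_cost.

(** * From weighted values back to conditional costs *)

Section recursion.
Context {R : realType} (p mu1 mu2 omega : R) (mu1_gt0 : 0 < mu1) (mu2_gt0 : 0 < mu2).
Hypothesis p01 : 0 <= p <= 1.
Local Open Scope ereal_scope.
Local Notation survival := (survival p mu1 mu2).
Local Notation onestep := (onestep p omega mu1_gt0 mu2_gt0).
Implicit Types (W C : nat -> R -> \bar R).

(** Each summand of [onestep] carries the factor [survival u], except the one without departure,
    where the quotient of [survival (u + t)] by [survival u] is [P_up]. In the integral terms, [W]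
    is [survival] times the cost, which is the form of the integrand in [mix_trans]. *)
Lemma onestep_normalized W C i k u t : (1 <= k <= i)%N -> (0 <= u)%R -> (0 <= t)%R ->
  (forall l, (1 <= l)%N -> measurable_fun setT (W l)) ->
  (forall l v, (1 <= l)%N -> 0 <= W l v) ->
  W 1%N 0%R \is a fin_num ->
  (forall l v, (1 <= l <= i.+1)%N -> (0 <= v)%R -> C l v = ((survival v)^-1)%:E * W l v) ->
  ((survival u)^-1)%:E * onestep W k u t =
  (omega * fbar p mu1 mu2 k u t + (1 - omega) * hbar p mu1 mu2 k u)%:E +
  \sum_(2 <= l < k.+1) \int[lebesgue_measure]_(v in `]0%R, t[)
      ((p_trans p mu1 mu2 k l u v t)%:E * C l v) +
  (P_down p mu1 mu2 k u t)%:E * C 1%N 0%R +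
  (P_up p mu1 mu2 u t)%:E * C k.+1 (u + t)%R.
Proof.
move=> /andP[k1 ki] u0 t0 mW W0 Wfin CW.
have s0 v := survival_gt0 mu1 mu2 p01 v.
have sn0 v : survival v != 0%R by rewrite gt_eqF.
have is0 : 0 <= ((survival u)^-1)%:E :> \bar R by rewrite lee_fin invr_ge0 ltW.
have M0 m (g : R -> \bar R) : (forall v, 0 <= g v) -> 0 <= mix p mu1_gt0 mu2_gt0 u m (truncated t g).
  by move=> g0; apply: mix_ge0 => // w; exact: truncated_ge0.
have A0 : 0 <= \sum_(2 <= l < k.+1) mix p mu1_gt0 mu2_gt0 u (k - l) (truncated t (W l)).
  rewrite big_nat; apply: sume_ge0 => l /andP[l2 _].
  by apply: M0 => v; apply: W0; exact: ltnW.
have B0 : 0 <= mix p mu1_gt0 mu2_gt0 u k.-1 (truncated t (fun=> W 1%N 0%R)).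
  by apply: M0 => v; exact: W0.
have D0 : 0 <= W k.+1 (u + t)%R by exact: W0.
rewrite /onestep transitionE muleDr// ?fin_num_adde_defr//.
rewrite (ge0_muleDr _ (adde_ge0 A0 B0) D0) (ge0_muleDr _ A0 B0) !addeA.
have e4 (a a' b b' c c' e e' : \bar R) : a = a' -> b = b' -> c = c' -> e = e' ->
  a + b + c + e = a' + b' + c' + e' by move=> -> -> -> ->.
apply: e4.
- by rewrite -EFinM mulKf.
- rewrite big_nat [RHS]big_nat ge0_sume_distrr; last first.
    by move=> l /andP[l2 _]; apply: M0 => v; apply: W0; exact: ltnW.
  apply: eq_bigr => l /andP[l2 lk]; have l1 := ltnW l2.
  (* [C] is known for nonnegative [v] only; [g] agrees with it there and is measurable and
     nonnegative on the whole line. *)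
  pose g v := ((survival v)^-1)%:E * W l v.
  have mg : measurable_fun [set: R] g.
    apply: emeasurable_funM; last exact: mW.
    apply/measurable_EFinP; apply: nondecreasing_measurable => // x y xy.
    by rewrite lef_pV2 ?posrE// survival_noninc.
  have g0 v : 0 <= g v by rewrite mule_ge0 ?W0// lee_fin invr_ge0 ltW.
  have := mix_trans mu1_gt0 mu2_gt0 p01 k l u t0 mg g0.
  rewrite (_ : (fun x => _) = truncated t (W l)); last first.
    apply/funext => w; rewrite /truncated; case: ifP => // _.
    by rewrite /g muleA -EFinM mulfV// mul1e.
  move=> ->; rewrite muleA -EFinM mulVf// mul1e.
  apply: eq_integral => v; rewrite inE/= in_itv/= => /andP[v0 _].
  by rewrite CW// ?(ltW v0)// l1/= ltnW// (leq_trans lk).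
- rewrite CW// (_ : survival 0 = 1%R); last by rewrite /survival !mulr0 expR0 !mulr1 addrC subrK.
  rewrite invr1 mul1e -(fineK Wfin).
  pose I (w : R) : \bar R := if (w <= t)%R then 1 else 0.
  have mI : measurable_fun [set: R] I by apply: measurable_fun_ifT => //; exact: measurable_fun_ler.
  have I0 w : 0 <= I w by rewrite /I; case: ifP.
  rewrite (_ : truncated t _ = fun w => (fine (W 1%N 0%R))%:E * I w); last first.
    by apply/funext => w; rewrite /truncated /I; case: ifP => _; rewrite ?mule1 ?mule0.
  rewrite mixZ//; last by rewrite fine_ge0// W0.
  rewrite mix_down// -!EFinM; congr EFin.
  by rewrite mulrCA mulKf// mulrC.
- rewrite CW ?addr_ge0// muleA -EFinM; congr (_%:E * _).
  by rewrite /P_up mulrAC mulfV// mul1r.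
Qed.

End recursion.

(** * Services that are negative on a null set *)

Section absolute_value.
Context d (Omega : measurableType d) (R : realType) (P : probability Omega R).
Variables (n : nat) (p mu1 mu2 omega : R) (mu1_gt0 : 0 < mu1) (mu2_gt0 : 0 < mu2).
Variable S : nat -> {RV P >-> R}.
Hypothesis p01 : 0 <= p <= 1.
Hypothesis omega01 : 0 <= omega <= 1.
Hypothesis S_indep : mutually_independent [pred j | (1 <= j <= n)%N] S.
Hypothesis S_law : forall j, (1 <= j <= n)%N -> forall A, measurable A ->
  distribution P (S j) A = hyperexp_prob p mu1 mu2 A.
Local Open Scope ereal_scope.

(* The services are nonnegative only almost surely; their absolute values have the
   same joint law and satisfy the sample path identities everywhere. *)
Definition abs_fun c (x : Omega) : R := `|S c x|.

Let measurable_abs_fun c : measurable_fun [set: Omega] (abs_fun c).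
Proof. exact: measurableT_comp. Qed.

HB.instance Definition _ c := isMeasurableFun.Build _ _ _ _ (abs_fun c) (measurable_abs_fun c).
Definition abs_service c : {RV P >-> R} := abs_fun c.

Lemma abs_indep : mutually_independent [pred j | (1 <= j <= n)%N] abs_service.
Proof.
move=> J A uJ sJ mA.
apply: (S_indep uJ sJ (A := fun j => (fun y : R => `|y|%R) @^-1` A j)) => j.
rewrite -[X in measurable X]setTI; exact: measurableT_comp.
Qed.

Lemma abs_law j : (1 <= j <= n)%N -> forall A, measurable A ->
  distribution P (abs_service j) A = hyperexp_prob p mu1 mu2 A.
Proof.
move=> jn A mA.
have mnA : measurable ((fun y : R => `|y|%R) @^-1` A).
  rewrite -[X in measurable X]setTI; exact: measurableT_comp.
transitivity (hyperexp_prob p mu1 mu2 ((fun y : R => `|y|%R) @^-1` A)).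
  by rewrite -(S_law jn mnA).
rewrite /hyperexp_prob.
have H l (l0 : (0 < l)%R) : exponential_prob l ((fun y : R => `|y|%R) @^-1` A) = exponential_prob l A.
  rewrite -[LHS]/(expo l0 _) -[RHS]/(expo l0 A) (integral_indic1 _ mnA) (integral_indic1 _ mA).
  apply: eq_integral_ge0 => //; first exact: expo_lt0.
  - by apply/measurable_EFinP; exact: measurable_indic.
  - by apply/measurable_EFinP; exact: measurable_indic.
  - move=> x x0; rewrite !indicE (_ : (x \in _ @^-1` A) = (x \in A))//.
    by apply/idP/idP; rewrite !inE/= ger0_norm.
by rewrite !H.
Qed.

Lemma prob_service_lt0 c : (1 <= c <= n)%N -> P [set x | (S c x < 0)%R] = 0.
Proof.
move=> cn; have := S_law cn (measurable_itv `]-oo, 0%R[).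
rewrite /hyperexp_prob -[exponential_prob mu1 _]/(expo mu1_gt0 _) -[exponential_prob mu2 _]/(expo mu2_gt0 _).
rewrite !expo_lt0 !mule0 adde0 => <-.
congr (P _); apply/seteqP; split => x /=; by rewrite in_itv.
Qed.

Lemma expected_cost_abs tau i k u : policy tau -> (i <= n)%N -> (1 <= k <= i)%N -> (0 <= u)%R ->
  expected_cost S omega n tau i k u = expected_cost abs_service omega n tau i k u.
Proof.
move=> ptau ni ki u0.
rewrite (expected_costE mu1_gt0 mu2_gt0 p01 omega01 S_law)//.
rewrite (expected_costE mu1_gt0 mu2_gt0 p01 omega01 abs_law)//.
have mcost (X : nat -> {RV P >-> R}) : measurable_fun [set: Omega] (fun x =>
    if (u < X (i - k).+1 x)%R then (path_cost omega n tau i k u (X^~ x))%:E else 0).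
  apply: measurable_fun_ifT => //; first exact: measurable_fun_ltr.
  have mX c : measurable_fun [set: Omega] (X c) by [].
  apply/measurable_EFinP.
  exact: (measurable_path_cost n mX (fun j k => proj1 (ptau j k)) omega i k (measurable_cst u)).
congr (_ * _); apply: ae_eq_integral => //.
have [k1 ki'] := andP ki.
(* Nothing is known about the sign of services outside [1 <= c <= n]; by [path_cost_local] the cost
   does not read them. *)
pose N c := if (1 <= c <= n)%N then [set x | (S c x < 0)%R] else set0.
have N0 : P.-negligible (\bigcup_c N c).
  apply: negligible_bigcup => c; rewrite /N; case: ifP => [cn|_]; last exact: negligible_set0.
  exists [set x | (S c x < 0)%R]; split => //; last exact: prob_service_lt0.
  by rewrite -[X in measurable X]setTI; apply: measurable_fun_ltr.
apply: negligibleS N0 => x /= H; apply: contrapT => xN; apply: H => _.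
have Sx c : (1 <= c <= n)%N -> S c x = abs_service c x.
  move=> cn; rewrite /abs_service/= /abs_fun ger0_norm// leNgt; apply/negP => Sc.
  by apply: xN; exists c => //; rewrite /N cn.
rewrite -Sx; last by lia.
case: ifP => // _; congr EFin; apply: (@path_cost_local _ _ _ _ 1%N) => //.
Qed.

Lemma optimal_cost_value i k u : (i <= n)%N -> (1 <= k <= i)%N -> (0 <= u)%R ->
  optimal_cost S omega n i k u =
  ((survival p mu1 mu2 u)^-1)%:E * value p omega mu1_gt0 mu2_gt0 (n - i) k u.
Proof.
move=> ni ki u0.
have abs_ge0 c x : (0 <= abs_service c x)%R by rewrite /abs_service/= /abs_fun.
have inr : (i + (n - i))%N = n by rewrite subnKC.
rewrite -(optimal_costE mu1_gt0 mu2_gt0 p01 omega01 abs_indep abs_law abs_ge0 inr ki u0).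
rewrite /optimal_cost; congr ereal_inf; apply/seteqP.
by split => [_ [tau ptau <-]|_ [tau ptau <-]]; exists tau => //; rewrite expected_cost_abs.
Qed.

End absolute_value.

Theorem theorem4 (R : realType) (d : measure_display) (Omega : measurableType d)
    (P : probability Omega R) (n : nat) (mu1 mu2 p omega : R)
    (S : nat -> {RV P >-> R})
    (mu1_gt0 : 0 < mu1) (mu2_gt0 : 0 < mu2)
    (p01 : 0 <= p <= 1) (omega01 : 0 <= omega <= 1)
    (S_indep : mutually_independent [pred j | (1 <= j <= n)%N] S)
    (S_law : forall j, (1 <= j <= n)%N -> forall A, measurable A ->
       distribution P (S j) A = hyperexp_prob p mu1 mu2 A) :
  let C := optimal_cost S omega n in
  (forall (i k : nat) (u : R), (1 <= i < n)%N -> (1 <= k <= i)%N -> 0 <= u ->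
     C i k u =
     ereal_inf
       [set ((omega * fbar p mu1 mu2 k u t
              + (1 - omega) * hbar p mu1 mu2 k u)%:E
             + \sum_(2 <= l < k.+1)
                 \int[lebesgue_measure]_(v in `]0%R, t[)
                   ((p_trans p mu1 mu2 k l u v t)%:E * C i.+1 l v)
             + (P_down p mu1 mu2 k u t)%:E * C i.+1 1%N 0%R
             + (P_up p mu1 mu2 u t)%:E * C i.+1 k.+1 (u + t)%R)%E
       | t in [set t : R | 0 <= t]]) /\
  (forall (k : nat) (u : R), (1 <= k <= n)%N -> 0 <= u ->
     C n k u = ((1 - omega) * hbar p mu1 mu2 k u)%:E).
Proof.
move=> C.
have CE i k u : (i <= n)%N -> (1 <= k <= i)%N -> 0 <= u ->
    C i k u = (((survival p mu1 mu2 u)^-1)%:E * value p omega mu1_gt0 mu2_gt0 (n - i) k u)%E.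
  exact: optimal_cost_value.
split=> [i k u /andP[i1 ni] ki u0|k u kn u0]; last first.
  rewrite CE// subnn /= -EFinM; congr EFin.
  by rewrite mulrCA mulKf// gt_eqF// survival_gt0.
have /andP[k1 ki'] := ki.
rewrite CE//; last exact: ltnW.
(* Written as a successor, [n - i] lets [value] unfold to an infimum, into which the positive factor
   is moved. *)
rewrite -subnSK//= -ereal_inf_pZl; last by rewrite invr_gt0 survival_gt0.
congr ereal_inf; rewrite image_comp; apply: eq_imagel => t t0 /=.
apply: (onestep_normalized omega mu1_gt0 mu2_gt0 p01 ki u0 t0) => [l l1|l v l1||l v li v0].
- exact: measurable_value.
- exact: value_ge0.
- exact: value_fin.
- exact: CE.
Qed.
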